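(* Let $\{X_n\}_{n\ge1}$ be a collection of uniformly bounded, independent, mean-zero random variables on a probability space $\Omega$. Then for almost every $\omega\in\Omega$ the following holds: for every measure-preserving system $(X,\Sigma,\mu,\tau)$ and every $f\in L^1(X)$, the series $\sum_{n=1}^\infty\frac{X_n(\omega)}{n}\,\tau^nf$ converges $\mu$-a.e.
   Context: A measure-preserving system $(X,\Sigma,\mu,\tau)$ is a non-atomic $\sigma$-finite measure space $(X,\Sigma,\mu)$ together with a measure-preserving $\mathbb{Z}$-action $\tau$; $\tau^nf$ denotes $f$ composed with the $n$-th iterate of the invertible transformation generating the action. The exceptional null set of $\omega$ does not depend on the system or on $f$. *)

(* Defs.v *)
From mathcomp Require Import all_boot all_order all_algebra.
From mathcomp Require Import finmap.
From mathcomp Require Import all_classical all_reals all_analysis.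

Set Implicit Arguments.
Unset Strict Implicit.
Unset Printing Implicit Defensive.

Import Order.TTheory GRing.Theory Num.Theory.
Import numFieldNormedType.Exports.

Local Open Scope classical_set_scope.
Local Open Scope ring_scope.

(* Mutual independence of the subfamily [X i], [i \in I]: the product rule
   over every finite subset [J] of [I]. *)
Definition mutually_independent (d : measure_display) (Omega : measurableType d)
    (R : realType) (P : probability Omega R) (I : set nat)
    (X : nat -> {RV P >-> R}) : Prop :=
  forall (J : {fset nat}) (B : nat -> set R),
    [set` J] `<=` I ->
    (forall j, j \in J -> measurable (B j)) ->
    P (\bigcap_(j in [set` J]) (X j @^-1` B j)) =
    (\prod_(j <- J) P (X j @^-1` B j))%E.

(* Essential boundedness, with one bound for the whole family. *)
Definition uniformly_bounded (d : measure_display) (Omega : measurableType d)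
    (R : realType) (P : probability Omega R) (I : set nat)
    (X : nat -> {RV P >-> R}) : Prop :=
  exists M : R, forall n, I n -> {ae P, forall w, `|X n w| <= M}.

Definition atom (d : measure_display) (T : measurableType d) (R : realType)
    (mu : {measure set T -> \bar R}) (A : set T) : Prop :=
  [/\ measurable A, (0 < mu A)%E &
      forall B, measurable B -> B `<=` A -> (mu B < mu A)%E -> mu B = 0%E].

Definition non_atomic (d : measure_display) (T : measurableType d)
    (R : realType) (mu : {measure set T -> \bar R}) : Prop :=
  forall A : set T, ~ atom mu A.

(* [tau n] is the action of the integer [n] on the points of [T]. *)
Record measure_preserving_Zaction (d : measure_display) (T : measurableType d)
    (R : realType) (mu : {measure set T -> \bar R}) (tau : int -> T -> T) :
    Prop := {
  Zaction0 : forall x, tau 0 x = x ;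
  ZactionD : forall m n x, tau (m + n) x = tau m (tau n x) ;
  Zaction_measurable : forall n, measurable_fun setT (tau n) ;
  Zaction_preserving : forall n A, measurable A -> mu (tau n @^-1` A) = mu A
}.

Record measure_preserving_system (d : measure_display) (T : measurableType d)
    (R : realType) (mu : {measure set T -> \bar R}) (tau : int -> T -> T) :
    Prop := {
  system_sigma_finite : sigma_finite setT mu ;
  system_non_atomic : non_atomic mu ;
  system_Zaction : measure_preserving_Zaction mu tau
}.

(* [tau^n f]: the generator of the action is [tau 1]. *)
Definition translate (T : Type) (R : Type) (tau : int -> T -> T) (n : nat)
    (f : T -> R) : T -> R :=
  fun x => f (iter n (tau 1) x).

(* Main.v *)
(* Write [blk n] for the integer part of log2 n.  Almost surely, for j <= k, the
   correlations sum_{n in W} X_n X_{n+h}, with n in the j-th dyadic block and n+h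
   in the k-th, maximised over intervals W, have fourth powers whose sum over
   0 < h < 2^(k+1) is O(2^(k + 2j + j/2)), instead of the trivial 2^(k+4j).  For
   k < 4j this follows from fourth moments; for larger k, where a bound on the
   expectation would not be summable in k, the fourth power is expanded and the
   sums over h of products of four distinct X's are controlled in L^2.

   The rest is deterministic given this property of the sequence.  By Calderon's
   transference it suffices to prove a weak type (1,1) maximal inequality for
   sum_n (X_n/n) f(x+n) on the integers.  Let i(y) be the first level from which
   on all dyadic averages of |f| around y are at most 1.  The terms n with
   blk n < i(x+n) matter only for x in a small set.  For s >= 0 keep the terms with
   blk n = i(x+n) + s: expanding the square gives an L^2 bound decaying
   geometrically in s, the diagonal being small because |f(y)| <= 2^i(y), the
   off-diagonal by decorrelation.  The L^2 bound survives the supremum over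
   partial sums because the total variation of the partial sums is integrable: up
   to an error 1/P, P a small power of 2^s, every tail sum is one of O(P^2) tail
   sums starting where a majorant of the variation crosses a fixed level.  This
   majorant is constant on dyadic cells, so that expanding the squares of the cut
   sums still produces correlations over intervals.  Finally one sums over s.

   The same estimate applied to bounded f at a single scale (f bounded by 1, k = s)
   gives convergence for bounded functions, which are dense in L^1. *)
Require Import Defs.
From mathcomp Require Import all_boot all_order all_algebra.
From mathcomp Require Import finmap.
From mathcomp Require Import all_classical all_reals all_analysis.
From mathcomp Require Import measurable_realfun.
From mathcomp Require Import ring lra zify.
Import Order.TTheory GRing.Theory Num.Theory.
Import numFieldNormedType.Exports.
Set Implicit Arguments.
Unset Strict Implicit.
Unset Printing Implicit Defensive.
Local Open Scope classical_set_scope.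
Local Open Scope ring_scope.

(** * Dyadic scales and elementary sums *)

Notation blk := (trunc_log 2).

Lemma blk_bounds (n : nat) : (0 < n)%N -> (2 ^ blk n <= n < 2 ^ (blk n).+1)%N.
Proof. by move=> n0; apply: trunc_log_bounds. Qed.

Lemma blk_le (n m : nat) : (n <= m)%N -> (blk n <= blk m)%N.
Proof. exact: leq_trunc_log. Qed.

Lemma divn_add_bounds (x n L : nat) : (0 < L)%N ->
  (x %/ L + n %/ L <= (x + n) %/ L <= x %/ L + n %/ L + 1)%N.
Proof.
move=> L0; rewrite divnD//; case: (leqP L _) => _ /=; first by rewrite !leqnn !leq_addr.
by rewrite addn0 leqnn leq_addr.
Qed.

Lemma divn_pow_coarsen (x l l' : nat) : (l <= l')%N ->
  (x %/ 2 ^ l' = (x %/ 2 ^ l) %/ 2 ^ (l' - l))%N.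
Proof. by move=> ll'; rewrite -divnMA -expnD subnKC. Qed.

Section Sums.
Variable R : realType.
Implicit Types (f g : nat -> R).

(** Telescoping: [phi] drops by at least the [j]-th term at every step. Inside a run of [m] equal
    quotients it is linear; at the end of a run [m + 1] times a power becomes [2 * m] times half of
    it. *)
Lemma sum_geo_floor (m s t : nat) : (0 < m)%N ->
  \sum_(s <= j < t) (2^-1 : R) ^+ (j %/ m) <= (2 * m)%:R * 2^-1 ^+ (s %/ m).
Proof.
move=> m0.
have [ts|st] := leqP t s.
  by rewrite big_geq// mulr_ge0// exprn_ge0// invr_ge0.
pose phi (j : nat) : R := (2 * m - j %% m)%:R * 2^-1 ^+ (j %/ m).
have phi0 j : 0 <= phi j by rewrite mulr_ge0// exprn_ge0// invr_ge0.
have step j : (2^-1 : R) ^+ (j %/ m) <= phi j - phi j.+1.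
  rewrite /phi; have := divn_eq j m; have := ltn_pmod j m0.
  set q := (j %/ m)%N; set r := (j %% m)%N => rm jE.
  have p0 : 0 <= (2^-1 : R) ^+ q by rewrite exprn_ge0// invr_ge0.
  have [rm1|rm1] := ltnP r.+1 m.
    have -> : (j.+1 %/ m = q)%N by rewrite jE -addnS divnMDl// divn_small// addn0.
    have -> : (j.+1 %% m = r.+1)%N by rewrite jE -addnS modnMDl modn_small.
    have -> : (2 * m - r = (2 * m - r.+1).+1)%N by lia.
    rewrite -mulrBl -[leLHS]mul1r ler_wpM2r// -natr1; lra.
  have rE : r.+1 = m by lia.
  have -> : (j.+1 %/ m = q.+1)%N by rewrite jE -addnS rE divnMDl// divnn m0 addn1.
  have -> : (j.+1 %% m = 0)%N by rewrite jE -addnS rE modnMDl modnn.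
  rewrite subn0 exprS.
  have -> : (2 * m - r = m.+1)%N by lia.
  rewrite natrM -natr1 mulrA (_ : 2 * m%:R * 2^-1 = m%:R :> R); last by field.
  rewrite -mulrBl -[leLHS]mul1r ler_wpM2r//; lra.
apply: (@le_trans _ _ (\sum_(s <= j < t) (phi j - phi j.+1))).
  by apply: ler_sum => j _; exact: step.
rewrite (@telescope_sumr_eq _ _ _ (fun j => - phi j) _ (ltnW st)); last first.
  by move=> k _; rewrite opprK addrC.
rewrite opprK addrC; apply: (@le_trans _ _ (phi s)); first by have := phi0 t; lra.
rewrite /phi ler_wpM2r ?exprn_ge0 ?invr_ge0//.
by rewrite ler_nat; lia.
Qed.

Lemma sum_ord_itv_le (D u v : nat) : 
  \sum_(x < D) ((u <= x < v)%N)%:R <= (v - u)%:R :> R.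
Proof.
rewrite -(big_mkord xpredT (fun x => ((u <= x < v)%N)%:R)) -natr_sum ler_nat.
rewrite -big_mkcond/=.
rewrite (@leq_trans (\sum_(u <= x < v) 1))//; last by rewrite sum_nat_const_nat muln1.
rewrite [leqRHS]big_mkcond/=.
rewrite !sum1_count.
rewrite -!size_filter.
apply: uniq_leq_size; first by rewrite filter_uniq// iota_uniq.
move=> x; rewrite !mem_filter !mem_index_iota => /andP[]; lia.
Qed.

(** Turns a sum cut by a condition into a sum over an interval: a convex predicate selects exactly
    the integers from its least to its greatest solution in the range. *)
Lemma sum_convex (F : nat -> R) (Q : pred nat) (A B : nat) :
  (forall n1 n2 n3, (A <= n1)%N -> (n3 < B)%N -> (n1 <= n2 <= n3)%N -> Q n1 -> Q n3 -> Q n2) ->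
  exists lo hi, [/\ (A <= lo)%N, (hi <= B)%N &
    \sum_(A <= n < B) F n * (Q n)%:R = \sum_(lo <= n < hi) F n].
Proof.
move=> cvx.
pose T n := [&& (A <= n)%N, (n < B)%N & Q n].
have [[n0 Tn0]|noT] := pselect (exists n, T n); last first.
  (* Without solutions any empty interval does; [maxn A B] keeps [A <= lo] also when [B < A]. *)
  exists (maxn A B), B; split; rewrite ?leq_maxl//.
  rewrite [RHS]big_geq ?leq_maxr// big_nat big1// => n /andP[An nB].
  by case: (boolP (Q n)) => [Qn|]; rewrite ?mulr0//; case: noT; exists n; apply/and3P.
have exT : exists n, T n by exists n0.
have bT n : T n -> (n <= B)%N by case/and3P => _ /ltnW.
have [lo /and3P[lo1 lo2 lo3] lomin] := ex_minnP exT.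
have [hi /and3P[hi1 hi2 hi3] himax] := ex_maxnP exT bT.
have lohi : (lo <= hi)%N by apply: lomin; apply/and3P.
exists lo, hi.+1; split => //.
rewrite (big_cat_nat lo1 (ltnW lo2))/= [X in X + _]big_nat big1 ?add0r; last first.
  move=> n /andP[An nlo]; case: (boolP (Q n)) => Qn; rewrite ?mulr0//.
  suff : (lo <= n)%N by rewrite leqNgt nlo.
  by apply: lomin; apply/and3P; split => //; apply: ltn_trans nlo lo2.
rewrite (big_cat_nat (leqW lohi) hi2)/= [X in _ + X]big_nat [X in _ + X]big1 ?addr0; last first.
  move=> n /andP[hn nB]; case: (boolP (Q n)) => Qn; rewrite ?mulr0//.
  suff : (n <= hi)%N by rewrite leqNgt hn.
  by apply: himax; apply/and3P; split => //; apply: leq_trans (ltnW hn).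
rewrite !big_nat; apply: eq_bigr => n /andP[n1 n2].
by rewrite (cvx lo n hi) ?mulr1// n1.
Qed.

(** The substitution [n = y - x]. Subtraction is truncated, so the factor [(n <= y)] removes the [n]
    that come from no [x]. *)
Lemma sum_ord_reindex_sub (G : nat -> R) (D y A B : nat) : (y < D)%N ->
  (forall x, (x < D)%N -> G x != 0 -> (A <= y - x < B)%N && (x <= y)%N) ->
  \sum_(x < D) G x = \sum_(A <= n < B) G (y - n)%N * (n <= y)%N%:R.
Proof.
move=> yD hG.
transitivity (\sum_(x < D) \sum_(A <= n < B) G x * (x + n == y)%N%:R).
  apply: eq_bigr => x _; have [->|G0] := eqVneq (G x) 0.
    by rewrite big1// => n _; rewrite mul0r.
  have /andP[/andP[h1 h2] h3] := hG x (ltn_ord x) G0.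
  rewrite (bigD1_seq (y - x)%N) ?iota_uniq ?mem_index_iota ?h1//=.
  rewrite subnKC// eqxx mulr1 big1 ?addr0// => n nx.
  by rewrite (_ : _ == _ = false) ?mulr0//; apply/eqP => E; move: nx; rewrite -E addKn eqxx.
rewrite exchange_big/=; apply: eq_bigr => n _.
have [ny|yn] := leqP n y; last first.
  rewrite mulr0 big1// => x _; rewrite (_ : _ == _ = false) ?mulr0//.
  by apply/eqP => E; move: yn; rewrite -E; lia.
have lt : (y - n < D)%N by lia.
rewrite (bigD1 (Ordinal lt))//= subnK// eqxx !mulr1 big1 ?addr0// => x xn.
rewrite (_ : _ == _ = false) ?mulr0//; apply/eqP => E; move/eqP: xn; apply.
by apply: val_inj => /=; lia.
Qed.

End Sums.

(** * The core estimate on the integers *)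

Section Core.
Variables (R : realType) (d : nat -> R) (M : R).
Hypothesis d0 : d 0%N = 0.

Definition dyadic_weight (n : nat) : R := d n * 2 ^+ blk n.
Local Notation e := dyadic_weight.
Hypothesis eM : forall n, `|e n| <= M.

Lemma weightE (n : nat) : d n = e n / 2 ^+ blk n.
Proof. by rewrite /dyadic_weight mulfK// expf_neq0. Qed.

Lemma weight_le (n : nat) : `|d n| <= M / 2 ^+ blk n.
Proof.
rewrite weightE normrM normfV [X in _ / X]ger0_norm ?exprn_ge0//.
by rewrite ler_wpM2r// invr_ge0 exprn_ge0.
Qed.

Lemma M_ge0 : 0 <= M. Proof. exact: le_trans (eM 0). Qed.

Definition pair_corr (k h n : nat) : R := e n * (e (n + h)%N * (blk (n + h) == k)%:R).
(** Prefixes of the block suffice: an interval is a difference of two prefixes, whence the factor 2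
    in [corr_max_itv]. *)
Definition corr_max (j k h : nat) : R :=
  \big[Num.max/0]_(b < (2 ^ j.+1).+1) `|\sum_(2 ^ j <= n < b) pair_corr k h n|.

Lemma corr_max_prefix (j k h b : nat) : (b <= 2 ^ j.+1)%N ->
  `|\sum_(2 ^ j <= n < b) pair_corr k h n| <= corr_max j k h.
Proof.
move=> bj; have lt : (b < (2 ^ j.+1).+1)%N by [].
exact: (@le_bigmax _ _ _ 0 (fun b : 'I_(2 ^ j.+1).+1 =>
  `|\sum_(2 ^ j <= n < b) pair_corr k h n|) (Ordinal lt)).
Qed.

Lemma corr_max_ge0 (j k h : nat) : 0 <= corr_max j k h.
Proof. by apply: le_trans (corr_max_prefix k h (leq0n _)). Qed.

Lemma corr_max_itv (j k h lo hi : nat) : (2 ^ j <= lo)%N -> (hi <= 2 ^ j.+1)%N ->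
  `|\sum_(lo <= n < hi) pair_corr k h n| <= 2 * corr_max j k h.
Proof.
move=> jlo hij; have [hl|lh] := leqP hi lo.
  by rewrite big_geq// normr0 mulr_ge0// corr_max_ge0.
have -> : \sum_(lo <= n < hi) pair_corr k h n =
    \sum_(2 ^ j <= n < hi) pair_corr k h n - \sum_(2 ^ j <= n < lo) pair_corr k h n.
  by rewrite (big_cat_nat jlo (ltnW lh))/= [RHS]addrC addKr.
rewrite (le_trans (ler_normB _ _))// mulr2n mulrDl mul1r lerD// corr_max_prefix//.
by rewrite (leq_trans _ hij)// ltnW.
Qed.

(* [gain j] is 2^(j/16) up to a constant; exponents are floored to stay among
   natural powers. *)
Definition gain (j : nat) : R := 2 ^+ (j %/ 16).

Lemma gain_gt0 (j : nat) : 0 < gain j. Proof. exact: exprn_gt0. Qed.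

Variable C : R.
Hypothesis C0 : 0 <= C.
Hypothesis decorrelated : forall j k, (j <= k)%N ->
  \sum_(1 <= h < 2 ^ k.+1) corr_max j k h ^+ 4 <= C * 2 ^+ (k + 2 * j) * gain j ^+ 8.

(** * One instance of the decomposition: levels, cells and the potential *)

Section Instance.
(** [f y] meets only the weights of block [kap y]. Later [kap y] is [lev y + s], or constantly [s]
    for a function bounded by 1. [f_le] limits heights; [f_avg] limits the mass of one level in a
    cell that is not too short. *)
Variables (s D : nat) (f : nat -> R) (kap : nat -> nat).
Hypothesis kap_ge : forall y, (s <= kap y)%N.
Hypothesis f_le : forall y, `|f y| <= 2 ^+ (kap y - s).
Hypothesis f_avg : forall j l q, (j <= l + s)%N ->
  \sum_(y < D) `|f y| * ((y %/ 2 ^ l == q) && (kap y == j))%N%:R <= 2 ^+ l.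

(** As [96 = 6 * 16], [P ^+ 6 <= gain s]; the maximal argument below loses only [P ^+ 5]. *)
Let a := (s %/ 96)%N.
Let P : R := 2 ^+ a.

Let a_le_s : (a <= s)%N. Proof. exact: leq_div. Qed.
Let a_le_kap y : (a <= kap y)%N. Proof. exact: leq_trans (kap_ge y). Qed.
Let P_gt0 : 0 < P. Proof. exact: exprn_gt0. Qed.
Let M0 := M_ge0.

Definition cell (j x : nat) := (x %/ 2 ^ (j - a))%N.
Definition cdist (x y : nat) := (cell (kap y) y - cell (kap y) x)%N.
(** Cell version of: [y - x] lies in the block of [kap y] and is at least [n]. The numbers [2 ^ a]
    and [2 ^ a.+1] are the ends of that block measured in cells. Rounding loses no genuine pair, by
    [act_hit]. *)
Definition act (n x y : nat) := [&& (2 ^ a <= cdist x y)%N, (cdist x y <= 2 ^ a.+1)%N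
  & (blk n < kap y)%N || ((blk n == kap y) && (n %/ 2 ^ (blk n - a) <= cdist x y)%N)].
(* Up to constants and a small error, bounds the total variation after [n] of the
   partial sums at [x]; [act] depends on [x] only through cells, unlike [y - x]. *)
Definition potential (n x : nat) : R :=
  \sum_(y < D) `|f y| * 2^-1 ^+ kap y * (act n x y)%:R.
Local Notation Rv := potential.

Lemma act_mono (n n' x y : nat) : (n <= n')%N -> act n' x y -> act n x y.
Proof.
rewrite /act => nn' /and3P[-> ->/=]; have := blk_le nn'.
rewrite leq_eqVlt => /orP[/eqP bE|blt].
  by rewrite -bE => /orP[->//|/andP[-> h]]; rewrite (leq_trans _ h) ?orbT// leq_div2r.
by move=> /orP[h|/andP[/eqP <- _]]; [rewrite (ltn_trans blt h)|rewrite blt].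
Qed.

(** Only levels [kap y >= blk n] can be active at [n], and their cells are unions of cells of level
    [blk n]. *)
Lemma act_cell (n x x' y : nat) : cell (blk n) x = cell (blk n) x' ->
  act n x y = act n x' y.
Proof.
move=> xx'; have [bk|kb] := leqP (blk n) (kap y); last first.
  rewrite /act ltnNge (ltnW kb)/= (_ : (_ == kap y) = false) ?andbF//.
  by apply/eqP => h; rewrite h ltnn in kb.
suff E : cdist x y = cdist x' y by rewrite /act E.
rewrite /cdist; congr (_ - _)%N; rewrite /cell.
have le : (blk n - a <= kap y - a)%N by rewrite leq_sub2r.
by rewrite (divn_pow_coarsen x le) (divn_pow_coarsen x' le) -/(cell _ x) xx'.
Qed.

Lemma act_hit (n x y : nat) : (0 < y - x)%N -> blk (y - x) = kap y ->
  (n <= y - x)%N -> act n x y /\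
  (cdist x y <= (y - x) %/ 2 ^ (kap y - a) + 1)%N.
Proof.
move=> yx0 bE nyx.
have L0 : (0 < 2 ^ (kap y - a))%N by rewrite expn_gt0.
have /andP[lo hi] := divn_add_bounds x (y - x) L0.
rewrite subnKC in lo hi; last by rewrite ltnW// -subn_gt0.
have cd1 : ((y - x) %/ 2 ^ (kap y - a) <= cdist x y)%N.
  by rewrite /cdist /cell leq_subRL ?(leq_trans _ lo)// leq_addr.
have cd2 : (cdist x y <= (y - x) %/ 2 ^ (kap y - a) + 1)%N.
  by rewrite /cdist /cell leq_subLR addnA.
split=> //; apply: (act_mono nyx).
have /andP[b1 b2] := blk_bounds yx0; rewrite bE in b1 b2.
have b1' : (2 ^ a <= (y - x) %/ 2 ^ (kap y - a))%N.
  by rewrite leq_divRL// -expnD subnKC.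
have b2' : ((y - x) %/ 2 ^ (kap y - a) < 2 ^ a.+1)%N.
  by rewrite ltn_divLR// -expnD addSn subnKC.
by rewrite /act (leq_trans b1' cd1) bE eqxx cd1 orbT andbT/= (leq_trans cd2)// addn1.
Qed.

Lemma potential_noninc (n n' x : nat) : (n <= n')%N -> Rv n' x <= Rv n x.
Proof.
move=> nn'; apply: ler_sum => y _; apply: ler_wpM2l.
  by rewrite mulr_ge0// exprn_ge0// invr_ge0.
by rewrite ler_nat; case: (act n' x y) (@act_mono n n' x y nn') => // ->.
Qed.

Lemma potential_ge0 (n x : nat) : 0 <= Rv n x.
Proof.
by apply: sumr_ge0 => y _; rewrite !mulr_ge0// exprn_ge0// invr_ge0.
Qed.

Lemma potential_cell (n x x' : nat) : cell (blk n) x = cell (blk n) x' ->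
  Rv n x = Rv n x'.
Proof. by move=> E; apply: eq_bigr => y _; rewrite (act_cell _ E). Qed.

Lemma cell_coarse (j j' x x' : nat) : (j <= j')%N -> cell j x = cell j x' ->
  cell j' x = cell j' x'.
Proof.
move=> jj' xx'; have le : (j - a <= j' - a)%N by rewrite leq_sub2r.
by rewrite /cell (divn_pow_coarsen x le) (divn_pow_coarsen x' le) -/(cell _ x) xx'.
Qed.

(** This is [f_avg] at the cell length [2 ^ (j - a)], admissible because [a <= s]. *)
Lemma cell_mass (j q : nat) :
  \sum_(y < D) `|f y| * 2^-1 ^+ kap y * ((kap y == j) && (cell j y == q))%:R <= P^-1.
Proof.
have [js|sj] := ltnP j s.
  rewrite big1 ?invr_ge0 ?exprn_ge0// => y _.
  by rewrite (_ : (kap y == j) = false) ?mulr0//; apply/eqP => kj; have := kap_ge y; lia.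
have aj : (a <= j)%N by lia.
apply: (@le_trans _ _ (2^-1 ^+ j * \sum_(y < D) `|f y| *
    ((y %/ 2 ^ (j - a) == q) && (kap y == j))%N%:R)).
  rewrite mulr_sumr; apply: ler_sum => y _.
  rewrite [(_ == j) && _]andbC /cell; case: eqP => /=; last by rewrite !mulr0.
  by case: eqP => [<-|]; rewrite ?mulr0// !mulr1 mulrC.
apply: (@le_trans _ _ (2^-1 ^+ j * 2 ^+ (j - a))).
  by rewrite ler_wpM2l ?exprn_ge0 ?invr_ge0// f_avg//; lia.
by rewrite /P exprB// ?unitfE// mulrA -exprMn mulVf// expr1n mul1r.
Qed.

(** A term met between [n1] and [n2] is active at [n1]. If it is inactive at [n2], the drop of the
    potential pays for it. Otherwise [kap y = blk n2] and rounding confines [y] to two cells, each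
    of weighted mass at most [P^-1]. *)
Lemma variation_le (n1 n2 x : nat) : (0 < n1)%N -> (n1 <= n2)%N ->
  \sum_(y < D) `|f y| * `|d (y - x)| *
     ((blk (y - x) == kap y) && (n1 <= y - x < n2))%N%:R
  <= M * (Rv n1 x - Rv n2 x + 2 / P).
Proof.
move=> n10 n12.
pose b2 := (n2 %/ 2 ^ (blk n2 - a))%N; pose q := (cell (blk n2) x + b2)%N.
pose m (c : nat) (y : nat) : R :=
  `|f y| * 2^-1 ^+ kap y * ((kap y == blk n2) && (cell (blk n2) y == c))%:R.
apply: (@le_trans _ _ (M * \sum_(y < D) (`|f y| * 2^-1 ^+ kap y * (act n1 x y)%:R -
    `|f y| * 2^-1 ^+ kap y * (act n2 x y)%:R + (m q y + m q.+1 y)))); last first.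
  rewrite ler_wpM2l// big_split/= sumrB lerD2l big_split/=.
  by rewrite [leRHS]mulr_natl mulr2n lerD// cell_mass.
rewrite mulr_sumr; apply: ler_sum => y _.
set w := `|f y| * 2^-1 ^+ kap y.
have w0 : 0 <= w by rewrite mulr_ge0// exprn_ge0// invr_ge0.
rewrite /m -/w -mulrBr -2!mulrDr.
have [/andP[/eqP bE /andP[h1 h2]]|_] := boolP (_ && _)%N; last first.
  rewrite mulr0 mulr_ge0// mulr_ge0// addr_ge0//.
  rewrite subr_ge0 ler_nat.
  by case: (act n2 x y) (@act_mono n1 n2 x y n12) => // ->.
have yx0 : (0 < y - x)%N by exact: leq_trans h1.
have [ac1 cd] := act_hit yx0 bE h1.
rewrite ac1 mulr1; apply: (@le_trans _ _ (M * (w * 1))).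
  rewrite mulr1 /w mulrCA ler_wpM2l//.
  by rewrite exprVn -bE weight_le.
rewrite ler_wpM2l// ler_wpM2l//.
have [ac2|_] := boolP (act n2 x y); last by rewrite subr0 lerDl addr_ge0.
rewrite subrr add0r -natrD ler1n.
have kE : kap y = blk n2.
  apply/eqP; rewrite eqn_leq -{1}bE blk_le ?(ltnW h2)//=.
  by case/and3P: ac2 => _ _ /orP[/ltnW//|/andP[/eqP-> _]].
have cd2 : (b2 <= cdist x y)%N.
  by case/and3P: ac2 => _ _; rewrite kE ltnn/= => /andP[_].
have cd3 : (cdist x y <= b2 + 1)%N.
  by rewrite (leq_trans cd)// leq_add2r kE leq_div2r// ltnW.
rewrite kE eqxx/= /q.
have cdp : (0 < cdist x y)%N.
  by case/and3P: ac2 => h _ _; rewrite (leq_trans _ h)// expn_gt0.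
move: cd2 cd3 cdp; rewrite /cdist kE => cd2 cd3 cdp.
have : (cell (blk n2) y = cell (blk n2) x + b2 \/ cell (blk n2) y = (cell (blk n2) x + b2).+1)%N.
  move: (b2) cd2 cd3 cdp; move: (cell _ y) (cell _ x) => u v w'; clear; lia.
by case=> ->; rewrite eqxx ?orbT// addn1.
Qed.

(** For each [y] the active [x] fill at most [2 ^ a + 1] cells, hence at most [2 * 2 ^ kap y]
    points, which the weight [2^-1 ^+ kap y] cancels. *)
Lemma sum_potential_le : \sum_(x < D) Rv 1 x <= 2 * \sum_(y < D) `|f y|.
Proof.
rewrite /potential exchange_big/= mulr_sumr; apply: ler_sum => y _.
rewrite -mulr_sumr.
set L := (2 ^ (kap y - a))%N.
have L0 : (0 < L)%N by rewrite expn_gt0.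
pose c := cell (kap y) y.
apply: (@le_trans _ _ (`|f y| * 2^-1 ^+ kap y * ((2 ^ a).+1 * L)%N%:R)).
  rewrite ler_wpM2l ?mulr_ge0 ?exprn_ge0 ?invr_ge0//.
  apply: le_trans (_ : _ <= ((c - 2 ^ a).+1 * L - (c - 2 ^ a.+1) * L)%N%:R) _.
    apply: le_trans (sum_ord_itv_le R D _ _); apply: ler_sum => x _.
    rewrite ler_nat; case: (boolP (act 1 x y)) => //= /and3P[h1 h2 _].
    rewrite lt0b; move: h1 h2; rewrite /cdist -/c /cell -/L => h1 h2.
    apply/andP; split; first by rewrite -leq_divRL// leq_subLR addnC -leq_subLR.
    rewrite -ltn_divLR//; have : (0 < 2 ^ a)%N by [rewrite expn_gt0].
    by move: h1 h2; set A := (2 ^ a)%N; set B := (2 ^ a.+1)%N; set X := (x %/ L)%N; lia.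
  rewrite ler_nat -mulnBl leq_mul2r.
  by rewrite expnS; apply/orP; right; lia.
have h : ((2 ^ a).+1 * L)%N%:R <= 2 * 2 ^+ kap y :> R.
  rewrite -natrX -natrM ler_nat -[kap y in leqRHS](subnKC (a_le_kap y)) expnD mulnA leq_mul2r.
  by apply/orP; right; have : (0 < 2 ^ a)%N by [rewrite expn_gt0]; lia.
apply: (@le_trans _ _ (`|f y| * 2^-1 ^+ kap y * (2 * 2 ^+ kap y))).
  by rewrite ler_wpM2l// mulr_ge0// exprn_ge0// invr_ge0.
rewrite -mulrA [X in _ * X]mulrCA -exprMn mulVf// expr1n mulr1 mulrC//.
Qed.

(** * Tail sums replaced by sums cut at a level of the potential *)

Definition cut_term (t x y : nat) : R :=
  d (y - x) * ((blk (y - x) == kap y) && (Rv (y - x) x < t%:R / P))%:R.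
Definition cut_sum (t x : nat) : R := \sum_(y < D) f y * cut_term t x y.

(** Let [t / P] be the first multiple of [P^-1] strictly above the potential at [N]. By monotonicity
    the cut at this level keeps the terms from some [m <= N] on; between [m] and [N] the potential
    drops by at most [P^-1], so [variation_le] bounds the difference by [3 * M / P]. *)
Lemma tail_cut (N x : nat) : (0 < N)%N -> Rv 1 x <= P ->
  exists2 t : nat, (t <= 2 ^ (2 * a) + 1)%N &
   `|(\sum_(y < D) f y * d (y - x) * ((blk (y - x) == kap y) && (N <= y - x)%N)%:R)
     - cut_sum t x| <= 3 * M / P.
Proof.
move=> N0 RP.
have PR0 : 0 <= P * Rv N x by rewrite mulr_ge0 ?potential_ge0// ltW.
have /andP[t1 t2] := truncn_itv PR0.
set t := (Num.truncn (P * Rv N x)).+1; exists t.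
  rewrite /t addn1 ltnS -(ler_nat R) (le_trans t1)// natrX mulnC exprM expr2.
  by rewrite ler_wpM2l ?(ltW P_gt0)// (le_trans _ RP)// potential_noninc.
have RNt : Rv N x < t%:R / P by rewrite ltr_pdivlMr// mulrC.
have tRN : t%:R / P <= Rv N x + P^-1.
  by rewrite ler_pdivrMr// mulrDl mulVf ?gt_eqF// /t -natr1 lerD2r [leRHS]mulrC.
have exn : exists n, (0 < n)%N && (Rv n x < t%:R / P) by exists N; rewrite N0.
have [m /andP[m0 Rm] mmin] := ex_minnP exn.
have mN : (m <= N)%N by apply: mmin; rewrite N0.
have cutE n : (0 < n)%N -> (Rv n x < t%:R / P) = (m <= n)%N.
  move=> n0; apply/idP/idP => [h|mn]; first by apply: mmin; rewrite n0.
  exact: le_lt_trans (potential_noninc x mn) Rm.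
rewrite /cut_sum -sumrB.
apply: le_trans (ler_norm_sum _ _ _) _.
apply: (@le_trans _ _ (M * (Rv m x - Rv N x + 2 / P))); last first.
  rewrite -mulrA mulrCA ler_wpM2l//.
  apply: (@le_trans _ _ (t%:R / P - Rv N x + 2 / P)).
    by rewrite lerD2r lerD2r ltW.
  have -> : 3 / P = P^-1 + 2 / P by field; rewrite gt_eqF.
  by rewrite lerD2r lerBlDl.
apply: le_trans (variation_le x m0 mN); apply: ler_sum => y _.
rewrite /cut_term mulrA -mulrBr normrM normrM.
have [->|yx0] := posnP (y - x)%N; first by rewrite d0 normr0 mulr0 !mul0r.
rewrite ler_wpM2l ?mulr_ge0// cutE//; case: (blk _ == _) => /=; last by rewrite subrr normr0.
have [Ny|yN] := leqP N (y - x); first by rewrite (leq_trans mN Ny) subrr normr0.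
by rewrite sub0r normrN andbT normr_nat.
Qed.

(** Substitute [n = y - x] and split by the cell distance [c], which takes at most [3 * P] values.
    For fixed [c] the cell of [x] is fixed, the potentials depend on [x] only through it and so are
    monotone in [n]; the surviving [n] form an interval, costing at most [2 * corr_max]. *)
Lemma cut_corr (t y z : nat) : (y < D)%N -> (y < z)%N ->
  `|\sum_(x < D) cut_term t x y * cut_term t x z| <=
  6 * P * (2^-1 ^+ kap y * 2^-1 ^+ kap z * corr_max (kap y) (kap z) (z - y)) *
  ((kap y <= kap z)%N && (z - y < 2 ^ (kap z).+1)%N)%:R.
Proof.
move=> yD yz.
set j := kap y; set k := kap z; set h := (z - y)%N.
pose G x := cut_term t x y * cut_term t x z.
have G0 x : G x != 0 -> [/\ (0 < y - x)%N, blk (y - x) = j & blk (z - x) = k].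
  rewrite /G /cut_term; have [->|yx0] := posnP (y - x)%N; first by rewrite d0 !mul0r eqxx.
  case: (blk (y - x) =P kap y) => [->|]; last by rewrite mulr0 mul0r eqxx.
  case: (blk (z - x) =P kap z) => [->//|]; last by rewrite !mulr0 eqxx.
have [/andP[jk hk]|hjk] := boolP (_ && _); last first.
  rewrite mulr0 big1 ?normr0// => x _; apply/eqP; apply: contraNT hjk => /G0[yx0 bj bk].
  rewrite -bj -bk blk_le; last by lia.
  have /andP[_] : (2 ^ blk (z - x) <= z - x < 2 ^ (blk (z - x)).+1)%N.
    by apply: blk_bounds; lia.
  by rewrite /h; lia.
rewrite mulr1.
rewrite (sum_ord_reindex_sub (G := G) (A := 2 ^ j) (B := 2 ^ j.+1) yD); last first.
  move=> x _ /G0[yx0 bj _]; rewrite -{1 2}bj blk_bounds//=; lia.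
pose Q c n := [&& (n <= y)%N, (cell j y - cell j (y - n) == c)%N,
   Rv n (y - n) < t%:R / P & Rv (n + h) (y - n) < t%:R / P].
have GE n : (2 ^ j <= n < 2 ^ j.+1)%N -> G (y - n)%N * (n <= y)%N%:R =
    \sum_(c < (2 ^ a.+1).+1) 2^-1 ^+ j * 2^-1 ^+ k * pair_corr k h n * (Q c n)%:R.
  move=> /andP[n1 n2]; have bn : blk n = j by apply: trunc_log_eq => //; rewrite n1.
  have [ny|yn] := leqP n y; last first.
    by rewrite mulr0 big1// => c _; rewrite /Q leqNgt yn/= mulr0.
  have yxE : (y - (y - n) = n)%N by rewrite subKn.
  have zxE : (z - (y - n) = n + h)%N by rewrite /h; lia.
  have n0 : (0 < n)%N by rewrite (leq_trans _ n1)// expn_gt0.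
  have ac : act n (y - n) y.
    by have := @act_hit n (y - n) y; rewrite yxE => /(_ n0 bn (leqnn n)) [].
  have clt : (cell j y - cell j (y - n) < (2 ^ a.+1).+1)%N.
    by case/and3P: ac.
  rewrite (bigD1 (Ordinal clt))//= big1 ?addr0; last first.
    move=> c cn; rewrite /Q (_ : (_ == nat_of_ord c) = false) ?andbF ?mulr0//.
    by apply/eqP => E; move/eqP: cn; apply; apply: val_inj.
  rewrite mulr1 /Q ny eqxx/= /G /cut_term yxE zxE bn eqxx/= /pair_corr.
  rewrite /dyadic_weight bn -/j -/k;
   case: (blk (n + h) =P k) => [->|_]/=; last by rewrite !mulr0 mul0r.
  rewrite [in RHS]mulr1 -mulnb natrM !exprVn; field; rewrite !expf_neq0//.
rewrite big_nat (eq_bigr _ GE) -big_nat exchange_big/=.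
apply: le_trans (ler_norm_sum _ _ _) _.
apply: (@le_trans _ _ (\sum_(c < (2 ^ a.+1).+1) 2^-1 ^+ j * 2^-1 ^+ k * (2 * corr_max j k h))).
  apply: ler_sum => c _.
  have cvx n1 n2 n3 : (2 ^ j <= n1)%N -> (n3 < 2 ^ j.+1)%N -> (n1 <= n2 <= n3)%N ->
      Q c n1 -> Q c n3 -> Q c n2.
    move=> h1 h3 /andP[h12 h23] /and4P[q1 /eqP q2 q3 q4] /and4P[p1 /eqP p2 _ _].
    have ny n : (cell j (y - n) <= cell j y)%N by rewrite leq_div2r// leq_subr.
    have c12 : (cell j (y - n2) <= cell j (y - n1))%N by rewrite leq_div2r// leq_sub2l.
    have c23 : (cell j (y - n3) <= cell j (y - n2))%N by rewrite leq_div2r// leq_sub2l.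
    have cE : cell j (y - n2) = cell j (y - n1).
      by have := ny n1; have := ny n3; move: p2 q2 c12 c23; lia.
    have b2 : blk n2 = j.
      by apply: trunc_log_eq => //; rewrite (leq_trans h1 h12) (leq_ltn_trans h23 h3).
    apply/and4P; split; first by exact: leq_trans p1.
    - by rewrite cE q2.
    (* [y - n2] shares a cell with [y - n1], so both potentials can be compared at one point. *)
    - rewrite (@potential_cell n2 _ (y - n1)) ?b2//.
      exact: le_lt_trans (potential_noninc _ h12) q3.
    - rewrite (@potential_cell (n2 + h) _ (y - n1)); last first.
        by apply: cell_coarse cE; rewrite -b2 blk_le// leq_addr.
      by apply: le_lt_trans (potential_noninc _ _) q4; rewrite leq_add2r.
  have [lo [hi [jlo hij ->]]] := sum_convex (fun n => 2^-1 ^+ j * 2^-1 ^+ k * pair_corr k h n) cvx.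
  rewrite -mulr_sumr normrM ger0_norm ?mulr_ge0 ?exprn_ge0 ?invr_ge0//.
  by rewrite ler_wpM2l ?corr_max_itv// mulr_ge0// exprn_ge0// invr_ge0.
rewrite sumr_const card_ord -[leLHS]mulr_natl.
have hP : (2 ^ a.+1).+1%:R <= 3 * P.
  rewrite /P -natrX -natrM ler_nat expnS; have : (0 < 2 ^ a)%N by [rewrite expn_gt0]; lia.
apply: (@le_trans _ _ (3 * P * (2^-1 ^+ j * 2^-1 ^+ k * (2 * corr_max j k h)))).
  by rewrite ler_wpM2r// !mulr_ge0 ?exprn_ge0 ?invr_ge0 ?corr_max_ge0.
rewrite le_eqVlt; apply/orP; left; apply/eqP; ring.
Qed.

(** * L2 bound for the cut sums *)

Lemma le_threshold_pow4 (g rho : R) : 0 <= g -> 0 < rho -> g <= rho + g ^+ 4 / rho ^+ 3.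
Proof.
move=> g0 r0; have [gr|rg] := leP g rho.
  by rewrite (le_trans gr)// lerDl divr_ge0 ?exprn_ge0// ltW.
apply: (@le_trans _ _ (g ^+ 4 / rho ^+ 3)); last by rewrite lerDr ltW.
rewrite ler_pdivlMr ?exprn_gt0// [leRHS]exprS ler_wpM2l//.
by rewrite lerXn2r ?nnegrE// ltW.
Qed.

(** Split [corr_max] at [rho = 2 ^+ j / gain j]. Below [rho], use that level [j] has mass at most
    [3 * 2 ^+ k] in the three cells of length [2 ^ k] containing the relevant [y]. Above it,
    [|f y| <= 2 ^+ j] and decorrelation leave [C * gain j ^+ 11 / 2 ^+ j], and
    [gain j ^+ 12 <= 2 ^+ j]. *)
Lemma cross_scale (j z : nat) : (z < D)%N -> (s <= j <= kap z)%N ->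
  \sum_(y < D) `|f y| * (2^-1 ^+ j * 2^-1 ^+ kap z * corr_max j (kap z) (z - y)) *
   [&& kap y == j, (y < z)%N & (z - y < 2 ^ (kap z).+1)%N]%:R <= (3 + C) / gain j.
Proof.
move=> zD /andP[sj jk]; set k := kap z in jk *.
have p0 : 0 < gain j := gain_gt0 j.
pose rho : R := 2 ^+ j / gain j.
have rho0 : 0 < rho by rewrite divr_gt0// exprn_gt0.
pose w : R := 2^-1 ^+ j * 2^-1 ^+ k.
have w0 : 0 <= w by rewrite mulr_ge0// exprn_ge0// invr_ge0.
pose B y := [&& kap y == j, (y < z)%N & (z - y < 2 ^ k.+1)%N].
apply: (@le_trans _ _ (w * rho * \sum_(y < D) `|f y| * (B y)%:R +
   w * rho ^- 3 * \sum_(y < D) `|f y| * corr_max j k (z - y) ^+ 4 * (B y)%:R)).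
  rewrite !mulr_sumr -big_split/=; apply: ler_sum => y _; rewrite -/(B y) -/w.
  have := le_threshold_pow4 (corr_max_ge0 j k (z - y)) rho0.
  set g := corr_max _ _ _ => h.
  apply: (@le_trans _ _ (`|f y| * (w * (rho + g ^+ 4 / rho ^+ 3)) * (B y)%:R)).
    by rewrite ler_wpM2r// ler_wpM2l// ler_wpM2l.
  rewrite le_eqVlt; apply/orP; left; apply/eqP; ring.
have S1 : \sum_(y < D) `|f y| * (B y)%:R <= 3 * 2 ^+ k.
  pose m i : R := \sum_(y < D) `|f y| * ((y %/ 2 ^ k == z %/ 2 ^ k - i)%N && (kap y == j))%:R.
  have m_le i : m i <= 2 ^+ k by apply: f_avg; lia.
  apply: (@le_trans _ _ (m 0%N + m 1%N + m 2%N)).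
    rewrite /m -!big_split/=; apply: ler_sum => y _.
    rewrite -!mulrDr ler_wpM2l// -!natrD ler_nat.
    case: (boolP (B y)) => // /and3P[-> yz hz]; rewrite !andbT.
    have zy : z = (y + (z - y))%N by lia.
    have L0 : (0 < 2 ^ k)%N by rewrite expn_gt0.
    have := divn_add_bounds y (z - y) L0; rewrite -zy => /andP[u1 u2].
    have u3 : ((z - y) %/ 2 ^ k < 2)%N by rewrite ltn_divLR// -expnS.
    have : (y %/ 2 ^ k = z %/ 2 ^ k - 0 \/ y %/ 2 ^ k = z %/ 2 ^ k - 1
      \/ y %/ 2 ^ k = z %/ 2 ^ k - 2)%N.
      move: u1 u2 u3; move: (y %/ _)%N (z %/ _)%N ((z - y) %/ _)%N => u v w'; clear; lia.
    by case=> [->|[->|->]]; rewrite eqxx /=; do 2!case: (_ == _).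
  by have := m_le 0%N; have := m_le 1%N; have := m_le 2%N; lra.
have S2 : \sum_(y < D) `|f y| * corr_max j k (z - y) ^+ 4 * (B y)%:R <=
    2 ^+ j * (C * 2 ^+ (k + 2 * j) * gain j ^+ 8).
  pose G y : R := corr_max j k (z - y) ^+ 4 * (0 < z - y < 2 ^ k.+1)%N%:R.
  apply: (@le_trans _ _ (\sum_(y < D) 2 ^+ j * G y)).
    apply: ler_sum => y _; rewrite /G; case: (boolP (B y)) => [/and3P[/eqP kj yz hz]|_].
      rewrite subn_gt0 yz hz !mulr1 ler_wpM2r ?exprn_ge0 ?corr_max_ge0//.
      by rewrite (le_trans (f_le y))// kj ler_weXn2l ?ler1n// leq_subr.
    by rewrite mulr0 !mulr_ge0 ?exprn_ge0 ?corr_max_ge0.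
  rewrite -mulr_sumr ler_wpM2l ?exprn_ge0//.
  rewrite (sum_ord_reindex_sub (G := G) (A := 1) (B := 2 ^ k.+1) zD); last first.
    move=> x _; rewrite /G; case: (boolP (0 < _ < _)%N) => [/andP[h1 h2] _|]; last first.
      by rewrite mulr0 eqxx.
    by rewrite /= ltnW// -subn_gt0.
  apply: le_trans (decorrelated jk); rewrite !big_nat; apply: ler_sum => n /andP[n1 n2].
  have [nz|_] := leqP n z; last by rewrite mulr0 exprn_ge0// corr_max_ge0.
  by rewrite /G subKn// n1 n2 !mulr1.
apply: (@le_trans _ _ (w * rho * (3 * 2 ^+ k) +
   w * rho ^- 3 * (2 ^+ j * (C * 2 ^+ (k + 2 * j) * gain j ^+ 8)))).
  by apply: lerD; apply: ler_wpM2l => //; rewrite mulr_ge0// ?invr_ge0 ?exprn_ge0// ltW.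
have -> : w * rho * (3 * 2 ^+ k) = 3 / gain j.
  rewrite /w /rho !exprVn; field.
  by rewrite gt_eqF ?expf_neq0.
have -> : w * rho ^- 3 * (2 ^+ j * (C * 2 ^+ (k + 2 * j) * gain j ^+ 8)) =
   C * (gain j ^+ 12 / 2 ^+ j) / gain j.
  rewrite /w /rho !exprVn exprD mulnC exprM; field.
  by rewrite gt_eqF ?expf_neq0.
rewrite [leRHS]mulrDl lerD2l ler_wpM2r ?invr_ge0 ?(ltW p0)// ler_piMr//.
rewrite ler_pdivrMr ?exprn_gt0// mul1r /gain -exprM ler_weXn2l ?ler1n//.
have aux i : (i %/ 16 * 12 <= i)%N by clear; lia.
exact: aux.
Qed.

(** Sums [cross_scale] over the levels [j >= s]. The geometric sum costs [2 * 16], and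
    [192 = 6 * 32]. *)
Lemma cross_scales (z : nat) : (z < D)%N ->
  \sum_(y < D) `|f y| * (6 * P * (2^-1 ^+ kap y * 2^-1 ^+ kap z *
      corr_max (kap y) (kap z) (z - y)) *
      ((kap y <= kap z)%N && (z - y < 2 ^ (kap z).+1)%N)%:R) * (y < z)%N%:R
  <= 192 * (3 + C) * P / gain s.
Proof.
move=> zD; set k := kap z.
pose T j y : R := `|f y| * (2^-1 ^+ j * 2^-1 ^+ k * corr_max j k (z - y)) *
   [&& kap y == j, (y < z)%N & (z - y < 2 ^ k.+1)%N]%:R.
apply: (@le_trans _ _ (6 * P * \sum_(s <= j < k.+1) \sum_(y < D) T j y)).
  rewrite exchange_big/= mulr_sumr; apply: ler_sum => y _.
  have T0 j : 0 <= T j y.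
    by rewrite !mulr_ge0 ?exprn_ge0 ?invr_ge0 ?corr_max_ge0.
  have [jk|kj] := leqP (kap y) k; last first.
    rewrite /= !mulr0 mul0r mulr_ge0 ?sumr_ge0// mulr_ge0// ltW//.
  rewrite (bigD1_seq (kap y)) ?iota_uniq ?mem_index_iota ?kap_ge//=.
  apply: (@le_trans _ _ (6 * P * T (kap y) y)); last first.
    rewrite ler_wpM2l ?mulr_ge0 ?(ltW P_gt0)// lerDl sumr_ge0//.
  rewrite /T eqxx/= andbC -mulnb natrM.
  rewrite le_eqVlt; apply/orP; left; apply/eqP; ring.
have -> : 192 * (3 + C) * P / gain s = 6 * P * ((3 + C) * (32 / gain s)) by ring.
rewrite ler_wpM2l ?mulr_ge0 ?(ltW P_gt0)//.
apply: (@le_trans _ _ (\sum_(s <= j < k.+1) (3 + C) * 2^-1 ^+ (j %/ 16))).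
  rewrite !big_nat; apply: ler_sum => j /andP[sj jk].
  apply: le_trans (@cross_scale j z zD _) _; first by rewrite sj.
  by rewrite exprVn.
rewrite -mulr_sumr ler_wpM2l ?addr_ge0//.
by apply: le_trans (sum_geo_floor R _ _ _) _ => //; rewrite exprVn.
Qed.

(** The height bound decides: [2 ^ k] points, squares at most [M ^+ 2 / 2 ^+ (2 * k)] and
    [|f z| <= 2 ^+ (k - s)] leave [M ^+ 2 / 2 ^+ s]. *)
Lemma cut_diag (t z : nat) : (z < D)%N ->
  `|f z| * \sum_(x < D) cut_term t x z * cut_term t x z <= M ^+ 2 / gain s.
Proof.
move=> zD; set k := kap z.
have h x : cut_term t x z * cut_term t x z <=
   (M * 2^-1 ^+ k) ^+ 2 * (z.+1 - 2 ^ k.+1 <= x < z.+1 - 2 ^ k)%N%:R.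
  rewrite /cut_term; have [->|zx0] := posnP (z - x)%N.
    by rewrite d0 !mul0r mulr_ge0// exprn_ge0// mulr_ge0// exprn_ge0// invr_ge0.
  case: (blk (z - x) =P kap z) => [bE|_]/=; last first.
    by rewrite !mulr0 mulr_ge0// exprn_ge0// mulr_ge0// exprn_ge0// invr_ge0.
  have /andP[b1 b2] := blk_bounds zx0.
  rewrite bE -/k in b1 b2.
  rewrite (_ : (_ <= x < _)%N); last by lia.
  rewrite mulr1 -expr2 -[leLHS]ger0_norm ?sqr_ge0// normrX.
   rewrite lerXn2r ?nnegrE ?mulr_ge0 ?exprn_ge0 ?invr_ge0//.
  rewrite normrM exprVn /k -bE; apply: le_trans (weight_le (z - x)%N).
  by rewrite -[leRHS]mulr1 ler_wpM2l// normr_nat lern1 leq_b1.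
apply: (@le_trans _ _ (2 ^+ (k - s) * ((M * 2^-1 ^+ k) ^+ 2 * 2 ^+ k))).
  apply: ler_pM => //.
    by apply: sumr_ge0 => x _; rewrite -expr2 sqr_ge0.
  apply: (@le_trans _ _ _ _ _ (ler_sum _ (fun (x : 'I_D) _ => h x))).
  rewrite -mulr_sumr ler_wpM2l ?exprn_ge0 ?mulr_ge0 ?exprn_ge0 ?invr_ge0//.
  apply: le_trans (sum_ord_itv_le R D _ _) _.
  by rewrite -natrX ler_nat expnS; lia.
rewrite exprB ?unitfE// ?kap_ge//.
have -> : 2 ^+ k / 2 ^+ s * ((M * 2^-1 ^+ k) ^+ 2 * 2 ^+ k) = M ^+ 2 / 2 ^+ s.
  by rewrite exprVn; field; rewrite !expf_neq0.
rewrite ler_wpM2l ?sqr_ge0// lef_pV2 ?posrE ?exprn_gt0// /gain ler_weXn2l ?ler1n//.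
exact: leq_div.
Qed.

(** Expanding the square gives a symmetric kernel; the off-diagonal part is twice the sum over
    [y < z], whence [384 = 2 * 192]. *)
Lemma cut_L2 (t : nat) :
  \sum_(x < D) cut_sum t x ^+ 2 <=
  (M ^+ 2 + 384 * (3 + C)) * P / gain s * \sum_(y < D) `|f y|.
Proof.
pose K (y z : nat) : R := \sum_(x < D) cut_term t x y * cut_term t x z.
have KC y z : K y z = K z y by apply: eq_bigr => x _; rewrite mulrC.
have -> : \sum_(x < D) cut_sum t x ^+ 2 = \sum_(z < D) \sum_(y < D) f y * f z * K y z.
  under eq_bigr do rewrite expr2 /cut_sum mulr_suml.
  rewrite exchange_big/= [RHS]exchange_big/=; apply: eq_bigr => y _.
  under eq_bigr do rewrite mulr_sumr.
  rewrite exchange_big/=; apply: eq_bigr => z _.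
  by rewrite /K mulr_sumr; apply: eq_bigr => x _; ring.
pose A (y z : nat) : R := `|f y| * `|f z| * `|K y z|.
have AC y z : A y z = A z y by rewrite /A KC (mulrC `|f y|).
have A0 y z : 0 <= A y z by rewrite /A !mulr_ge0.
apply: (@le_trans _ _ (\sum_(z < D) A z z +
   2 * \sum_(z < D) \sum_(y < D) A y z * (y < z)%N%:R)).
  apply: (@le_trans _ _ (\sum_(z < D) (A z z + (\sum_(y < D) A y z * (y < z)%N%:R
      + \sum_(y < D) A y z * (z < y)%N%:R)))); last first.
    rewrite !big_split/= lerD2l mulr_natl mulr2n lerD2l exchange_big/=.
    by apply: ler_sum => y _; apply: ler_sum => z _; rewrite AC.
  apply: ler_sum => z _.
  rewrite (bigD1 z)//= lerD//.
    by rewrite (le_trans (ler_norm _))// /A !normrM.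
  rewrite -big_split/= [leLHS]big_mkcond/=; apply: ler_sum => y _.
  case: eqP => [->|/eqP yz]/=; first by rewrite addr_ge0// mulr_ge0.
  rewrite -mulrDr -natrD (_ : ((y < z) + (z < y) = 1)%N) ?mulr1; last first.
    by move: yz; rewrite -(inj_eq val_inj)/=; case: ltngtP.
  by rewrite (le_trans (ler_norm _))// /A !normrM.
have hd : \sum_(z < D) A z z <= (\sum_(y < D) `|f y|) * (M ^+ 2 / gain s).
  rewrite mulr_suml; apply: ler_sum => z _.
  rewrite /A -mulrA ler_wpM2l// (@ger0_norm _ (K z z)); last first.
    by apply: sumr_ge0 => x _; rewrite -expr2 sqr_ge0.
  exact: cut_diag.
have ho : \sum_(z < D) \sum_(y < D) A y z * (y < z)%N%:R <=
    (\sum_(y < D) `|f y|) * (192 * (3 + C) * P / gain s).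
  rewrite mulr_suml; apply: ler_sum => z _.
  apply: (@le_trans _ _ (`|f z| * \sum_(y < D) `|f y| * (6 * P * (2^-1 ^+ kap y * 2^-1 ^+ kap z *
      corr_max (kap y) (kap z) (z - y)) *
      ((kap y <= kap z)%N && (z - y < 2 ^ (kap z).+1)%N)%:R) * (y < z)%N%:R)); last first.
    by rewrite ler_wpM2l// cross_scales.
  rewrite mulr_sumr; apply: ler_sum => y _.
  have [yz|_] := ltnP y z; last by rewrite !mulr0.
  rewrite !mulr1 (_ : A y z = `|f z| * (`|f y| * `|K y z|)); last by rewrite /A; ring.
  by do 2!apply: ler_wpM2l => //; apply: cut_corr.
set F := \sum_(y < D) `|f y| in hd ho *.
have F0 : 0 <= F by exact: sumr_ge0.
have MP : M ^+ 2 / gain s <= M ^+ 2 * P / gain s.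
  rewrite ler_wpM2r ?invr_ge0 ?(ltW (gain_gt0 _))// ler_peMr ?sqr_ge0//.
  by rewrite /P exprn_ege1// ler1n.
have FMP : F * (M ^+ 2 / gain s) <= F * (M ^+ 2 * P / gain s) by rewrite ler_wpM2l.
have -> : (M ^+ 2 + 384 * (3 + C)) * P / gain s * F =
   F * (M ^+ 2 * P / gain s) + 2 * (F * (192 * (3 + C) * P / gain s)) by ring.
apply: (@le_trans _ _ (F * (M ^+ 2 / gain s) + 2 * (F * (192 * (3 + C) * P / gain s)))).
  by apply: lerD; [exact: hd|rewrite ler_wpM2l].
by rewrite lerD2r.
Qed.

(** * The maximal inequality for one instance *)

Definition core_const : R := 2 + 3 * (M ^+ 2 + 384 * (3 + C)).

(** Discard the [x] whose potential exceeds [P] (Markov) and those with some cut sum above [P^-1]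
    (Chebyshev, over [P ^+ 2 + 2] values of [t]). For the others [tail_cut] bounds every tail by
    [(1 + 3 * M) / P], and a partial sum is a difference of two tails. *)
Lemma core_maximal :
  \sum_(x < D) (`[< exists N, (2 + 6 * M) / P <
     `|\sum_(y < D) f y * d (y - x) * ((blk (y - x) == kap y) && (y - x < N)%N)%:R| >])%:R
  <= core_const / P * \sum_(y < D) `|f y|.
Proof.
pose n0 := (2 ^ (2 * a) + 2)%N.
have P1 : 1 <= P by rewrite /P exprn_ege1// ler1n.
set F := \sum_(y < D) `|f y|.
have F0 : 0 <= F by exact: sumr_ge0.
apply: (@le_trans _ _ (\sum_(x < D) (Rv 1 x / P + \sum_(t < n0) P ^+ 2 * cut_sum t x ^+ 2))).
  apply: ler_sum => x _.
  have T0 (t : 'I_n0) : true -> 0 <= P ^+ 2 * cut_sum t x ^+ 2.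
    by move=> _; rewrite mulr_ge0 ?sqr_ge0// exprn_ge0// ltW.
  case: asboolP => [[N hN]|_]; last first.
    by rewrite addr_ge0 ?divr_ge0 ?potential_ge0 ?(ltW P_gt0)// sumr_ge0.
  have [PR|RP] := ltP P (Rv 1 x).
    apply: (@le_trans _ _ (Rv 1 x / P)); first by rewrite ler_pdivlMr// mul1r ltW.
    by rewrite lerDl sumr_ge0.
  have [[t ht]|hsmall] := pselect (exists t : 'I_n0, P^-1 < `|cut_sum t x|).
    apply: (@le_trans _ _ (\sum_(t < n0) P ^+ 2 * cut_sum t x ^+ 2)); last first.
      by rewrite lerDr divr_ge0 ?potential_ge0 ?(ltW P_gt0).
    rewrite (bigD1 t)//=; apply: ler_wpDr; first by apply: sumr_ge0 => t' _; exact: T0.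
    rewrite -exprMn -[leRHS]ger0_norm ?sqr_ge0// normrX exprn_ege1//.
    by rewrite normrM (gtr0_norm P_gt0) -ler_pdivrMl// mulr1 ltW.
  have small t : (t < n0)%N -> `|cut_sum t x| <= P^-1.
    by move=> tn; rewrite leNgt; apply/negP => h; apply: hsmall; exists (Ordinal tn).
  have tailb N' : (0 < N')%N ->
    `|\sum_(y < D) f y * d (y - x) * ((blk (y - x) == kap y) && (N' <= y - x)%N)%:R|
      <= (1 + 3 * M) / P.
    move=> N0; have [t tn ht] := tail_cut N0 RP.
    rewrite -[X in `|X|](subrK (cut_sum t x)) (le_trans (ler_normD _ _))//.
    rewrite addrC mulrDl mul1r lerD// small//.
    by rewrite /n0 addnS ltnS.
  suff : (2 + 6 * M) / P < (2 + 6 * M) / P by rewrite ltxx.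
  apply: lt_le_trans hN _.
  have [->|N0] := posnP N.
    rewrite big1 ?normr0 ?divr_ge0 ?(ltW P_gt0)// ?addr_ge0 ?mulr_ge0//.
    by move=> y _; rewrite ltn0 andbF mulr0.
  set U := \sum_(y < D) _.
  (* The condition [1 <= y - x] is free: every [y <= x] has truncated difference 0 and weight
     [d 0 = 0]. *)
  have -> : U = \sum_(y < D) f y * d (y - x) * ((blk (y - x) == kap y) && (1 <= y - x)%N)%:R
     - \sum_(y < D) f y * d (y - x) * ((blk (y - x) == kap y) && (N <= y - x)%N)%:R.
    rewrite -sumrB; apply: eq_bigr => y _; rewrite -mulrBr.
    have [->|yx0] := posnP (y - x)%N; first by rewrite d0 mulr0 !mul0r.
    congr (_ * _); case: (blk _ == _) => /=; last by rewrite subrr.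
    by have [] := ltnP (y - x) N; rewrite ?subrr ?subr0.
  rewrite (le_trans (ler_normB _ _))//.
  have -> : (2 + 6 * M) / P = (1 + 3 * M) / P + (1 + 3 * M) / P by ring.
  by rewrite lerD// tailb.
rewrite big_split/= -mulr_suml [X in _ + X]exchange_big/=.
under [X in _ + X]eq_bigr do rewrite -mulr_sumr.
set K := M ^+ 2 + 384 * (3 + C).
have K0 : 0 <= K.
  apply: addr_ge0; [exact: sqr_ge0|apply: mulr_ge0; first exact: ler0n].
  exact: addr_ge0 (ler0n _ _) C0.
apply: (@le_trans _ _ (2 * F / P + \sum_(t < n0) P ^+ 2 * (K * P / gain s * F))).
  apply: lerD; first by apply: ler_wpM2r; [rewrite invr_ge0 ltW|exact: sum_potential_le].
  apply: ler_sum => t _; rewrite ler_wpM2l ?exprn_ge0 ?(ltW P_gt0)//.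
  exact: cut_L2.
rewrite sumr_const card_ord -[_ *+ n0]mulr_natl.
have hn : n0%:R <= 3 * P ^+ 2.
  rewrite /n0 natrD natrX mulnC exprM -/P.
  have : 1 <= P ^+ 2 by rewrite exprn_ege1.
  lra.
have hg : P ^+ 6 <= gain s.
  have aux i : (i %/ 96 * 6 <= i %/ 16)%N by clear; lia.
  by rewrite /P /gain -exprM ler_weXn2l ?ler1n// aux.
have G0 := gain_gt0 s.
apply: (@le_trans _ _ (2 * F / P + 3 * P ^+ 2 * (P ^+ 2 * (K * P / gain s * F)))).
  rewrite lerD2l ler_wpM2r// !mulr_ge0 ?exprn_ge0 ?invr_ge0 ?(ltW P_gt0) ?(ltW G0)//.
rewrite /core_const -/K.
have -> : (2 + 3 * K) / P * F = 2 * F / P + 3 * K / P * F by ring.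
rewrite lerD2l.
have -> : 3 * P ^+ 2 * (P ^+ 2 * (K * P / gain s * F)) = 3 * K * F * (P ^+ 5 / gain s) by ring.
have -> : 3 * K / P * F = 3 * K * F * P^-1 by ring.
rewrite ler_wpM2l ?mulr_ge0// ler_pdivrMr// mulrC ler_pdivlMr// -exprSr//.
Qed.

End Instance.
End Core.

(** * Weak type (1,1) on the integers *)

Section WeakType.
Variables (R : realType) (d : nat -> R) (M C : R).
Hypothesis d0 : d 0%N = 0.
Hypothesis eM : forall n, `|dyadic_weight d n| <= M.
Hypothesis C0 : 0 <= C.
Hypothesis decorrelated : forall j k, (j <= k)%N ->
  \sum_(1 <= h < 2 ^ k.+1) corr_max d j k h ^+ 4 <= C * 2 ^+ (k + 2 * j) * gain R j ^+ 8.

Let M0 : 0 <= M := M_ge0 eM.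

Lemma core_const_ge0 : 0 <= core_const M C.
Proof.
apply: addr_ge0; first exact: ler0n.
apply: mulr_ge0; first exact: ler0n.
apply: addr_ge0; [exact: sqr_ge0|apply: mulr_ge0; first exact: ler0n].
exact: addr_ge0 (ler0n _ _) C0.
Qed.

(** The instance with all levels equal to [s = k]; [f_avg] then just counts the points of a cell. *)
Lemma block_maximal (k D : nat) (f : nat -> R) : (forall y, `|f y| <= 1) ->
  \sum_(x < D) (`[< exists N, (2 + 6 * M) / 2 ^+ (k %/ 96) <
     `|\sum_(y < D) f y * d (y - x) * ((blk (y - x) == k) && (y - x < N)%N)%:R| >])%:R
  <= core_const M C / 2 ^+ (k %/ 96) * \sum_(y < D) `|f y|.
Proof.
move=> f1.
apply: (core_maximal d0 eM C0 decorrelated (s := k) (kap := fun=> k)) => //.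
  by move=> y; rewrite subnn.
move=> j l q _.
apply: (@le_trans _ _ (\sum_(y < D) (q * 2 ^ l <= y < q.+1 * 2 ^ l)%N%:R)).
  apply: ler_sum => y _; case: eqP => [yq|_]/=; last by rewrite mulr0.
  rewrite (_ : (_ <= _ < _)%N); last first.
    by rewrite -leq_divRL ?expn_gt0// -ltn_divLR ?expn_gt0// yq leqnn ltnS leqnn.
  by apply: mulr_ile1 => //; case: (k == j); rewrite ?ler01.
apply: le_trans (sum_ord_itv_le R D _ _) _.
by rewrite -mulnBl subSnn mul1n natrX.
Qed.

(** * Calderon-Zygmund levels on an interval of [2 ^ K] points *)

Section CZ.
Variables (K : nat) (f : nat -> R).
Let D := (2 ^ K)%N.
Hypothesis f_supp : forall y, (D <= y)%N -> f y = 0.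
Hypothesis f_mass : \sum_(y < D) `|f y| <= 2 ^+ K.

Definition cell_sum (l y : nat) : R :=
  \sum_(z < D) `|f z| * (z %/ 2 ^ l == y %/ 2 ^ l)%N%:R.
(** Testing up to [K] is enough: beyond that level the total mass [f_mass] already gives the
    bound. *)
Definition calm (y i : nat) : bool :=
  [forall l : 'I_K.+1, (i <= l)%N ==> (cell_sum l y <= 2 ^+ l)].

Lemma cell_sum_le (l y : nat) : cell_sum l y <= \sum_(z < D) `|f z|.
Proof.
apply: ler_sum => z _; rewrite -[leRHS]mulr1 ler_wpM2l//.
by case: (_ == _).
Qed.

Lemma calm_top (y : nat) : calm y K.
Proof.
apply/forallP => l; apply/implyP => Kl.
have -> : nat_of_ord l = K by apply/eqP; rewrite eqn_leq Kl -ltnS ltn_ord.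
exact: le_trans (cell_sum_le _ _) f_mass.
Qed.

Lemma calm_ex (y : nat) : exists i, calm y i. Proof. by exists K; exact: calm_top. Qed.
Definition lev (y : nat) : nat := ex_minn (calm_ex y).

Lemma lev_le (y : nat) : (lev y <= K)%N.
Proof. by rewrite /lev; case: ex_minnP => m _; apply; exact: calm_top. Qed.

Lemma lev_calm (y l : nat) : (lev y <= l)%N -> cell_sum l y <= 2 ^+ l.
Proof.
move=> yl; have [lK|Kl] := leqP l K.
  move: yl; rewrite /lev; case: ex_minnP => m /forallP h _ ml.
  by have := h (Ordinal (lK : (l < K.+1)%N)) => /implyP; apply.
apply: le_trans (cell_sum_le _ _) _; apply: le_trans f_mass _.
by rewrite ler_weXn2l ?ler1n// ltnW.
Qed.

Lemma lev_wild (y : nat) : (0 < lev y)%N -> 2 ^+ (lev y).-1 < cell_sum (lev y).-1 y.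
Proof.
have := lev_le y; have := @lev_calm y.
rewrite /lev; case: ex_minnP => m cm mmin hc mK m0.
rewrite ltNge; apply/negP => hm.
suff /mmin : calm y m.-1 by lia.
apply/forallP => l; apply/implyP; rewrite leq_eqVlt => /orP[/eqP<-//|ml].
by apply: hc; lia.
Qed.

Lemma cell_sum_eq (i l y z : nat) : (i <= l)%N -> (y %/ 2 ^ i = z %/ 2 ^ i)%N ->
  cell_sum l y = cell_sum l z.
Proof.
move=> il yz; apply: eq_bigr => u _.
by rewrite (divn_pow_coarsen y il) (divn_pow_coarsen z il) yz.
Qed.

(** [y] and [z] share all cells from level [(lev z).-1] on, and these decide both that [lev z] is
    calm and that the level below it is not. *)
Lemma lev_cell (y z : nat) : (0 < lev z)%N ->
  (y %/ 2 ^ (lev z).-1 = z %/ 2 ^ (lev z).-1)%N -> lev y = lev z.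
Proof.
move=> z0 yz; apply/eqP; rewrite eqn_leq; apply/andP; split.
  rewrite {1}/lev; case: ex_minnP => m _; apply.
  apply/forallP => l; apply/implyP => zl.
  by rewrite (@cell_sum_eq (lev z).-1 _ _ z)//; [exact: lev_calm|lia].
rewrite leqNgt; apply/negP => yltz.
have := lev_wild z0; rewrite ltNge => /negP; apply.
by rewrite -(cell_sum_eq (leqnn _) yz) lev_calm//; lia.
Qed.

Lemma lev_height (y : nat) : `|f y| <= 2 ^+ lev y.
Proof.
have [yD|Dy] := ltnP y D; last by rewrite f_supp// normr0 exprn_ge0.
apply: le_trans (lev_calm (leqnn (lev y))).
rewrite /cell_sum (bigD1 (Ordinal yD))//= eqxx mulr1 lerDl.
by apply: sumr_ge0 => z _; rewrite mulr_ge0.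
Qed.

(** One point [y0] of level [j - s <= l] in the cell suffices: its calmness bounds the mass of the
    whole cell. *)
Lemma lev_avg (s j l q : nat) : (j <= l + s)%N ->
  \sum_(y < D) `|f y| * ((y %/ 2 ^ l == q) && (lev y + s == j))%N%:R <= 2 ^+ l.
Proof.
move=> jls.
have [[y0 /andP[/eqP y0q /eqP y0j]]|none] :=
    pselect (exists y : 'I_D, (y %/ 2 ^ l == q) && (lev y + s == j))%N; last first.
  rewrite big1 ?exprn_ge0// => y _.
  by case: (boolP (_ && _)) => h; [case: none; exists y|rewrite mulr0].
apply: (@le_trans _ _ (cell_sum l y0)); last by apply: lev_calm; lia.
apply: ler_sum => y _; rewrite ler_wpM2l// ler_nat y0q.
by case: eqP; case: eqP.
Qed.

(** Points seeing some [f y] at a distance too short for its level. At other points every nonzero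
    term has [blk (y - x) = lev y + s] for some [s >= 0]. *)
Definition escaping (x : nat) : bool :=
  `[< exists y, [/\ (y < D)%N, (x < y)%N & (blk (y - x) < lev y)%N] >].

(** An escaping [x] is at most two cells away from a cell of length [L = 2 ^ (lev y0).-1] with
    average above 1, all of whose points have level [lev y0]. Charge [x] to the mass of that cell;
    each [y] is charged by at most [3 * L] points. *)
Lemma escaping_count : \sum_(x < D) (escaping x)%:R <= 3 * \sum_(y < D) `|f y|.
Proof.
pose L y := (2 ^ (lev y).-1)%N.
have L0 y : (0 < L y)%N by rewrite expn_gt0.
pose near x y := (0 < lev y)%N && (x %/ L y <= y %/ L y <= x %/ L y + 2)%N.
apply: (@le_trans _ _ (\sum_(x < D) \sum_(y < D) `|f y| * ((L y)%:R^-1 * (near x y)%:R))).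
  apply: ler_sum => x _; rewrite /escaping; case: asboolP => [[y0 [y0D xy blt]]|_]; last first.
    by apply: sumr_ge0 => y _; rewrite !mulr_ge0// invr_ge0.
  have y00 : (0 < lev y0)%N by exact: leq_ltn_trans blt.
  have nr : near x y0.
    rewrite /near y00/= leq_div2r ?(ltnW xy)//=.
    have /andP[_] := divn_add_bounds x (y0 - x) (L0 y0).
    rewrite subnKC ?(ltnW xy)// => h; apply: leq_trans h _.
    rewrite -addnA leq_add2l addn1 ltn_divLR//.
    have yx0 : (0 < y0 - x)%N by rewrite subn_gt0.
    have /andP[_ h2] := blk_bounds yx0.
    apply: leq_trans h2 _; rewrite /L -expnS prednK// leq_exp2l//.
  apply: (@le_trans _ _ ((L y0)%:R^-1 * cell_sum (lev y0).-1 y0)).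
    rewrite -ler_pdivrMl ?invr_gt0 ?ltr0n// invrK mulr1.
    by rewrite ltW// natrX lev_wild.
  rewrite /cell_sum mulr_sumr; apply: ler_sum => y _.
  case: eqP => [yc|_]; last by rewrite !mulr0 !mulr_ge0// invr_ge0.
  have ly := lev_cell y00 yc.
  have Ly : L y = L y0 by rewrite /L ly.
  have -> : near x y by rewrite /near Ly ly -{1 2}/(L y0) {1 2}/L yc.
  by rewrite Ly !mulr1 mulrC.
rewrite exchange_big/= mulr_sumr; apply: ler_sum => y _.
rewrite -mulr_sumr mulrC ler_wpM2r// -mulr_sumr.
rewrite ler_pdivrMl ?ltr0n//.
apply: (@le_trans _ _ (\sum_(x < D) ((y %/ L y - 2) * L y <= x < (y %/ L y).+1 * L y)%N%:R)).
  apply: ler_sum => x _; rewrite ler_nat /near; case: (boolP (_ && _)) => //= /and3P[_ h1 h2].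
  rewrite lt0b -leq_divRL// -ltn_divLR// ltnS h1 andbT.
  by rewrite leq_subLR addnC.
apply: le_trans (sum_ord_itv_le R D _ _) _.
rewrite -mulnBl -natrM ler_nat mulnC leq_mul2l; apply/orP; right.
by lia.
Qed.

(** Off the escaping set the sum splits into the instances [kap y = lev y + s]. Thresholds and
    exceptional counts both decay like [2^-1 ^+ (s %/ 96)], whose sum is at most [192 = 2 * 96]. *)
Lemma weak_type_calm :
  \sum_(x < D) (`[< exists N, (2 + 6 * M) * 192 <
     `|\sum_(y < D) f y * d (y - x) * (y - x < N)%N%:R| >])%:R
  <= (3 + 192 * core_const M C) * \sum_(y < D) `|f y|.
Proof.
pose U s N x := \sum_(y < D) f y * d (y - x) * ((blk (y - x) == lev y + s) && (y - x < N))%N%:R.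
pose thr s : R := (2 + 6 * M) / 2 ^+ (s %/ 96).
pose bad s x := `[< exists N, thr s < `|U s N x| >].
have geo (c : R) : 0 <= c -> \sum_(s < K.+1) c / 2 ^+ (s %/ 96) <= c * 192.
  move=> c0; rewrite -mulr_sumr ler_wpM2l//.
  rewrite -(big_mkord xpredT (fun s => (2 ^+ (s %/ 96))^-1)).
  under eq_bigr do rewrite -exprVn.
  by apply: le_trans (sum_geo_floor R _ _ _) _ => //; rewrite div0n expr0 mulr1.
apply: (@le_trans _ _ (\sum_(x < D) ((escaping x)%:R + \sum_(s < K.+1) (bad s x)%:R))).
  apply: ler_sum => x _; case: asboolP => [[N hN]|_]; last first.
    by rewrite addr_ge0// sumr_ge0.
  have [ex|nex] := boolP (escaping x); first by rewrite lerDl sumr_ge0.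
  rewrite add0r; have [[s bs]|nobad] := pselect (exists s : 'I_K.+1, bad s x).
    by rewrite (bigD1 s)//= bs lerDl sumr_ge0.
  suff : (2 + 6 * M) * 192 < (2 + 6 * M) * 192 by rewrite ltxx.
  apply: lt_le_trans hN _.
  have -> : \sum_(y < D) f y * d (y - x) * (y - x < N)%N%:R = \sum_(s < K.+1) U s N x.
    rewrite /U exchange_big/=; apply: eq_bigr => y _.
    have [->|yx0] := posnP (y - x)%N.
      by rewrite d0 mulr0 mul0r big1// => s _; rewrite mul0r.
    have lb : (lev y <= blk (y - x))%N.
      rewrite leqNgt; apply: contra nex => h; apply/asboolP; exists y; split => //; lia.
    have bK : (blk (y - x) - lev y < K.+1)%N.
      rewrite ltnS (leq_trans (leq_subr _ _))//.
      rewrite -(trunc_expnK K (isT : 1 < 2)%N) blk_le// (leq_trans (leq_subr _ _))//.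
      by rewrite ltnW.
    rewrite (bigD1 (Ordinal bK))//= subnKC// eqxx/= big1 ?addr0// => s sK.
    rewrite (_ : (_ == _) = false) ?mulr0//; apply/eqP => E; move/eqP: sK; apply.
    by apply: val_inj => /=; rewrite E addKn.
  apply: le_trans (ler_norm_sum _ _ _) _.
  apply: le_trans (geo _ _); last by rewrite addr_ge0// mulr_ge0.
  apply: ler_sum => s _; rewrite leNgt; apply/negP => h; apply: nobad; exists s.
  by apply/asboolP; exists N.
rewrite big_split/= mulrDl; apply: lerD; first exact: escaping_count.
rewrite exchange_big/=.
apply: (@le_trans _ _ (\sum_(s < K.+1) core_const M C / 2 ^+ (s %/ 96) * \sum_(y < D) `|f y|)).
  apply: ler_sum => s _.
  apply: (core_maximal d0 eM C0 decorrelated (s := s) (kap := fun y => lev y + s)%N).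
  - by move=> y; rewrite leq_addl.
  - by move=> y; rewrite addnK lev_height.
  - by move=> j l q; exact: lev_avg.
rewrite -mulr_suml ler_wpM2r ?sumr_ge0// mulrC; apply: geo.
exact: core_const_ge0.
Qed.

End CZ.

(** If the mass exceeds [2 ^ K], the number of points, the bound is trivial; otherwise the levels
    are available for [g], the extension of [f] by zero. *)
Lemma weak_type (K : nat) (f : nat -> R) :
  \sum_(x < 2 ^ K) (`[< exists N, (2 + 6 * M) * 192 <
     `|\sum_(y < 2 ^ K) f y * d (y - x) * (y - x < N)%N%:R| >])%:R
  <= (3 + 192 * core_const M C) * \sum_(y < 2 ^ K) `|f y|.
Proof.
pose g y := f y * (y < 2 ^ K)%N%:R.
have gf (y : 'I_(2 ^ K)) : g y = f y by rewrite /g ltn_ord mulr1.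
have [small|large] := leP (\sum_(y < 2 ^ K) `|f y|) (2 ^+ K).
  have := @weak_type_calm K g; rewrite (eq_bigr (fun y : 'I__ => `|f y|)) => [h|y _];
     last by rewrite gf.
  apply: le_trans (h _ small); last by move=> y; rewrite /g ltnNge => ->; rewrite mulr0.
  apply: ler_sum => x _; rewrite ler_nat; case: asboolP => [[N hN]|]//.
  by rewrite asboolT//; exists N; under eq_bigr do rewrite gf.
apply: (@le_trans _ _ (\sum_(y < 2 ^ K) `|f y|)).
  apply: le_trans (ltW large); apply: (@le_trans _ _ (\sum_(x < 2 ^ K) 1)).
    by apply: ler_sum => x _; rewrite lern1 leq_b1.
  by rewrite sumr_const card_ord natrX.
rewrite ler_peMl ?sumr_ge0//.
have := core_const_ge0; lra.
Qed.

End WeakType.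

(** * Expectations of bounded random variables *)

Section BoundedExpectation.
Context (dO : measure_display) (Omega : measurableType dO) (R : realType)
  (P : probability Omega R).
Implicit Types (g : Omega -> R).

Definition bdd_meas g := measurable_fun setT g /\ exists B, forall w, `|g w| <= B.
Definition Ex g : R := \int[P]_w g w.

Lemma bdd_meas_int g : bdd_meas g -> P.-integrable setT (EFin \o g).
Proof.
move=> [mg [B hB]]; apply: measurable_bounded_integrable => //.
  by rewrite (le_lt_trans (probability_le1 P measurableT))// ltry.
exists B; split; first by rewrite num_real.
by move=> M BM w _; exact: le_trans (hB w) (ltW BM).
Qed.

Lemma bdd_meas_cst c : bdd_meas (fun=> c).
Proof. by split; [exact: measurable_cst|exists `|c|]. Qed.

Lemma bdd_measD g1 g2 : bdd_meas g1 -> bdd_meas g2 -> bdd_meas (fun w => g1 w + g2 w).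
Proof.
move=> [m1 [B1 h1]] [m2 [B2 h2]]; split; first exact: measurable_funD.
by exists (B1 + B2) => w; rewrite (le_trans (ler_normD _ _))// lerD.
Qed.

Lemma bdd_measM g1 g2 : bdd_meas g1 -> bdd_meas g2 -> bdd_meas (fun w => g1 w * g2 w).
Proof.
move=> [m1 [B1 h1]] [m2 [B2 h2]]; split; first exact: measurable_funM.
by exists (B1 * B2) => w; rewrite normrM ler_pM.
Qed.

Lemma bdd_meas_sum (I : Type) (r : seq I) (p : pred I) (h : I -> Omega -> R) :
  (forall i, p i -> bdd_meas (h i)) -> bdd_meas (fun w => \sum_(i <- r | p i) h i w).
Proof.
move=> hh; elim: r => [|i r ih].
  by rewrite (_ : (fun w => _) = (fun=> 0)); [exact: bdd_meas_cst|
   apply/funext => w; rewrite big_nil].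
have [pi|npi] := boolP (p i).
  rewrite (_ : (fun w => _) = (fun w => h i w + \sum_(i <- r | p i) h i w)).
    by apply: bdd_measD => //; exact: hh.
  by apply/funext => w; rewrite big_cons pi.
by rewrite (_ : (fun w => _) = (fun w => \sum_(i <- r | p i) h i w))//;
  apply/funext => w; rewrite big_cons (negbTE npi).
Qed.

Lemma bdd_meas_prod (I : Type) (r : seq I) (p : pred I) (h : I -> Omega -> R) :
  (forall i, p i -> bdd_meas (h i)) -> bdd_meas (fun w => \prod_(i <- r | p i) h i w).
Proof.
move=> hh; elim: r => [|i r ih].
  by rewrite (_ : (fun w => _) = (fun=> 1)); [exact: bdd_meas_cst|
   apply/funext => w; rewrite big_nil].
have [pi|npi] := boolP (p i).
  rewrite (_ : (fun w => _) = (fun w => h i w * \prod_(i <- r | p i) h i w)).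
    by apply: bdd_measM => //; exact: hh.
  by apply/funext => w; rewrite big_cons pi.
by rewrite (_ : (fun w => _) = (fun w => \prod_(i <- r | p i) h i w))//;
  apply/funext => w; rewrite big_cons (negbTE npi).
Qed.

Lemma bdd_meas_exp g n : bdd_meas g -> bdd_meas (fun w => g w ^+ n).
Proof.
move=> hg; elim: n => [|n ih]; first exact: bdd_meas_cst.
by under eq_fun do rewrite exprS; exact: bdd_measM.
Qed.

Lemma bdd_meas_norm g : bdd_meas g -> bdd_meas (fun w => `|g w|).
Proof.
move=> [mg [B hB]]; split; first exact: measurableT_comp.
by exists B => w; rewrite normr_id.
Qed.

Lemma bdd_meas_indic (A : set Omega) : measurable A -> bdd_meas (\1_A : Omega -> R).
Proof.
move=> mA; split; first exact: measurable_indic.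
by exists 1 => w; rewrite indicE normr_nat lern1 leq_b1.
Qed.

Lemma ExD g1 g2 : bdd_meas g1 -> bdd_meas g2 -> Ex (fun w => g1 w + g2 w) = Ex g1 + Ex g2.
Proof. by move=> h1 h2; apply: RintegralD => //; exact: bdd_meas_int. Qed.

Lemma ExZ c g : bdd_meas g -> Ex (fun w => c * g w) = c * Ex g.
Proof. by move=> h; apply: RintegralZl => //; exact: bdd_meas_int. Qed.

Lemma Ex_cst c : Ex (fun=> c) = c.
Proof. by rewrite /Ex Rintegral_cst//= probability_setT mulr1. Qed.

Lemma Ex_le g1 g2 : bdd_meas g1 -> bdd_meas g2 -> (forall w, g1 w <= g2 w) -> Ex g1 <= Ex g2.
Proof. by move=> h1 h2 h; apply: le_Rintegral => //; exact: bdd_meas_int. Qed.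

Lemma Ex_sum (I : Type) (r : seq I) (p : pred I) (h : I -> Omega -> R) :
  (forall i, p i -> bdd_meas (h i)) ->
  Ex (fun w => \sum_(i <- r | p i) h i w) = \sum_(i <- r | p i) Ex (h i).
Proof.
move=> hh; elim: r => [|i r ih].
  rewrite (_ : (fun w => _) = (fun=> 0)) ?Ex_cst ?big_nil//.
  by apply/funext => w; rewrite big_nil.
rewrite big_cons; case: ifPn => pi; last first.
  by rewrite -ih; congr Ex; apply/funext => w; rewrite big_cons (negbTE pi).
rewrite -ih -ExD; [|exact: hh|exact: bdd_meas_sum].
by congr Ex; apply/funext => w; rewrite big_cons pi.
Qed.

Lemma Ex_normr_le g B : bdd_meas g -> (forall w, `|g w| <= B) -> `|Ex g| <= B.
Proof.
move=> hg hB; apply: le_trans (le_normr_Rintegral measurableT (bdd_meas_int hg)) _.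
rewrite -[leRHS]Ex_cst; apply: Ex_le => //; [exact: bdd_meas_norm|exact: bdd_meas_cst].
Qed.

Lemma Ex_indic (A : set Omega) : measurable A -> Ex (\1_A : Omega -> R) = fine (P A).
Proof. by move=> mA; rewrite /Ex /Rintegral integral_indic// setIT. Qed.

(* [Z] is a uniform limit of step functions of [Z]. *)
Lemma Ex_orthogonal (Z H : Omega -> R) : bdd_meas Z -> bdd_meas H ->
  (forall B : set R, measurable B -> Ex (fun w => \1_(Z @^-1` B) w * H w) = 0) ->
  Ex (fun w => Z w * H w) = 0.
Proof.
move=> bZ bH orth.
have [mZ [B hB]] := bZ; have [_ [K hK]] := bH.
have mpre (A : set R) : measurable A -> measurable (Z @^-1` A).
  by move=> mA; rewrite -[X in measurable X]setTI; exact: mZ.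
have EH : Ex H = 0.
  rewrite -(orth setT)//; congr Ex; apply/funext => w.
  by rewrite preimage_setT indicT mul1r.
have B0 w : 0 <= Z w + B by rewrite -lerBlDr sub0r; have := hB w; rewrite ler_norml => /andP[].
have K0 : 0 <= K by apply: le_trans (hK point).
suff small (r : nat) : `|Ex (fun w => Z w * H w)| <= K / r.+1%:R.
  apply/eqP; rewrite -normr_le0; apply/ler_addgt0Pr => e e0; rewrite add0r.
  have [r hr] : exists r : nat, K / e < r.+1%:R.
    by exists (Num.truncn (K / e)); have /andP[] := truncn_itv (divr_ge0 K0 (ltW e0)).
  apply: le_trans (small r) _.
  by rewrite ler_pdivrMr// mulrC -ler_pdivrMr// ltW.
pose q : R := r.+1%:R.
have q0 : 0 < q by rewrite ltr0n.
(* [W] rounds the nonnegative function [Z + B] down to a multiple of [q^-1]; its values reach at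
   most [B + B], which fixes the number of steps. *)
pose N := (Num.truncn (q * (B + B))).+1.
pose I (i : nat) : set R := `[i%:R / q - B, i.+1%:R / q - B[%classic.
have mI i : measurable (I i) by exact: measurable_itv.
pose W w : R := \sum_(i < N) i%:R / q * \1_(Z @^-1` I i) w.
have bW : bdd_meas W.
  apply: (@bdd_meas_sum _ (index_enum _) _ (fun (i : 'I_N) w => i%:R / q * \1_(Z @^-1` I i) w)).
  move=> i _; apply: bdd_measM; first exact: bdd_meas_cst.
  by apply: bdd_meas_indic; exact: mpre.
have EW : Ex (fun w => W w * H w) = 0.
  rewrite /W; under eq_fun do rewrite mulr_suml.
  rewrite Ex_sum; last first.
    move=> i _; apply: bdd_measM => //; apply: bdd_measM; first exact: bdd_meas_cst.
    by apply: bdd_meas_indic; exact: mpre.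
  rewrite big1// => i _.
  transitivity (i%:R / q * Ex (fun w => \1_(Z @^-1` I i) w * H w)).
    rewrite -ExZ; last by apply: bdd_measM => //; apply: bdd_meas_indic; exact: mpre.
    by congr Ex; apply/funext => w; rewrite mulrA.
  by rewrite orth ?mulr0.
have close w : `|Z w + B - W w| <= q^-1.
  set t := q * (Z w + B); have t0 : 0 <= t by rewrite mulr_ge0// ltW.
  have /andP[t1 t2] := truncn_itv t0.
  have iN : (Num.truncn t < N)%N.
    rewrite ltnS; apply: le_truncn; rewrite ler_wpM2l ?(ltW q0)//.
    by rewrite lerD2r (le_trans (ler_norm _)).
  have -> : W w = (Num.truncn t)%:R / q.
    rewrite /W (bigD1 (Ordinal iN))//= indicE mem_set; last first.
      rewrite /I/= in_itv/= lerBlDr ltrBrDr ler_pdivrMr// ltr_pdivlMr//.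
      by rewrite ![(Z w + B) * q]mulrC -/t t1 t2.
    rewrite mulr1 big1 ?addr0// => i iE; rewrite indicE memNset ?mulr0//.
    rewrite /I/= in_itv/= lerBlDr ltrBrDr ler_pdivrMr// ltr_pdivlMr//.
    rewrite ![(Z w + B) * q]mulrC -/t => /andP[i1 i2].
    move/eqP: iE; apply; apply: val_inj => /=.
    by apply/esym/truncn_def; rewrite i1 i2.
  rewrite ger0_norm; last by rewrite subr_ge0 ler_pdivrMr// mulrC.
  rewrite lerBlDl -[X in _ <= _ + X]mul1r -mulrDl natr1 ler_pdivlMr//.
  by rewrite mulrC ltW.
have bZW : bdd_meas (fun w => (Z w + B - W w) * H w).
  apply: bdd_measM => //; under eq_fun do rewrite -mulN1r.
  apply: bdd_measD; first by apply: bdd_measD => //; exact: bdd_meas_cst.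
  by apply: bdd_measM => //; exact: bdd_meas_cst.
have bWH : bdd_meas (fun w => W w * H w) by exact: bdd_measM.
have bBH : bdd_meas (fun w => - B * H w) by apply: bdd_measM => //; exact: bdd_meas_cst.
have -> : Ex (fun w => Z w * H w) = Ex (fun w => (Z w + B - W w) * H w).
  have -> : (fun w => Z w * H w) = (fun w => (Z w + B - W w) * H w + (W w * H w + - B * H w)).
    by apply/funext => w; ring.
  rewrite ExD//; last exact: bdd_measD.
  by rewrite ExD// EW ExZ// EH mulr0 !addr0.
apply: Ex_normr_le => // w; rewrite normrM mulrC ler_pM//.
Qed.

End BoundedExpectation.

(** * Independence *)

Section Independent.
Context (dO : measure_display) (Omega : measurableType dO) (R : realType)
  (P : probability Omega R).
Variables (I : set nat) (X : nat -> {RV P >-> R}).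
Hypothesis indep : mutually_independent I X.
Local Notation Ex := (Ex P).

Let fineP (A : set Omega) : measurable A -> P A = (fine (P A))%:E.
Proof. by move=> mA; rewrite fineK// fin_num_measure. Qed.

Let mpre (j : nat) (B : set R) : measurable B -> measurable (X j @^-1` B).
Proof. by move=> mB; rewrite -[X in measurable X]setTI; exact: (measurable_funPT (X j)). Qed.

Definition cylinder (J : seq nat) (B : nat -> set R) : set Omega :=
  \bigcap_(j in [set` J]) (X j @^-1` B j).

Lemma cylinder_measurable (J : seq nat) (B : nat -> set R) :
  (forall j, measurable (B j)) -> measurable (cylinder J B).
Proof.
by move=> mB; apply: bigcap_measurableType => //= j _; exact: mpre.
Qed.

Lemma independent_seq (J : seq nat) (B : nat -> set R) : uniq J ->
  (forall j, j \in J -> I j) -> (forall j, measurable (B j)) ->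
  fine (P (cylinder J B)) = \prod_(j <- J) fine (P (X j @^-1` B j)).
Proof.
move=> uJ JI mB.
pose J' := [fset j in J]%fset.
have JJ' : [set` J'] = [set` J].
  by apply/seteqP; split => j /=; rewrite in_fset.
have := @indep J' B; rewrite JJ' => /(_ JI (fun j _ => mB j)).
rewrite -/(cylinder J B) => ->.
rewrite (perm_big J)/=; last first.
  by apply: uniq_perm => //; [exact: fset_uniq|move=> j; rewrite in_fset].
rewrite (eq_bigr (fun j => (fine (P (X j @^-1` B j)))%:E)); last first.
  by move=> j _; apply: fineP; exact: mpre.
by rewrite prodEFin.
Qed.

Lemma bdd_meas_comp (j : nat) (phi : R -> R) : measurable_fun setT phi ->
  (exists B, forall t, `|phi t| <= B) -> bdd_meas (fun w => phi (X j w)).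
Proof.
move=> mphi [B hB]; split; last by exists B => w.
by apply: measurableT_comp => //; exact: measurable_funPT.
Qed.

(** Induction on [J1]: by [Ex_orthogonal] a factor may be replaced by an indicator, which joins the
    cylinder. When only a cylinder [A] remains, [\1_A] minus its probability is orthogonal to every
    event of [X m] by the product rule, and the constant is killed by the zero mean. *)
Lemma Ex_independent_prod (phi : nat -> R -> R) (m : nat) (J1 J2 : seq nat) (B : nat -> set R) :
  (forall j, measurable_fun setT (phi j)) ->
  (forall j, exists B, forall t, `|phi j t| <= B) ->
  Ex (fun w => phi m (X m w)) = 0 ->
  uniq (m :: J1 ++ J2) -> (forall j, j \in m :: J1 ++ J2 -> I j) ->
  (forall j, measurable (B j)) ->
  Ex (fun w => phi m (X m w) * (\prod_(j <- J1) phi j (X j w) * \1_(cylinder J2 B) w)) = 0.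
Proof.
move=> mphi bphi Em; elim: J1 J2 B => [|j J1 ih] J2 B uJ JI mB.
  have mA := cylinder_measurable J2 mB.
  set A := cylinder J2 B in mA *; pose p := fine (P A).
  have bA := bdd_meas_indic R mA.
  have bH : bdd_meas (fun w => \1_A w + - p) by apply: bdd_measD => //; exact: bdd_meas_cst.
  have bm : bdd_meas (fun w => phi m (X m w)) by exact: bdd_meas_comp.
  have E0 : Ex (fun w => phi m (X m w) * (\1_A w + - p)) = 0.
    apply: Ex_orthogonal => // C mC.
    pose C' := phi m @^-1` C.
    have mC' : measurable C'.
      by rewrite /C' -[X in measurable X]setTI; exact: mphi.
    have mXC : measurable (X m @^-1` C') by exact: mpre.
    rewrite (_ : _ @^-1` _ = X m @^-1` C')//.
    rewrite (_ : (fun w => _) =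
       (fun w => \1_(X m @^-1` C' `&` A) w + - p * \1_(X m @^-1` C') w)); last first.
      by apply/funext => w; rewrite indicI/=; ring.
    have mI : measurable (X m @^-1` C' `&` A) by exact: measurableI.
    rewrite ExD; [|exact: bdd_meas_indic|]; last first.
      by apply: bdd_measM; [exact: bdd_meas_cst|exact: bdd_meas_indic].
    rewrite ExZ; last exact: bdd_meas_indic.
    rewrite !Ex_indic//.
    pose B' i := if i == m then C' else B i.
    have mB' i : measurable (B' i) by rewrite /B'; case: ifP.
    move: uJ; rewrite /= => /andP[mJ uJ2].
    have BE i : i \in J2 -> B' i = B i.
      by move=> iJ; rewrite /B'; case: eqP => // im; rewrite -im iJ in mJ.
    have AE : A = cylinder J2 B'.
      by rewrite /A /cylinder; apply: eq_bigcapr => i /= iJ; rewrite BE.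
    have -> : X m @^-1` C' `&` A = cylinder (m :: J2) B'.
      rewrite AE /cylinder; apply/seteqP; split => [w /= [w1 w2] i|w /= h].
        rewrite /= inE => /orP[/eqP ->|iJ]; first by rewrite /B' eqxx.
        exact: w2.
      split; first by have := h m; rewrite /= inE eqxx /B' eqxx; apply.
      by move=> i /= iJ; apply: h; rewrite /= inE iJ orbT.
    rewrite independent_seq//; last by rewrite /= mJ.
    rewrite big_cons /p AE (@independent_seq J2)//; last first.
      by move=> i iJ; apply: JI; rewrite inE iJ orbT.
    by rewrite {1}/B' eqxx mulNr mulrC subrr.
  under eq_fun do rewrite big_nil mul1r.
  have -> : (fun w => phi m (X m w) * \1_A w) =
     (fun w => phi m (X m w) * (\1_A w + - p) + p * phi m (X m w)).
    by apply/funext => w; ring.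
  rewrite ExD; [|exact: bdd_measM|by apply: bdd_measM => //; exact: bdd_meas_cst].
  by rewrite E0 ExZ// Em mulr0 addr0.
have mA := cylinder_measurable J2 mB.
pose H w := phi m (X m w) * (\prod_(j <- J1) phi j (X j w) * \1_(cylinder J2 B) w).
have bH : bdd_meas H.
  apply: bdd_measM; first exact: bdd_meas_comp.
  apply: bdd_measM; last exact: bdd_meas_indic.
  by apply: bdd_meas_prod => i _; exact: bdd_meas_comp.
rewrite (_ : (fun w => _) = (fun w => phi j (X j w) * H w)); last first.
  by apply/funext => w; rewrite big_cons /H; ring.
apply: Ex_orthogonal => //; first exact: bdd_meas_comp.
move=> C mC; pose C' := phi j @^-1` C.
have mC' : measurable C'.
  by rewrite /C' -[X in measurable X]setTI; exact: mphi.
pose B' i := if i == j then C' else B i.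
have mB' i : measurable (B' i) by rewrite /B'; case: ifP.
have jJ2 : j \notin J2.
  move: uJ => /= /andP[_]; rewrite mem_cat negb_or => /andP[/andP[_ jJ] _].
  exact: jJ.
have perm : perm_eq (m :: J1 ++ j :: J2) (m :: (j :: J1) ++ J2).
  by rewrite perm_cons -(cat1s j J2) (perm_catCA J1 [:: j] J2).
have JI' i : i \in m :: J1 ++ j :: J2 -> I i by rewrite (perm_mem perm) => /JI.
have := ih (j :: J2) B'; rewrite (perm_uniq perm) => /(_ uJ JI' mB') <-.
have BE i : i \in J2 -> B' i = B i.
  by move=> iJ; rewrite /B'; case: eqP => // ij; rewrite -ij iJ in jJ2.
have -> : cylinder (j :: J2) B' = (X j @^-1` C') `&` cylinder J2 B.
  rewrite /cylinder; apply/seteqP; split => [w /= h|w /= [w1 w2] i].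
    split; first by have := h j; rewrite /= inE eqxx /B' eqxx; apply.
    by move=> i /= iJ; rewrite -BE//; apply: h; rewrite /= inE iJ orbT.
  rewrite /= inE => /orP[/eqP ->|iJ]; first by rewrite /B' eqxx.
  by rewrite BE//; exact: w2.
rewrite (_ : (fun w => phi j (X j w)) @^-1` C = X j @^-1` C')//.
by congr Ex; apply/funext => w; rewrite indicI /H/=; ring.
Qed.

(** * Orthogonality of one variable to functions of the others *)

Section Span.
Variables (phi : R -> R) (m N : nat).
Hypothesis mphi : measurable_fun setT phi.
Hypothesis bphi : exists B, forall t, `|phi t| <= B.
Hypothesis I_pos : forall n, (0 < n)%N -> I n.
Hypothesis m_pos : (0 < m)%N.
Hypothesis Em : Ex (fun w => phi (X m w)) = 0.

Definition pure (c : R) (psi : nat -> R -> R) (w : Omega) : R :=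
  c * \prod_(1 <= i < N | i != m) psi i (X i w).

(* Only sums are constructors: products of pure functions are pure, so [span]
   is closed under multiplication. *)
Inductive span : (Omega -> R) -> Prop :=
| span_pure (c : R) (psi : nat -> R -> R) : (forall j, measurable_fun setT (psi j)) ->
    (forall j, exists B, forall t, `|psi j t| <= B) -> span (pure c psi)
| span_add g1 g2 : span g1 -> span g2 -> span (fun w => g1 w + g2 w).

Lemma span_bdd g : span g -> bdd_meas g.
Proof.
elim => [c psi mpsi bpsi|g1 g2 _ b1 _ b2]; last exact: bdd_measD.
apply: bdd_measM; first exact: bdd_meas_cst.
by apply: bdd_meas_prod => i _; exact: bdd_meas_comp.
Qed.

Lemma span_mul g1 g2 : span g1 -> span g2 -> span (fun w => g1 w * g2 w).
Proof.
move=> s1; elim: s1 g2 => [c psi mpsi bpsi|f1 f2 _ ih1 _ ih2] g2 s2; last first.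
  rewrite (_ : (fun w => _) = (fun w => f1 w * g2 w + f2 w * g2 w)).
    by apply: span_add; [exact: ih1|exact: ih2].
  by apply/funext => w; rewrite mulrDl.
elim: s2 => [c' psi' mpsi' bpsi'|f1 f2 _ ih1 _ ih2]; last first.
  rewrite (_ : (fun w => _) = (fun w => pure c psi w * f1 w + pure c psi w * f2 w)).
    exact: span_add.
  by apply/funext => w; rewrite mulrDr.
rewrite (_ : (fun w => _) = pure (c * c') (fun i t => psi i t * psi' i t)).
  apply: span_pure => j; first exact: measurable_realfun.measurable_funM.
  have [B1 h1] := bpsi j; have [B2 h2] := bpsi' j.
  by exists (B1 * B2) => t; rewrite normrM ler_pM.
by apply/funext => w; rewrite /pure big_split/=; ring.
Qed.

Lemma span_cst c : span (fun=> c).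
Proof.
rewrite (_ : (fun=> c) = pure c (fun _ _ => 1)).
  by apply: span_pure => j; [exact: measurable_cst|exists 1 => t; rewrite normr1].
by apply/funext => w; rewrite /pure big1 ?mulr1.
Qed.

Lemma span_sum (J : Type) (r : seq J) (p : pred J) (h : J -> Omega -> R) :
  (forall i, p i -> span (h i)) -> span (fun w => \sum_(i <- r | p i) h i w).
Proof.
move=> hh; elim: r => [|i r ih].
  by rewrite (_ : (fun w => _) = (fun=> 0)); [exact: span_cst|apply/funext => w; rewrite big_nil].
have [pi|npi] := boolP (p i).
  rewrite (_ : (fun w => _) = (fun w => h i w + \sum_(i <- r | p i) h i w)).
    by apply: span_add => //; exact: hh.
  by apply/funext => w; rewrite big_cons pi.
by rewrite (_ : (fun w => _) = (fun w => \sum_(i <- r | p i) h i w))//;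
  apply/funext => w; rewrite big_cons (negbTE npi).
Qed.

Lemma span_exp g n : span g -> span (fun w => g w ^+ n).
Proof.
move=> hg; elim: n => [|n ih].
  by rewrite (_ : (fun w => _) = (fun=> 1))//; exact: span_cst.
rewrite (_ : (fun w => _) = (fun w => g w * g w ^+ n)); first exact: span_mul.
by apply/funext => w; rewrite exprS.
Qed.

Lemma span_var i : (0 < i < N)%N -> i != m -> span (fun w => phi (X i w)).
Proof.
move=> iN im.
rewrite (_ : (fun w => _) = pure 1 (fun j t => if j == i then phi t else 1)).
  apply: span_pure => j; case: (j == i) => //.
  by exists 1 => t; rewrite normr1.
apply/funext => w; rewrite /pure mul1r -big_filter (bigD1_seq i)/= ?filter_uniq ?iota_uniq//.
  by rewrite eqxx big1 ?mulr1// => j /negbTE ->.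
by rewrite mem_filter im mem_index_iota.
Qed.

Lemma Ex_span g : span g -> Ex (fun w => phi (X m w) * g w) = 0.
Proof.
have bm : bdd_meas (fun w => phi (X m w)) by exact: bdd_meas_comp.
elim => [c psi mpsi bpsi|g1 g2 s1 E1 s2 E2]; last first.
  rewrite (_ : (fun w => _) = (fun w => phi (X m w) * g1 w + phi (X m w) * g2 w)).
    by rewrite ExD ?E1 ?E2 ?addr0//; apply: bdd_measM => //; exact: span_bdd.
  by apply/funext => w; rewrite mulrDr.
pose J := [seq i <- index_iota 1 N | i != m].
pose psi' j := if j == m then phi else psi j.
have mpsi' j : measurable_fun setT (psi' j) by rewrite /psi'; case: ifP.
have bpsi' j : exists B, forall t, `|psi' j t| <= B by rewrite /psi'; case: ifP.
have uJ : uniq (m :: J ++ [::]).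
  by rewrite cats0 /= mem_filter eqxx/= filter_uniq// iota_uniq.
have IJ j : j \in m :: J ++ [::] -> I j.
  rewrite cats0 inE mem_filter mem_index_iota => /orP[/eqP->|/andP[_ /andP[j0 _]]].
    exact: I_pos.
  exact: I_pos.
have mT (j : nat) : measurable ([set: R]) by exact: measurableT.
have Em' : Ex (fun w => psi' m (X m w)) = 0 by rewrite /psi' eqxx.
have := Ex_independent_prod mpsi' bpsi' Em' uJ IJ mT.
set K := (fun w => _) => EK.
rewrite (_ : (fun w => _) = (fun w => c * K w)).
  rewrite ExZ ?EK ?mulr0//.
  apply: bdd_measM; first exact: bdd_meas_comp.
  apply: bdd_measM; first by apply: bdd_meas_prod => i _; exact: bdd_meas_comp.
  by apply: bdd_meas_indic; exact: cylinder_measurable.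
apply/funext => w; rewrite /K /pure {1}/psi' eqxx.
have -> : cylinder [::] (fun=> [set: R]) = setT.
  by rewrite /cylinder set_nil bigcap_set0.
rewrite indicT mulr1 big_filter [X in _ = c * (_ * X)](eq_bigr (fun i => psi i (X i w))).
  by ring.
by move=> j /negbTE jm; rewrite /psi' jm.
Qed.

End Span.
End Independent.

(** * Moments of correlations *)

Section Moments.
Context (dO : measure_display) (Omega : measurableType dO) (R : realType)
  (P : probability Omega R).
Variables (I : set nat) (X : nat -> {RV P >-> R}) (phi : R -> R) (M : R).
Hypothesis indep : mutually_independent I X.
Hypothesis I_pos : forall n, (0 < n)%N -> I n.
Hypothesis mphi : measurable_fun setT phi.
Hypothesis phiM : forall t, `|phi t| <= M.
Hypothesis Ephi : forall n, (0 < n)%N -> Ex P (fun w => phi (X n w)) = 0.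
Local Notation Ex := (Ex P).

Let Y (n : nat) (w : Omega) : R := phi (X n w).
Let bphi : exists B, forall t, `|phi t| <= B. Proof. by exists M. Qed.
Let M0 : 0 <= M. Proof. exact: le_trans (phiM 0). Qed.

Let bdd_Y n : bdd_meas (Y n). Proof. exact: (bdd_meas_comp X n mphi bphi). Qed.

Let Ex_Y_span (m N : nat) g : (0 < m)%N -> span X m N g -> Ex (fun w => Y m w * g w) = 0.
Proof. by move=> m0; exact: (Ex_span indep mphi bphi I_pos m0 (Ephi m0)). Qed.

(** Induction on [b]. The new summand [x] contains [Y m] with [m = n0 + h], absent from [S0] and
    different from [Y n0], so terms linear in [x] have expectation 0. The cubic term need not
    vanish; it is absorbed by [4 * s * u ^+ 3 <= 2 * s ^+ 2 * u ^+ 2 + 2 * u ^+ 4]. *)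
Lemma correlation_moments (a : nat -> R) (j0 h b : nat) : (forall n, `|a n| <= 1) ->
  (0 < j0)%N -> (0 < h)%N ->
  let S w := \sum_(j0 <= n < j0 + b) a n * (Y n w * Y (n + h) w) in
  [/\ bdd_meas S, Ex (fun w => S w ^+ 2) <= M ^+ 4 * b%:R &
      Ex (fun w => S w ^+ 4) <= 8 * M ^+ 8 * b%:R ^+ 2].
Proof.
move=> a1 j00 h0; elim: b => [|b ih] S.
  have -> : S = (fun=> 0) by apply/funext => w; rewrite /S addn0 big_geq.
  by rewrite !expr0n/= !Ex_cst !mulr0; split => //; exact: bdd_meas_cst.
pose S0 w := \sum_(j0 <= n < j0 + b) a n * (Y n w * Y (n + h) w).
have [bS E2 E4] : [/\ bdd_meas S0, Ex (fun w => S0 w ^+ 2) <= M ^+ 4 * b%:R &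
      Ex (fun w => S0 w ^+ 4) <= 8 * M ^+ 8 * b%:R ^+ 2] := ih.
pose n0 := (j0 + b)%N; pose m := (n0 + h)%N.
pose x w : R := a n0 * (Y n0 w * Y m w).
have SE w : S w = S0 w + x w by rewrite /S addnS big_nat_recr ?leq_addr.
have bx : bdd_meas x.
  by apply: bdd_measM; [exact: bdd_meas_cst|exact: bdd_measM].
have bS' : bdd_meas S.
  by rewrite (_ : S = (fun w => S0 w + x w)); [exact: bdd_measD|apply/funext => w; rewrite SE].
have m0 : (0 < m)%N by rewrite /m /n0; lia.
have sp_var i : (0 < i < m.+1)%N -> i != m -> span X m m.+1 (Y i).
  exact: span_var.
have sp_S : span X m m.+1 S0.
  rewrite (_ : S0 = (fun w => \sum_(j0 <= n < j0 + b | (j0 <= n < j0 + b)%N)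
      a n * (Y n w * Y (n + h) w))); last by apply/funext => w; rewrite /S0 big_nat.
  apply: (@span_sum _ _ _ _ _ _ _ _ _ _ (fun n w => a n * (Y n w * Y (n + h) w))) => n /andP[n1 n2].
  apply: span_mul; first exact: span_cst.
  by apply: span_mul; apply: sp_var; rewrite /m /n0; lia.
have sp_n0 : span X m m.+1 (fun w => a n0 * Y n0 w).
  apply: span_mul; first exact: span_cst.
  by apply: sp_var; rewrite /m; lia.
have xM w : `|x w| <= M ^+ 2.
  rewrite /x !normrM -[leRHS]mul1r ler_pM// ?mulr_ge0// expr2 ler_pM// /Y; exact: phiM.
have xM2 w : x w ^+ 2 <= M ^+ 4.
  by rewrite -[x w ^+ 2]ger0_norm ?sqr_ge0// normrX
       (_ : M ^+ 4 = (M ^+ 2) ^+ 2) ?lerXn2r ?nnegrE ?exprn_ge0// -exprM.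
split=> //.
  have -> : (fun w => S w ^+ 2) =
      (fun w => S0 w ^+ 2 + (Y m w * (2 * (a n0 * Y n0 w) * S0 w) + x w ^+ 2)).
    by apply/funext => w; rewrite SE /x; ring.
  have sp1 : span X m m.+1 (fun w => 2 * (a n0 * Y n0 w) * S0 w).
    by apply: span_mul => //; apply: span_mul => //; exact: span_cst.
  have b1 : bdd_meas (fun w => Y m w * (2 * (a n0 * Y n0 w) * S0 w)).
    by apply: bdd_measM => //; exact: span_bdd sp1.
  have b2 := bdd_meas_exp 2 bx.
  have b3 := bdd_meas_exp 2 bS.
  rewrite ExD//; last exact: bdd_measD.
  rewrite ExD// (Ex_Y_span m0 sp1) add0r -(natr1 b) mulrDr mulr1 lerD//.
  by rewrite -[leRHS](Ex_cst P); apply: Ex_le => //; exact: bdd_meas_cst.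
have sp3 : span X m m.+1 (fun w => 4 * (a n0 * Y n0 w) * S0 w ^+ 3).
  by apply: span_mul; [apply: span_mul => //; exact: span_cst|exact: span_exp].
pose T w := S0 w ^+ 4 + (Y m w * (4 * (a n0 * Y n0 w) * S0 w ^+ 3) +
   (8 * M ^+ 4 * S0 w ^+ 2 + 3 * M ^+ 8)).
have b1 : bdd_meas (fun w => Y m w * (4 * (a n0 * Y n0 w) * S0 w ^+ 3)).
  by apply: bdd_measM => //; exact: span_bdd sp3.
have b2 := bdd_meas_exp 2 bS.
have b4 := bdd_meas_exp 4 bS.
have b5 : bdd_meas (fun w => 8 * M ^+ 4 * S0 w ^+ 2).
  by apply: bdd_measM => //; exact: bdd_meas_cst.
have b6 : bdd_meas (fun _ : Omega => 3 * M ^+ 8) by exact: bdd_meas_cst.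
have b7 := bdd_measD b5 b6.
have b8 := bdd_measD b1 b7.
apply: (@le_trans _ _ (Ex T)).
  apply: Ex_le; [exact: bdd_meas_exp|exact: bdd_measD|move=> w].
  rewrite SE /T.
  have -> : Y m w * (4 * (a n0 * Y n0 w) * S0 w ^+ 3) = 4 * S0 w ^+ 3 * x w by rewrite /x; ring.
  set s := S0 w; set u := x w.
  have u2 : 0 <= M ^+ 4 - u ^+ 2 by rewrite subr_ge0 xM2.
  have h1 : 0 <= 8 * s ^+ 2 * (M ^+ 4 - u ^+ 2) by rewrite mulr_ge0// mulr_ge0// sqr_ge0.
  have h2 : 0 <= 3 * ((M ^+ 4 - u ^+ 2) * (M ^+ 4 + u ^+ 2)).
    by rewrite mulr_ge0// mulr_ge0// addr_ge0// ?sqr_ge0// exprn_ge0.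
  have h3 : 0 <= 2 * (u ^+ 2 * (s - u) ^+ 2) by rewrite mulr_ge0// mulr_ge0// sqr_ge0.
  rewrite -subr_ge0.
  have -> : s ^+ 4 + (4 * s ^+ 3 * u + (8 * M ^+ 4 * s ^+ 2 + 3 * M ^+ 8)) - (s + u) ^+ 4 =
    8 * s ^+ 2 * (M ^+ 4 - u ^+ 2) + 3 * ((M ^+ 4 - u ^+ 2) * (M ^+ 4 + u ^+ 2))
      + 2 * (u ^+ 2 * (s - u) ^+ 2) by ring.
  by rewrite addr_ge0// addr_ge0.
rewrite /T ExD// ExD// ExD// (Ex_Y_span m0 sp3) add0r Ex_cst ExZ//.
apply: (@le_trans _ _ (8 * M ^+ 8 * b%:R ^+ 2 + (8 * M ^+ 4 * (M ^+ 4 * b%:R) + 3 * M ^+ 8))).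
  by rewrite lerD// lerD2r ler_wpM2l// mulr_ge0// exprn_ge0.
rewrite -(natr1 b) -subr_ge0.
have -> : 8 * M ^+ 8 * (b%:R + 1) ^+ 2 -
     (8 * M ^+ 8 * b%:R ^+ 2 + (8 * M ^+ 4 * (M ^+ 4 * b%:R) + 3 * M ^+ 8)) =
     (8 * b%:R + 5) * M ^+ 8 by ring.
by rewrite mulr_ge0 ?exprn_ge0// addr_ge0// mulr_ge0.
Qed.


(** * Sums over shifts of products of four variables *)

Section Quadruples.
Variables (v : nat -> R) (H : nat).
Hypothesis v1 : forall n, `|v n| <= 1.
Let y (n : nat) (w : Omega) : R := v n * Y n w.

Definition quad_sum (n1 n2 n3 n4 : nat) (w : Omega) : R :=
  \sum_(1 <= h < H) y (n1 + h) w * (y (n2 + h) w * (y (n3 + h) w * y (n4 + h) w)).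

Let bdd_y n : bdd_meas (y n). Proof. by apply: bdd_measM => //; exact: bdd_meas_cst. Qed.

Let y_le n w : `|y n w| <= M.
Proof. by rewrite normrM -[leRHS]mul1r ler_pM//; exact: phiM. Qed.

Let prod4_le n1 n2 n3 n4 w : `|y n1 w * (y n2 w * (y n3 w * y n4 w))| <= M ^+ 4.
Proof.
rewrite !exprS expr0 mulr1.
have mulM (u c : R) (n : nat) : `|u| <= c -> `|y n w * u| <= M * c.
  by move=> uc; rewrite normrM; apply: ler_pM => //; exact: y_le.
by apply: (mulM); apply: (mulM); apply: (mulM); exact: y_le.
Qed.

Lemma quad_sum_bdd n1 n2 n3 n4 : bdd_meas (quad_sum n1 n2 n3 n4).
Proof. by apply: bdd_meas_sum => h _; do 3!apply: bdd_measM => //. Qed.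

Lemma quad_sum_le n1 n2 n3 n4 w : `|quad_sum n1 n2 n3 n4 w| <= M ^+ 4 * H%:R.
Proof.
apply: le_trans (ler_norm_sum _ _ _) _.
apply: (@le_trans _ _ (\sum_(1 <= h < H) M ^+ 4)); first exact: ler_sum.
rewrite sumr_const_nat -[leLHS]mulr_natr ler_wpM2l ?exprn_ge0// ler_nat.
exact: leq_subr.
Qed.

(** Expand the square. For fixed [h], the variable of index [n1 + h] occurs once in the product at
    [h] and reappears in the product at [h'] for at most four [h']; for all other [h'] the
    expectation vanishes. *)
Lemma quad_sum_L2 (n1 n2 n3 n4 : nat) : n1 != n2 -> n1 != n3 -> n1 != n4 ->
  Ex (fun w => quad_sum n1 n2 n3 n4 w ^+ 2) <= 4 * M ^+ 8 * H%:R.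
Proof.
move=> n12 n13 n14.
pose z h w := y (n1 + h) w * (y (n2 + h) w * (y (n3 + h) w * y (n4 + h) w)).
have bz h : bdd_meas (z h) by do 3!apply: bdd_measM => //.
have zM h w : `|z h w| <= M ^+ 4 by exact: prod4_le.
have -> : (fun w => quad_sum n1 n2 n3 n4 w ^+ 2) =
    (fun w => \sum_(1 <= h < H) \sum_(1 <= h' < H) z h w * z h' w).
  by apply/funext => w; rewrite expr2 mulr_suml; apply: eq_bigr => h _; rewrite mulr_sumr.
rewrite Ex_sum; last by move=> h _; apply: bdd_meas_sum => h' _; exact: bdd_measM.
apply: (@le_trans _ _ (\sum_(1 <= h < H) 4 * M ^+ 8)); last first.
  rewrite sumr_const_nat -[leLHS]mulr_natr ler_wpM2l ?mulr_ge0 ?exprn_ge0// ler_nat.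
  exact: leq_subr.
rewrite !big_nat; apply: ler_sum => h /andP[h0 hH].
rewrite Ex_sum; last by move=> h' _; exact: bdd_measM.
(* Counts the [h'] with [i + h' = n1 + h]; a truncated difference is 0, outside the range. *)
pose c (i : nat) : R := \sum_(1 <= h' < H) (h' == n1 + h - i)%N%:R.
have c_le i : c i <= 1.
  rewrite /c -natr_sum lern1; set k := (_ - i)%N.
  rewrite -big_mkcond/= sum1_count.
  by rewrite (@count_uniq_mem _ _ k) ?iota_uniq// leq_b1.
apply: (@le_trans _ _ (M ^+ 8 * (c n1 + c n2 + c n3 + c n4))); last first.
  rewrite mulrC ler_wpM2r ?exprn_ge0//.
  by have := c_le n1; have := c_le n2; have := c_le n3; have := c_le n4; lra.
rewrite /c -!big_split/= mulr_sumr big_nat [leRHS]big_nat; apply: ler_sum => h' /andP[h'0 _].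
have [|disj] := boolP [|| h' == n1 + h - n1, h' == n1 + h - n2,
     h' == n1 + h - n3 | h' == n1 + h - n4]%N.
  move=> hit; apply: (@le_trans _ _ (M ^+ 8)).
    rewrite (le_trans (ler_norm _))//; apply: Ex_normr_le; first exact: bdd_measM.
    by move=> w; rewrite normrM (_ : M ^+ 8 = M ^+ 4 * M ^+ 4) ?ler_pM// -exprD.
  rewrite ler_peMr ?exprn_ge0// -!natrD ler1n.
  by case/or4P: hit => ->; rewrite ?addn_gt0 ?orbT.
apply: (@le_trans _ _ 0); last by rewrite mulr_ge0 ?exprn_ge0// -!natrD ler0n.
pose m := (n1 + h)%N; pose N := (m + n1 + n2 + n3 + n4 + h + h').+1.
have m0 : (0 < m)%N by rewrite /m; lia.
have sp i : (0 < i < N)%N -> i != m -> span X m N (y i).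
  by move=> iN im; apply: span_mul; [exact: span_cst|exact: span_var].
rewrite le_eqVlt; apply/orP; left; apply/eqP.
have sp1 : span X m N (fun w => v m * (y (n2 + h) w * (y (n3 + h) w * y (n4 + h) w) * z h' w)).
  move: disj; rewrite !negb_or => /and4P[/eqP d1 /eqP d2 /eqP d3 /eqP d4].
  move/eqP: n12 => n12; move/eqP: n13 => n13; move/eqP: n14 => n14.
  apply: span_mul; first exact: span_cst.
  apply: span_mul.
    apply: span_mul; [|apply: span_mul]; apply: sp; rewrite /m /N; lia.
  apply: (span_mul (g1 := y (n1 + h'))); first by apply: sp; rewrite /m /N; lia.
  apply: (span_mul (g1 := y (n2 + h'))); first by apply: sp; rewrite /m /N; lia.
  by apply: (span_mul (g1 := y (n3 + h'))); apply: sp; rewrite /m /N; lia.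
by rewrite -(Ex_Y_span m0 sp1); congr Ex; apply/funext => w; rewrite /z /y; ring.
Qed.

(** Equivalently, no value occurs exactly once: the quadruples to which [quad_sum_L2] applies in no
    order. *)
Definition matched (n1 n2 n3 n4 : nat) : bool :=
  [|| (n1 == n2) && (n3 == n4), (n1 == n3) && (n2 == n4) | (n1 == n4) && (n2 == n3)].

(** Some index differs from the other three and by symmetry may be put first, so the L2 bound
    applies; then [|Z| <= Z ^+ 2 / r + r]. *)
Lemma quad_sum_L1 (n1 n2 n3 n4 : nat) (r : R) : 0 < r -> ~~ matched n1 n2 n3 n4 ->
  Ex (fun w => `|quad_sum n1 n2 n3 n4 w|) <= 4 * M ^+ 8 * H%:R / r + r.
Proof.
move=> r0 unm; set Z := quad_sum n1 n2 n3 n4.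
have bZ : bdd_meas Z by exact: quad_sum_bdd.
have L2 : Ex (fun w => Z w ^+ 2) <= 4 * M ^+ 8 * H%:R.
  have perm2 : Z = quad_sum n2 n1 n3 n4.
    by apply/funext => w; apply: eq_bigr => h _; ring.
  have perm3 : Z = quad_sum n3 n1 n2 n4.
    by apply/funext => w; apply: eq_bigr => h _; ring.
  have perm4 : Z = quad_sum n4 n1 n2 n3.
    by apply/funext => w; apply: eq_bigr => h _; ring.
  have : [|| [&& n1 != n2, n1 != n3 & n1 != n4], [&& n2 != n1, n2 != n3 & n2 != n4],
    [&& n3 != n1, n3 != n2 & n3 != n4] | [&& n4 != n1, n4 != n2 & n4 != n3]].
    by move: unm; rewrite /matched; clear; lia.
  case/or4P => /and3P[u1 u2 u3]; first exact: quad_sum_L2.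
  - by rewrite perm2; exact: quad_sum_L2.
  - by rewrite perm3; exact: quad_sum_L2.
  - by rewrite perm4; exact: quad_sum_L2.
apply: (@le_trans _ _ (Ex (fun w => r^-1 * Z w ^+ 2 + r))).
  apply: Ex_le; [exact: bdd_meas_norm| |move=> w].
    apply: bdd_measD; last exact: bdd_meas_cst.
    by apply: bdd_measM; [exact: bdd_meas_cst|exact: bdd_meas_exp].
  have [Zr|rZ] := leP `|Z w| r.
    by rewrite (le_trans Zr)// lerDr mulr_ge0 ?sqr_ge0// invr_ge0 ltW.
  apply: (@le_trans _ _ (r^-1 * Z w ^+ 2)); last by rewrite lerDl ltW.
  by rewrite ler_pdivlMl// -[Z w ^+ 2]ger0_norm ?sqr_ge0// normrX expr2 ler_wpM2r// ltW.
have bZ2 : bdd_meas (fun w => r^-1 * Z w ^+ 2).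
  by apply: bdd_measM; [exact: bdd_meas_cst|exact: bdd_meas_exp].
have -> : Ex (fun w => r^-1 * Z w ^+ 2 + r) = Ex (fun w => r^-1 * Z w ^+ 2) + Ex (fun=> r).
  by apply: ExD => //; exact: bdd_meas_cst.
rewrite Ex_cst ExZ; last exact: bdd_meas_exp.
by rewrite lerD2r mulrC ler_wpM2r// invr_ge0 ltW.
Qed.

End Quadruples.

End Moments.

(** * The maximum over prefixes replaced by a sum over breakpoints *)

Section Coarse.
Variables (R : realType) (d : nat -> R) (M : R).
Hypothesis eM : forall n, `|dyadic_weight d n| <= M.

Let M0 : 0 <= M := M_ge0 eM.

(** Cuts the block into [gain j ^+ 6] pieces: few enough to sum over, and short enough that the
    fourth power of a piece is within a constant of [2 ^+ (2 * j) * gain j ^+ 8]. *)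
Definition coarse_step (j : nat) : nat := (2 ^ (j - 6 * (j %/ 16)))%N.

Let six (j : nat) : (6 * (j %/ 16) <= j)%N. Proof. clear; lia. Qed.

Lemma coarse_step_count (j : nat) : (coarse_step j * 2 ^ (6 * (j %/ 16)) = 2 ^ j)%N.
Proof. by rewrite /coarse_step -expnD subnK. Qed.

Lemma pair_corr_le (k h n : nat) : `|pair_corr d k h n| <= M ^+ 2.
Proof.
rewrite /pair_corr normrM expr2; apply: ler_pM => //.
rewrite normrM -[leRHS]mulr1; apply: ler_pM => //.
by case: (_ == _); rewrite ?normr1 ?normr0.
Qed.

(** Round the end [b] down to a breakpoint, leaving at most [coarse_step j] terms; then use that the
    fourth power of [|x| + c] is at most [8 * (x ^+ 4 + c ^+ 4)]. *)
Lemma corr_max_coarse (j k h : nat) :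
  corr_max d j k h ^+ 4 <= 8 * (\sum_(u < (2 ^ (6 * (j %/ 16))).+1)
     (\sum_(2 ^ j <= n < 2 ^ j + coarse_step j * u) pair_corr d k h n) ^+ 4
     + ((coarse_step j)%:R * M ^+ 2) ^+ 4).
Proof.
set c := (_ * M ^+ 2); set rhs := leRHS.
have c0 : 0 <= c by rewrite mulr_ge0// exprn_ge0.
have term0 u : 0 <= (\sum_(2 ^ j <= n < 2 ^ j + coarse_step j * u) pair_corr d k h n) ^+ 4.
  exact: exprn_even_ge0.
have rhs0 : 0 <= rhs.
  by rewrite mulr_ge0// addr_ge0 ?exprn_ge0// sumr_ge0.
suff [] : 0 <= corr_max d j k h /\ corr_max d j k h ^+ 4 <= rhs by [].
rewrite /corr_max; apply: (big_ind (fun x => 0 <= x /\ x ^+ 4 <= rhs)).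
- by rewrite expr0n.
- by move=> x y [x0 xr] [y0 yr]; rewrite /Num.max; case: ifP.
move=> b _; split=> //.
have [bj|jb] := leqP b (2 ^ j); first by rewrite big_geq// normr0 expr0n.
have s0 : (0 < coarse_step j)%N by rewrite expn_gt0.
set u := ((b - 2 ^ j) %/ coarse_step j)%N.
have ult : (u < (2 ^ (6 * (j %/ 16))).+1)%N.
  rewrite ltnS /u -(leq_pmul2l s0) coarse_step_count mulnC.
  apply: leq_trans (leq_divM _ _) _.
  by rewrite leq_subLR addnn -mul2n -expnS -ltnS ltn_ord.
have ub : (2 ^ j + coarse_step j * u <= b)%N.
  by rewrite -leq_subRL ?(ltnW jb)// mulnC /u leq_divM.
have rest : (b - (2 ^ j + coarse_step j * u) <= coarse_step j)%N.
  rewrite subnDA {1}(divn_eq (b - 2 ^ j) (coarse_step j)) -/u mulnC addKn ltnW// ltn_pmod//.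
set x := \sum_(2 ^ j <= n < 2 ^ j + coarse_step j * u) pair_corr d k h n.
have h1 : `|\sum_(2 ^ j <= n < b) pair_corr d k h n| <= `|x| + c.
  rewrite (big_cat_nat (leq_addr _ _) ub)/= (le_trans (ler_normD _ _))// lerD2l.
  apply: le_trans (ler_norm_sum _ _ _) _.
  apply: (@le_trans _ _ (\sum_(2 ^ j + coarse_step j * u <= n < b) M ^+ 2)).
    by apply: ler_sum => n _; exact: pair_corr_le.
  rewrite sumr_const_nat -[leLHS]mulr_natl ler_wpM2r ?exprn_ge0// ler_nat//.
apply: (@le_trans _ _ ((`|x| + c) ^+ 4)).
  by rewrite lerXn2r ?nnegrE// addr_ge0.
have h2 : (`|x| + c) ^+ 4 <= 8 * (x ^+ 4 + c ^+ 4).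
  have -> : x ^+ 4 = `|x| ^+ 4.
    by rewrite -[LHS]ger0_norm ?normrX//; exact: term0.
  rewrite -subr_ge0.
  have -> : 8 * (`|x| ^+ 4 + c ^+ 4) - (`|x| + c) ^+ 4 =
     (`|x| - c) ^+ 2 * (7 * `|x| ^+ 2 + 10 * (`|x| * c) + 7 * c ^+ 2) by ring.
  rewrite mulr_ge0 ?sqr_ge0// addr_ge0 ?mulr_ge0 ?sqr_ge0// addr_ge0 ?mulr_ge0 ?sqr_ge0//.
apply: le_trans h2 _; rewrite ler_wpM2l// lerD2r.
by rewrite (bigD1 (Ordinal ult))//= lerDl sumr_ge0.
Qed.

End Coarse.

(** * Expansion of fourth powers *)

Section FourthPower.
Variable R : realType.

Lemma sum_pow4 (c : nat -> R) (A b : nat) : (\sum_(A <= n < b) c n) ^+ 4 =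
  \sum_(A <= n1 < b) \sum_(A <= n2 < b) \sum_(A <= n3 < b) \sum_(A <= n4 < b)
    c n1 * (c n2 * (c n3 * c n4)).
Proof.
rewrite !exprS expr0 mulr1 mulr_suml; apply: eq_bigr => n1 _.
rewrite mulr_suml mulr_sumr; apply: eq_bigr => n2 _.
rewrite mulr_suml !mulr_sumr; apply: eq_bigr => n3 _.
by rewrite !mulr_sumr.
Qed.

(** Each of the three pairings leaves two free indices. *)
Lemma sum_matched (A b : nat) :
  \sum_(A <= n1 < b) \sum_(A <= n2 < b) \sum_(A <= n3 < b) \sum_(A <= n4 < b)
    (matched n1 n2 n3 n4)%:R <= 3 * (b - A)%:R ^+ 2 :> R.
Proof.
have one (m : nat) : \sum_(A <= n < b) (m == n)%:R <= 1 :> R.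
  rewrite -natr_sum lern1 -big_mkcond/= sum1_count.
  rewrite (eq_count (a2 := pred1 m)); last by move=> n; rewrite /= eq_sym.
  by rewrite (@count_uniq_mem _ _ m) ?iota_uniq// leq_b1.
have one' (m : nat) : 0 <= \sum_(A <= n < b) (m == n)%:R :> R by exact: sumr_ge0.
have cst (x : R) : \sum_(A <= n < b) x = (b - A)%:R * x.
  by rewrite sumr_const_nat mulr_natl.
apply: (@le_trans _ _ (\sum_(A <= n1 < b) \sum_(A <= n2 < b) \sum_(A <= n3 < b) \sum_(A <= n4 < b)
  ((n1 == n2)%:R * (n3 == n4)%:R + (n1 == n3)%:R * (n2 == n4)%:R + (n2 == n3)%:R * (n1 == n4)%:R))).
  do 4!(apply: ler_sum => ? _).
  rewrite /matched -!natrM -!natrD ler_nat.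
  by do 6!case: (_ == _).
have bnd (x : R) : 0 <= x -> forall m, \sum_(A <= n < b) (m == n)%:R * x <= x.
  by move=> x0 m; rewrite -mulr_suml ler_piMl.
apply: (@le_trans _ _ (\sum_(A <= n1 < b) \sum_(A <= n2 < b) \sum_(A <= n3 < b)
  ((n1 == n2)%:R + (n1 == n3)%:R + (n2 == n3)%:R))).
  do 3!(apply: ler_sum => ? _).
  rewrite !big_split/= -!mulr_sumr.
  by apply: lerD; [apply: lerD|]; apply: ler_piMr.
apply: (@le_trans _ _ (\sum_(A <= n1 < b) \sum_(A <= n2 < b)
  ((b - A)%:R * (n1 == n2)%:R + 1 + 1))).
  do 2!(apply: ler_sum => ? _).
  by rewrite !big_split/= cst; apply: lerD; [apply: lerD|].
apply: (@le_trans _ _ (\sum_(A <= n1 < b) ((b - A)%:R * 1 + (b - A)%:R * 1 + (b - A)%:R * 1))).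
  apply: ler_sum => ? _.
  rewrite !big_split/= cst -mulr_sumr.
  by rewrite lerD2r lerD2r ler_wpM2l.
by rewrite cst le_eqVlt; apply/orP; left; apply/eqP; ring.
Qed.

End FourthPower.

(** * From summable expectations to an almost sure bound *)

Section AlmostSureBound.
Context (dO : measure_display) (Omega : measurableType dO) (R : realType)
  (P : probability Omega R).

(** By monotone convergence the square partial sums increase to a function [L] with integral at most
    [B]; it is finite almost everywhere and dominates every term. *)
Lemma ae_bounded (F : nat -> nat -> Omega -> R) (B : R) :
  (forall j k, bdd_meas (F j k)) -> (forall j k w, 0 <= F j k w) ->
  (forall n, \sum_(j < n) \sum_(k < n) Ex P (F j k) <= B) ->
  {ae P, forall w, exists c, forall j k, F j k w <= c}.
Proof.
move=> bF F0 EB.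
pose G n w : R := \sum_(j < n) \sum_(k < n) F j k w.
have bG n : bdd_meas (G n).
  apply: (@bdd_meas_sum _ _ _ _ _ _ (fun (j : 'I_n) w => \sum_(k < n) F j k w)) => j _.
  by apply: (@bdd_meas_sum _ _ _ _ _ _ (fun (k : 'I_n) w => F j k w)) => k _.
have G0 n w : 0 <= G n w by apply: sumr_ge0 => j _; apply: sumr_ge0.
have EG n : Ex P (G n) <= B.
  rewrite /G Ex_sum; last first.
    move=> j _; by apply: (@bdd_meas_sum _ _ _ _ _ _ (fun (k : 'I_n) w => F j k w)) => k _.
  apply: le_trans (EB n); apply: ler_sum => j _.
  by rewrite Ex_sum.
have Gmono w : nondecreasing_seq (fun n => G n w).
  move=> n m nm; rewrite /G.
  rewrite (big_ord_widen m (fun j => \sum_(k < n) F j k w) nm) big_mkcond/=.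
  apply: ler_sum => j _; case: ifP => _; last exact: sumr_ge0.
  rewrite (big_ord_widen m (fun k => F j k w) nm) big_mkcond/=.
  by apply: ler_sum => k _; case: ifP.
have mG n : measurable_fun setT (EFin \o G n).
  by apply/measurable_EFinP; have [] := bG n.
have G0E n (w : Omega) : setT w -> (0 <= (EFin \o G n) w)%E by move=> _; rewrite /= lee_fin.
have GmE w : setT w -> nondecreasing_seq (fun n => (EFin \o G n) w).
  by move=> _ n m nm; rewrite /= lee_fin; exact: Gmono.
have := @cvg_monotone_convergence _ _ _ P setT measurableT _ mG G0E GmE.
set L := (fun w => limn _) => cvgL.
have LB : (\int[P]_w L w <= B%:E)%E.
  rewrite -(cvg_lim _ cvgL)//; apply: lime_le; first by apply/cvg_ex; exists (\int[P]_w L w)%E.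
  near=> n.
  rewrite -[leLHS]fineK; last by apply: integrable_fin_num => //; exact: bdd_meas_int.
  by rewrite lee_fin; exact: EG.
have L0 w : (0 <= L w)%E.
  apply: lime_ge; first exact: ereal_nondecreasing_is_cvgn (GmE w I).
  by near=> n; exact: G0E.
have mL : measurable_fun setT L.
  apply: (emeasurable_fun_cvg (fun n => EFin \o G n)) => // w _.
  exact: ereal_nondecreasing_is_cvgn (GmE w I).
have iL : P.-integrable setT L.
  apply/integrableP; split => //.
  under eq_integral do rewrite gee0_abs//.
  exact: le_lt_trans LB (ltry _).
have := integrable_ae measurableT iL.
apply: filterS => w /(_ I) Lfin.
exists (fine (L w)) => j k.
rewrite -lee_fin fineK//.
apply: (@le_trans _ _ (EFin (G (maxn j k).+1 w))).
  rewrite lee_fin /G.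
  have jm : (j < (maxn j k).+1)%N by rewrite ltnS leq_maxl.
  have km : (k < (maxn j k).+1)%N by rewrite ltnS leq_maxr.
  rewrite (bigD1 (Ordinal jm))//= (bigD1 (Ordinal km))//= -addrA lerDl.
  by rewrite addr_ge0// sumr_ge0// => i _; exact: sumr_ge0.
have -> : L w = ereal_sup (range (fun n => (EFin \o G n) w)).
  by apply/cvg_lim => //; exact: ereal_nondecreasing_cvgn (GmE w I).
by apply: ereal_sup_ubound; exists (maxn j k).+1.
Unshelve. all: by end_near.
Qed.

End AlmostSureBound.

(** * Almost sure decorrelation *)

Section Decorrelation.
Context (dO : measure_display) (Omega : measurableType dO) (R : realType)
  (P : probability Omega R).
Variables (I : set nat) (X : nat -> {RV P >-> R}) (phi : R -> R) (M : R).
Hypothesis indep : mutually_independent I X.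
Hypothesis I_pos : forall n, (0 < n)%N -> I n.
Hypothesis mphi : measurable_fun setT phi.
Hypothesis phiM : forall t, `|phi t| <= M.
Hypothesis Ephi : forall n, (0 < n)%N -> Ex P (fun w => phi (X n w)) = 0.

Let Y (n : nat) (w : Omega) : R := phi (X n w).
Let bphi : exists B, forall t, `|phi t| <= B. Proof. by exists M. Qed.
Let M0 : 0 <= M. Proof. exact: le_trans (phiM 0). Qed.
Let bdd_Y n : bdd_meas (Y n). Proof. exact: (bdd_meas_comp X n mphi bphi). Qed.

Definition dyadic_ratio (n : nat) : R := 2 ^+ blk n / n%:R.
Definition block_ratio (k n : nat) : R := dyadic_ratio n * (blk n == k)%:R.

Lemma dyadic_ratio_ge0 n : 0 <= dyadic_ratio n. Proof. by rewrite divr_ge0// exprn_ge0. Qed.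

Lemma dyadic_ratio_le1 n : dyadic_ratio n <= 1.
Proof.
rewrite /dyadic_ratio; have [->|n0] := posnP n; first by rewrite invr0 mulr0.
have /andP[h _] := blk_bounds n0.
by rewrite ler_pdivrMr ?ltr0n// mul1r -natrX ler_nat.
Qed.

Lemma block_ratio_norm k n : `|block_ratio k n| <= 1.
Proof.
rewrite /block_ratio normrM ger0_norm ?dyadic_ratio_ge0//
  -[leRHS]mul1r ler_pM ?dyadic_ratio_ge0 ?dyadic_ratio_le1//.
by case: (_ == _); rewrite ?normr1 ?normr0.
Qed.

Lemma dyadic_weight_le (y : nat -> R) (c : R) : (forall n, `|y n| <= c) ->
  forall n, `|dyadic_weight (fun n => y n / n%:R) n| <= c.
Proof.
move=> yc n; rewrite /dyadic_weight (_ : _ * _ = dyadic_ratio n * y n);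
  last by rewrite /dyadic_ratio; ring.
by rewrite normrM ger0_norm ?dyadic_ratio_ge0//
  -[leRHS]mul1r ler_pM ?dyadic_ratio_ge0 ?dyadic_ratio_le1.
Qed.

(** Written so that the factor depending on [h] is the weight [v] of [quad_sum] at [n + h]; the
    other factor leaves the sum over [h]. *)
Definition coef (k h n : nat) : R := dyadic_ratio n * block_ratio k (n + h).

Lemma coef_norm k h n : `|coef k h n| <= 1.
Proof.
by rewrite /coef normrM ger0_norm ?dyadic_ratio_ge0//
  -[leRHS]mul1r ler_pM ?dyadic_ratio_ge0 ?dyadic_ratio_le1 ?block_ratio_norm.
Qed.

Lemma pair_corr_coef (w : Omega) (k h n : nat) :
  pair_corr (fun n => Y n w / n%:R) k h n = coef k h n * (Y n w * Y (n + h) w).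
Proof. by rewrite /pair_corr /dyadic_weight /coef /block_ratio /dyadic_ratio; ring. Qed.

Definition pow4_sum (j k b : nat) (w : Omega) : R := \sum_(1 <= h < 2 ^ k.+1)
  (\sum_(2 ^ j <= n < b) coef k h n * (Y n w * Y (n + h) w)) ^+ 4.
Local Notation quad k := (quad_sum X phi (block_ratio k) (2 ^ k.+1)).
Definition unmatched_sum (j k b : nat) (w : Omega) : R :=
  \sum_(2 ^ j <= n1 < b) \sum_(2 ^ j <= n2 < b) \sum_(2 ^ j <= n3 < b) \sum_(2 ^ j <= n4 < b)
    (~~ matched n1 n2 n3 n4)%:R * `|quad k n1 n2 n3 n4 w|.

Lemma pow4_sum_bdd j k b : bdd_meas (pow4_sum j k b).
Proof.
apply: bdd_meas_sum => h _; apply: bdd_meas_exp; apply: bdd_meas_sum => n _.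
by apply: bdd_measM; [exact: bdd_meas_cst|exact: bdd_measM].
Qed.

Let bdd_quad k n1 n2 n3 n4 : bdd_meas (quad k n1 n2 n3 n4).
Proof. exact: (quad_sum_bdd _ mphi phiM). Qed.

Lemma unmatched_sum_bdd j k b : bdd_meas (unmatched_sum j k b).
Proof.
do 4!(apply: bdd_meas_sum => ? _).
by apply: bdd_measM; [exact: bdd_meas_cst|exact: bdd_meas_norm].
Qed.

(** Expand and sum over [h] first. Matched quadruples are bounded trivially for every [w], so only
    the unmatched part has to be summable in [k]. *)
Lemma pow4_sum_le (j k b : nat) (w : Omega) : (b - 2 ^ j <= 2 ^ j)%N ->
  pow4_sum j k b w <= 3 * M ^+ 8 * 2 ^+ k.+1 * 2 ^+ (2 * j) + M ^+ 4 * unmatched_sum j k b w.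
Proof.
move=> bj; pose A := (2 ^ j)%N; pose H := (2 ^ k.+1)%N.
pose x n := dyadic_ratio n * Y n w; pose y n := block_ratio k n * Y n w.
have xM n : `|x n| <= M.
  by rewrite /x normrM ger0_norm ?dyadic_ratio_ge0//
  -[leRHS]mul1r ler_pM ?dyadic_ratio_ge0 ?dyadic_ratio_le1//; exact: phiM.
have -> : pow4_sum j k b w = \sum_(A <= n1 < b) \sum_(A <= n2 < b) \sum_(A <= n3 < b)
    \sum_(A <= n4 < b) x n1 * (x n2 * (x n3 * x n4)) * quad k n1 n2 n3 n4 w.
  rewrite /pow4_sum; under eq_bigr do rewrite sum_pow4.
  rewrite exchange_big/=; apply: eq_bigr => n1 _.
  rewrite exchange_big/=; apply: eq_bigr => n2 _.
  rewrite exchange_big/=; apply: eq_bigr => n3 _.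
  rewrite exchange_big/=; apply: eq_bigr => n4 _.
  by rewrite /quad_sum mulr_sumr; apply: eq_bigr => h _; rewrite /x /coef /Y; ring.
apply: (@le_trans _ _ (\sum_(A <= n1 < b) \sum_(A <= n2 < b) \sum_(A <= n3 < b)
    \sum_(A <= n4 < b) (M ^+ 8 * H%:R * (matched n1 n2 n3 n4)%:R +
      M ^+ 4 * ((~~ matched n1 n2 n3 n4)%:R * `|quad k n1 n2 n3 n4 w|)))).
  apply: ler_sum => n1 _; apply: ler_sum => n2 _; apply: ler_sum => n3 _; apply: ler_sum => n4 _.
  have x4 : `|x n1 * (x n2 * (x n3 * x n4))| <= M ^+ 4.
    have mulM (u c : R) (n : nat) : `|u| <= c -> `|x n * u| <= M * c.
      by move=> uc; rewrite normrM; apply: ler_pM => //; exact: xM.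
    rewrite !exprS expr0 mulr1.
    by apply: (mulM); apply: (mulM); apply: (mulM); exact: xM.
  rewrite (le_trans (ler_norm _))// normrM.
  case: (matched _ _ _ _) => /=.
    rewrite mulr1 mul0r mulr0 addr0 (_ : M ^+ 8 * H%:R = M ^+ 4 * (M ^+ 4 * H%:R)); last by ring.
    by apply: ler_pM => //; exact: (quad_sum_le _ phiM _ (block_ratio_norm k)).
  by rewrite mulr0 add0r mul1r; apply: ler_wpM2r.
have split4 (F G : nat -> nat -> nat -> nat -> R) (c c' : R) :
    \sum_(A <= n1 < b) \sum_(A <= n2 < b) \sum_(A <= n3 < b) \sum_(A <= n4 < b)
      (c * F n1 n2 n3 n4 + c' * G n1 n2 n3 n4) =
    c * (\sum_(A <= n1 < b) \sum_(A <= n2 < b) \sum_(A <= n3 < b) \sum_(A <= n4 < b) F n1 n2 n3 n4)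
    + c' * \sum_(A <= n1 < b) \sum_(A <= n2 < b)
      \sum_(A <= n3 < b) \sum_(A <= n4 < b) G n1 n2 n3 n4.
  do 4!(rewrite !mulr_sumr -big_split/=; apply: eq_bigr => ? _).
  by [].
rewrite split4 lerD2r.
apply: (@le_trans _ _ (M ^+ 8 * H%:R * (3 * (b - A)%:R ^+ 2))).
  by rewrite ler_wpM2l ?sum_matched// mulr_ge0// exprn_ge0.
have -> : 3 * M ^+ 8 * 2 ^+ k.+1 * 2 ^+ (2 * j) = M ^+ 8 * H%:R * (3 * (2 ^+ j) ^+ 2).
  by rewrite /H natrX mulnC exprM; ring.
rewrite ler_wpM2l ?mulr_ge0 ?exprn_ge0// ler_wpM2l// lerXn2r ?nnegrE ?exprn_ge0//.
by rewrite -natrX ler_nat.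
Qed.

Lemma Ex_pow4_sum (j k t : nat) : (t <= 2 ^ j)%N ->
  Ex P (pow4_sum j k (2 ^ j + t)) <= 8 * M ^+ 8 * 2 ^+ k.+1 * 2 ^+ (2 * j).
Proof.
move=> tj.
have j0 : (0 < 2 ^ j)%N by rewrite expn_gt0.
have bS h : bdd_meas (fun w => \sum_(2 ^ j <= n < 2 ^ j + t) coef k h n * (Y n w * Y (n + h) w)).
  apply: bdd_meas_sum => n _.
  by apply: bdd_measM; [exact: bdd_meas_cst|exact: bdd_measM].
rewrite /pow4_sum Ex_sum; last by move=> h _; exact: bdd_meas_exp.
apply: (@le_trans _ _ (\sum_(1 <= h < 2 ^ k.+1) 8 * M ^+ 8 * (2 ^+ j) ^+ 2)).
  rewrite !big_nat; apply: ler_sum => h /andP[h0 _].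
  have [_ _ E4] := correlation_moments indep I_pos mphi phiM Ephi t (coef_norm k h) j0 h0.
  apply: le_trans E4 _; rewrite ler_wpM2l ?mulr_ge0 ?exprn_ge0// lerXn2r ?nnegrE ?exprn_ge0//.
  by rewrite -natrX ler_nat.
rewrite sumr_const_nat -[leLHS]mulr_natr.
have -> : 8 * M ^+ 8 * 2 ^+ k.+1 * 2 ^+ (2 * j) = 8 * M ^+ 8 * (2 ^+ j) ^+ 2 * 2 ^+ k.+1.
  by rewrite (mulnC 2%N) exprM; ring.
by rewrite ler_wpM2l ?mulr_ge0 ?exprn_ge0// -natrX ler_nat leq_subr.
Qed.

(** [r = 2 ^+ (k %/ 2)] balances the two terms of [quad_sum_L1], since the range [2 ^ k.+1] of
    shifts is at most [4 * r ^+ 2]; at most [2 ^ (4 * j)] quadruples occur. *)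
Lemma Ex_unmatched_sum (j k b : nat) : (b - 2 ^ j <= 2 ^ j)%N ->
  Ex P (unmatched_sum j k b) <= (16 * M ^+ 8 + 1) * 2 ^+ (k %/ 2) * 2 ^+ (4 * j).
Proof.
move=> bj; pose r : R := 2 ^+ (k %/ 2).
have r0 : 0 < r by exact: exprn_gt0.
pose c : R := (16 * M ^+ 8 + 1) * r.
have c0 : 0 <= c by rewrite mulr_ge0 ?(ltW r0)// addr_ge0// mulr_ge0// exprn_ge0.
have Hr : (2 ^ k.+1)%:R <= 4 * r ^+ 2.
  rewrite /r -exprM (_ : 4 = 2 ^+ 2); last by rewrite expr2 -natrM.
  by rewrite -exprD natrX ler_weXn2l ?ler1n//; clear; lia.
have one n1 n2 n3 n4 :
    Ex P (fun w => (~~ matched n1 n2 n3 n4)%:R * `|quad k n1 n2 n3 n4 w|) <= c.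
  have bq := bdd_meas_norm (bdd_quad k n1 n2 n3 n4).
  rewrite ExZ//; case: (boolP (matched n1 n2 n3 n4)) => [|unm]; first by rewrite mul0r.
  rewrite mul1r.
  apply: le_trans (quad_sum_L1 indep I_pos mphi phiM Ephi _ (block_ratio_norm k) r0 unm) _.
  rewrite /c [leRHS]mulrDl mul1r lerD2r ler_pdivrMr//.
  apply: (@le_trans _ _ (4 * M ^+ 8 * (4 * r ^+ 2))).
    by rewrite ler_wpM2l// mulr_ge0// exprn_ge0.
  by rewrite le_eqVlt; apply/orP; left; apply/eqP; ring.
have cst (x : R) : 0 <= x -> \sum_(2 ^ j <= n < b) x <= 2 ^+ j * x.
  move=> x0; rewrite sumr_const_nat -[leLHS]mulr_natl ler_wpM2r//.
  by rewrite -natrX ler_nat.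
have b1 n1 n2 n3 n4 : bdd_meas (fun w => (~~ matched n1 n2 n3 n4)%:R * `|quad k n1 n2 n3 n4 w|).
  by apply: bdd_measM; [exact: bdd_meas_cst|exact: bdd_meas_norm].
have b2 n1 n2 n3 : bdd_meas (fun w => \sum_(2 ^ j <= n4 < b)
    (~~ matched n1 n2 n3 n4)%:R * `|quad k n1 n2 n3 n4 w|).
  by apply: bdd_meas_sum => n4 _; exact: b1.
have b3 n1 n2 : bdd_meas (fun w => \sum_(2 ^ j <= n3 < b) \sum_(2 ^ j <= n4 < b)
    (~~ matched n1 n2 n3 n4)%:R * `|quad k n1 n2 n3 n4 w|).
  by apply: bdd_meas_sum => n3 _; exact: b2.
have b4 n1 : bdd_meas (fun w => \sum_(2 ^ j <= n2 < b) \sum_(2 ^ j <= n3 < b) \sum_(2 ^ j <= n4 < b)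
    (~~ matched n1 n2 n3 n4)%:R * `|quad k n1 n2 n3 n4 w|).
  by apply: bdd_meas_sum => n2 _; exact: b3.
have J0 : 0 <= 2 ^+ j :> R by rewrite exprn_ge0.
rewrite /unmatched_sum Ex_sum//.
apply: (@le_trans _ _ (2 ^+ j * (2 ^+ j * (2 ^+ j * (2 ^+ j * c))))); last first.
  by rewrite (mulnC 4%N) exprM -/r -/c le_eqVlt; apply/orP; left; apply/eqP; ring.
apply: (le_trans _ (cst _ _)); last by do ?[exact: c0|apply: (mulr_ge0 J0)].
apply: ler_sum => n1 _; rewrite Ex_sum//.
apply: (le_trans _ (cst _ _)); last by do ?[exact: c0|apply: (mulr_ge0 J0)].
apply: ler_sum => n2 _; rewrite Ex_sum//.
apply: (le_trans _ (cst _ _)); last by do ?[exact: c0|apply: (mulr_ge0 J0)].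
apply: ler_sum => n3 _; rewrite Ex_sum//.
apply: (le_trans _ (cst _ _)); last by do ?[exact: c0|apply: (mulr_ge0 J0)].
by apply: ler_sum => n4 _; exact: one.
Qed.

(** * Summability over the scales [j] and [k] *)

Local Notation q j := (j %/ 16)%N.
Let nrm (j k : nat) : R := 2 ^+ (k + 2 * j) * gain R j ^+ 8.
Let brk (j u : nat) : nat := (2 ^ j + coarse_step j * u)%N.
(** Relative to [nrm] and summed over breakpoints, the fourth moment is of order [gain j ^- 2], good
    for the [4 * j] values [k < 4 * j]. For the other [k] the unmatched part has the extra factor
    [2 ^+ (2 * j) * 2^-1 ^+ (k %/ 2)], summable in [k]. *)
Let part (j k u : nat) (w : Omega) : R :=
  if (k < 4 * j)%N then pow4_sum j k (brk j u) w else M ^+ 4 * unmatched_sum j k (brk j u) w.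
Let total (j k : nat) (w : Omega) : R :=
  (nrm j k)^-1 * \sum_(u < (2 ^ (6 * q j)).+1) part j k u w.

Let nrm_gt0 j k : 0 < nrm j k.
Proof. by rewrite mulr_gt0// exprn_gt0// gain_gt0. Qed.

Let brk_le j (u : 'I_(2 ^ (6 * q j)).+1) : (coarse_step j * u <= 2 ^ j)%N.
Proof. by rewrite -[leqRHS]coarse_step_count leq_mul2l -ltnS ltn_ord orbT. Qed.

Let pow4_sum_ge0 j k b w : 0 <= pow4_sum j k b w.
Proof. by apply: sumr_ge0 => h _; exact: exprn_even_ge0. Qed.

Let unmatched_sum_ge0 j k b w : 0 <= unmatched_sum j k b w.
Proof. by do 4!(apply: sumr_ge0 => ? _); rewrite mulr_ge0. Qed.

Let part_ge0 j k u w : 0 <= part j k u w.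
Proof. by rewrite /part; case: ifP => _ //; rewrite mulr_ge0// exprn_ge0. Qed.

Let partE1 j k u : (k < 4 * j)%N -> part j k u = pow4_sum j k (brk j u).
Proof. by move=> kj; apply/funext => w; rewrite /part kj. Qed.

Let partE2 j k u : (k < 4 * j)%N = false ->
  part j k u = (fun w => M ^+ 4 * unmatched_sum j k (brk j u) w).
Proof. by move=> kj; apply/funext => w; rewrite /part kj. Qed.

Let part_bdd j k u : bdd_meas (part j k u).
Proof.
have [kj|kj] := boolP (k < 4 * j)%N; first by rewrite partE1//; exact: pow4_sum_bdd.
rewrite partE2; last exact: negbTE.
by apply: bdd_measM; [exact: bdd_meas_cst|exact: unmatched_sum_bdd].
Qed.

Let K0 : R := 2 * (16 * M ^+ 8 + M ^+ 4 * (16 * M ^+ 8 + 1)).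

Let count_le j : ((2 ^ (6 * q j)).+1)%:R <= 2 * gain R j ^+ 6.
Proof.
rewrite /gain -exprM mulnC -natrX -natrM ler_nat mul2n -addnn -addn1 leq_add2l.
by rewrite expn_gt0.
Qed.

Let M8 : 0 <= 16 * M ^+ 8. Proof. by rewrite mulr_ge0// exprn_ge0. Qed.
Let M12 : 0 <= M ^+ 4 * (16 * M ^+ 8 + 1).
Proof. by rewrite mulr_ge0 ?exprn_ge0// addr_ge0. Qed.

Let Ex_total j k : Ex P (total j k) <=
  K0 / gain R j ^+ 2 * (if (k < 4 * j)%N then 1 else 2 ^+ (2 * j) * 2^-1 ^+ (k %/ 2)).
Proof.
have g0 := gain_gt0 R j.
rewrite /total ExZ; last by apply: bdd_meas_sum => u _; exact: part_bdd.
rewrite Ex_sum; last by move=> u _; exact: part_bdd.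
rewrite ler_pdivrMl ?nrm_gt0//.
have cst (x : R) : 0 <= x -> \sum_(u < (2 ^ (6 * q j)).+1) x <= 2 * gain R j ^+ 6 * x.
  by move=> x0; rewrite sumr_const card_ord -[leLHS]mulr_natl ler_wpM2r.
case: ifP => kj.
  apply: (@le_trans _ _ (2 * gain R j ^+ 6 * (16 * M ^+ 8 * 2 ^+ (k + 2 * j)))).
    apply: (le_trans _ (cst _ _)); last by rewrite mulr_ge0// exprn_ge0.
    apply: ler_sum => u _; rewrite partE1//.
    apply: le_trans (Ex_pow4_sum k (brk_le u)) _.
    by rewrite exprD (exprS _ k) le_eqVlt; apply/orP; left; apply/eqP; ring.
  have -> : nrm j k * (K0 / gain R j ^+ 2 * 1) = gain R j ^+ 6 * (K0 * 2 ^+ (k + 2 * j)).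
    by rewrite /nrm; field; rewrite gt_eqF.
  have -> : 2 * gain R j ^+ 6 * (16 * M ^+ 8 * 2 ^+ (k + 2 * j)) =
    gain R j ^+ 6 * (2 * (16 * M ^+ 8) * 2 ^+ (k + 2 * j)) by ring.
  rewrite ler_wpM2l ?exprn_ge0 ?(ltW g0)// ler_wpM2r ?exprn_ge0// /K0 ler_wpM2l//.
  by rewrite lerDl.
have V0 := M12; set V := M ^+ 4 * (16 * M ^+ 8 + 1) in V0 *.
apply: (@le_trans _ _ (2 * gain R j ^+ 6 * (V * 2 ^+ (k %/ 2) * 2 ^+ (4 * j)))).
  apply: (le_trans _ (cst _ _)); last first.
    apply: mulr_ge0; last exact: exprn_ge0.
    by apply: mulr_ge0 => //; exact: exprn_ge0.
  apply: ler_sum => u _; rewrite partE2// ExZ; last exact: unmatched_sum_bdd.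
  rewrite (_ : V * _ * _ = M ^+ 4 * ((16 * M ^+ 8 + 1) * 2 ^+ (k %/ 2) * 2 ^+ (4 * j))).
    by rewrite ler_wpM2l ?exprn_ge0//; apply: Ex_unmatched_sum; rewrite /brk addKn; exact: brk_le.
  by rewrite /V; ring.
have k2 : 2 ^+ (k %/ 2) <= 2 ^+ k * 2^-1 ^+ (k %/ 2) :> R.
  rewrite exprVn ler_pdivlMr ?exprn_gt0// -exprD ler_weXn2l ?ler1n//.
  by clear; lia.
have -> : nrm j k * (K0 / gain R j ^+ 2 * (2 ^+ (2 * j) * 2^-1 ^+ (k %/ 2))) =
    gain R j ^+ 6 * (2 ^+ (4 * j)) * (K0 * (2 ^+ k * 2^-1 ^+ (k %/ 2))).
  rewrite /nrm exprD (_ : (4 * j = 2 * j + 2 * j)%N); last by clear; lia.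
  by rewrite exprD; field; rewrite gt_eqF.
have -> : 2 * gain R j ^+ 6 * (V * 2 ^+ (k %/ 2) * 2 ^+ (4 * j)) =
  gain R j ^+ 6 * 2 ^+ (4 * j) * (2 * V * 2 ^+ (k %/ 2)) by ring.
rewrite ler_wpM2l ?mulr_ge0 ?exprn_ge0 ?(ltW g0)//.
by apply: ler_pM; [exact: mulr_ge0|exact: exprn_ge0|apply: ler_wpM2l => //; rewrite lerDr|].
Qed.

(** At [k = 4 * j] the geometric tail exactly cancels [2 ^+ (2 * j)], so the sum over [k]
    contributes at most [4 * j + 4 <= 64 * gain j] against [gain j ^+ 2]. Then [2048 = 64 * 32]. *)
Let total_sum n : \sum_(j < n) \sum_(k < n) Ex P (total j k) <= 2048 * K0.
Proof.
have K00 : 0 <= K0 by rewrite mulr_ge0// addr_ge0.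
apply: (@le_trans _ _ (\sum_(j < n) K0 * 64 * 2^-1 ^+ q j)); last first.
  rewrite -mulr_sumr -(big_mkord xpredT (fun j => 2^-1 ^+ q j)).
  apply: (@le_trans _ _ (K0 * 64 * 32)); last by rewrite le_eqVlt; apply/orP; left; apply/eqP; ring.
  apply: ler_wpM2l; first exact: mulr_ge0 K00 (ler0n _ _).
  by apply: le_trans (sum_geo_floor R _ _ _) _ => //; rewrite div0n expr0 mulr1.
apply: ler_sum => j _.
have g0 := gain_gt0 R j.
apply: (@le_trans _ _ (\sum_(k < n) K0 / gain R j ^+ 2 *
    ((0 <= k < 4 * j)%N%:R + 2 ^+ (2 * j) * (2^-1 ^+ (k %/ 2) * (4 * j <= k)%N%:R)))).
  apply: ler_sum => k _; apply: le_trans (Ex_total j k) _.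
  apply: ler_wpM2l; first by apply: mulr_ge0 => //; rewrite invr_ge0 exprn_ge0// ltW.
  by case: ltnP => /= _; rewrite ?mulr0 ?addr0 ?mulr1 ?add0r.
rewrite -mulr_sumr -mulrA -[leRHS]mulrA ler_wpM2l//.
rewrite big_split/= -mulr_sumr.
apply: (@le_trans _ _ ((gain R j ^+ 2)^-1 * ((4 * j)%:R + 4))).
  rewrite ler_wpM2l ?invr_ge0 ?exprn_ge0 ?(ltW g0)//; apply: lerD.
    by apply: le_trans (sum_ord_itv_le R n 0 (4 * j)) _; rewrite subn0.
  have -> : \sum_(k < n) (2^-1 : R) ^+ (k %/ 2) * (4 * j <= k)%N%:R =
      \sum_(4 * j <= k < n) 2^-1 ^+ (k %/ 2).
    rewrite big_geq_mkord/= [RHS]big_mkcond/=; apply: eq_bigr => k _.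
    by case: leqP => _; rewrite ?mulr1 ?mulr0.
  apply: (@le_trans _ _ (2 ^+ (2 * j) * ((2 * 2)%:R * 2^-1 ^+ (2 * j)))).
    rewrite ler_wpM2l ?exprn_ge0//.
    apply: le_trans (sum_geo_floor R _ _ _) _ => //.
    by rewrite (_ : (4 * j) %/ 2 = 2 * j)%N//; clear; lia.
  by rewrite mulrCA -exprMn mulfV// expr1n mulr1.
have qle : ((4 * j)%:R + 4 <= 64 * gain R j :> R).
  rewrite /gain -natrX -natrM -natrD ler_nat.
  have : (q j < 2 ^ q j)%N by exact: ltn_expl.
  by move: (2 ^ _)%N => z; clear; lia.
apply: (@le_trans _ _ ((gain R j ^+ 2)^-1 * (64 * gain R j))).
  by rewrite ler_wpM2l ?invr_ge0 ?exprn_ge0 ?(ltW g0).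
rewrite exprVn -/(gain R j) le_eqVlt; apply/orP; left; apply/eqP.
by field; rewrite gt_eqF.
Qed.

(** [ae_bounded] controls all breakpoint sums by one random constant, and [corr_max_coarse] passes
    to the maximum. *)
Theorem ae_decorrelated : {ae P, forall w, exists2 C, 0 <= C & forall j k, (j <= k)%N ->
  \sum_(1 <= h < 2 ^ k.+1) corr_max (fun n => Y n w / n%:R) j k h ^+ 4
  <= C * 2 ^+ (k + 2 * j) * gain R j ^+ 8}.
Proof.
have total_bdd j k : bdd_meas (total j k).
  apply: bdd_measM; first exact: bdd_meas_cst.
  by apply: bdd_meas_sum => u _; exact: part_bdd.
have total_ge0 j k w : 0 <= total j k w.
  by rewrite mulr_ge0 ?invr_ge0 ?(ltW (nrm_gt0 _ _))// sumr_ge0.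
apply: filterS (ae_bounded total_bdd total_ge0 total_sum) => w [c hc].
have c0 : 0 <= c := le_trans (total_ge0 0 0 w)%N (hc 0 0)%N.
exists (8 * (12 * M ^+ 8 + c) + 2 ^+ 34 * M ^+ 8).
  by rewrite addr_ge0 ?mulr_ge0 ?exprn_ge0// addr_ge0// mulr_ge0// exprn_ge0.
move=> j k jk; pose d n : R := Y n w / n%:R.
have eM n : `|dyadic_weight d n| <= M by apply: dyadic_weight_le => m; exact: phiM.
have g0 := gain_gt0 R j.
have g1 : 1 <= gain R j by rewrite exprn_ege1// ler1n.
apply: (@le_trans _ _ (\sum_(1 <= h < 2 ^ k.+1) 8 * (\sum_(u < (2 ^ (6 * q j)).+1)
     (\sum_(2 ^ j <= n < brk j u) pair_corr d k h n) ^+ 4 + ((coarse_step j)%:R * M ^+ 2) ^+ 4))).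
  by apply: ler_sum => h _; exact: corr_max_coarse.
rewrite -mulr_sumr big_split/= exchange_big/=.
have -> : \sum_(u < (2 ^ (6 * q j)).+1) \sum_(1 <= h < 2 ^ k.+1)
    (\sum_(2 ^ j <= n < brk j u) pair_corr d k h n) ^+ 4 =
    \sum_(u < (2 ^ (6 * q j)).+1) pow4_sum j k (brk j u) w.
  apply: eq_bigr => u _; apply: eq_bigr => h _; congr (_ ^+ 4); apply: eq_bigr => n _.
  exact: pair_corr_coef.
have S1 : \sum_(u < (2 ^ (6 * q j)).+1) pow4_sum j k (brk j u) w <=
    (12 * M ^+ 8 + c) * nrm j k.
  rewrite mulrDl.
  apply: (@le_trans _ _ (\sum_(u < (2 ^ (6 * q j)).+1)
     (6 * M ^+ 8 * 2 ^+ (k + 2 * j) + part j k u w))).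
    apply: ler_sum => u _; rewrite /part; case: ifP => _.
      by rewrite lerDr mulr_ge0 ?exprn_ge0// mulr_ge0// exprn_ge0.
    apply: le_trans (pow4_sum_le _ _ _) _; first by rewrite /brk addKn; exact: brk_le.
    rewrite lerD2r exprD (exprS _ k) le_eqVlt; apply/orP; left; apply/eqP; ring.
  rewrite big_split/=; apply: lerD; last first.
    by have := hc j k; rewrite /total ler_pdivrMl// mulrC.
  rewrite sumr_const card_ord -[leLHS]mulr_natl.
  apply: (@le_trans _ _ (2 * gain R j ^+ 8 * (6 * M ^+ 8 * 2 ^+ (k + 2 * j)))).
    rewrite ler_wpM2r ?mulr_ge0 ?exprn_ge0//; apply: le_trans (count_le j) _.
    by rewrite ler_wpM2l// ler_weXn2l.
  by rewrite /nrm le_eqVlt; apply/orP; left; apply/eqP; ring.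
(* From [j <= 16 * q j + 15] the exponent [4 * (j - 6 * q j)] is at most [2 * j + 8 * q j + 30]; one
   more factor 2 comes from [2 ^ k.+1]. *)
have S2 : \sum_(1 <= h < 2 ^ k.+1) ((coarse_step j)%:R * M ^+ 2) ^+ 4 <= 2 ^+ 31 * M ^+ 8 * nrm j k.
  rewrite sumr_const_nat -[leLHS]mulr_natl.
  apply: (@le_trans _ _ (2 ^+ k.+1 * (2 ^+ (2 * j + 8 * q j + 30) * M ^+ 8))).
    apply: ler_pM => //.
    - by rewrite exprn_ge0// mulr_ge0// exprn_ge0.
    - by rewrite -natrX ler_nat leq_subr.
    rewrite exprMn -exprM ler_wpM2r ?exprn_ge0// /coarse_step natrX -exprM ler_weXn2l ?ler1n//.
    by clear; lia.
  have E : 2 ^+ k.+1 * 2 ^+ (2 * j + 8 * q j + 30) =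
     2 ^+ 31 * (2 ^+ (k + 2 * j) * 2 ^+ (q j * 8)) :> R.
    by rewrite -!exprD; congr (_ ^+ _); clear; lia.
  rewrite /nrm /gain -exprM mulrA E;
   move: (2 ^+ 31) (2 ^+ (q j * 8)) (2 ^+ (k + 2 * j)) => z1 z2 z3.
  by rewrite le_eqVlt; apply/orP; left; apply/eqP; ring.
apply: (@le_trans _ _ (8 * ((12 * M ^+ 8 + c) * nrm j k + 2 ^+ 31 * M ^+ 8 * nrm j k))).
  by rewrite ler_wpM2l// lerD.
have -> : 2 ^+ 34 = 8 * 2 ^+ 31 :> R.
  by rewrite (exprD _ 3 31) (_ : 8 = 2 ^+ 3)// !exprS expr0; ring.
rewrite /nrm le_eqVlt; apply/orP; left; apply/eqP.
by move: (2 ^+ 31) => z; ring.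
Qed.

End Decorrelation.

(** * Transference to measure-preserving systems *)

(** The [y < m] have truncated difference 0 and vanish with [v 0]; the window starting at [m] fits
    into [D]. *)
Lemma sum_shift (R : realType) (v u : nat -> R) (D m N : nat) : v 0%N = 0 -> (m + N <= D)%N ->
  \sum_(y < D) u y * v (y - m)%N * (y - m < N)%N%:R = \sum_(n < N) v n * u (n + m)%N.
Proof.
move=> v0 mND.
rewrite -(big_mkord xpredT (fun y => u y * v (y - m)%N * (y - m < N)%N%:R)).
rewrite (@big_cat_nat _ _ _ m)//=; last by apply: leq_trans mND; exact: leq_addr.
rewrite big_nat big1 ?add0r; last first.
  by move=> y /andP[_ ym]; rewrite (_ : y - m = 0)%N ?v0 ?mulr0 ?mul0r//; lia.
rewrite (@big_cat_nat _ _ _ (m + N))//= ?leq_addr//.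
rewrite [X in _ + X]big_nat [X in _ + X]big1 ?addr0; last first.
  move=> y /andP[my _]; rewrite (_ : (y - m < N)%N = false) ?mulr0//.
  by apply/negbTE; rewrite -leqNgt; lia.
rewrite -{1}[m]add0n big_addn addKn big_mkord; apply: eq_bigr => n _.
by rewrite addnK ltn_ord mulr1 mulrC.
Qed.

Lemma sume_ord_const (R : realType) (x : \bar R) (n : nat) : (0 <= x)%E ->
  (\sum_(i < n) x = n%:R%:E * x)%E.
Proof.
move=> x0; elim: n => [|n ih]; first by rewrite big_ord0 mul0e.
by rewrite big_ord_recr/= ih -natr1 EFinD ge0_muleDl ?lee_fin// mul1e.
Qed.

Section Transference.
Context (d : measure_display) (T : measurableType d) (R : realType)
  (mu : {measure set T -> \bar R}).
Variable S : T -> T.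
Hypothesis mS : measurable_fun setT S.
Hypothesis preserving : forall A, measurable A -> mu (S @^-1` A) = mu A.

Lemma measurable_iter n : measurable_fun setT (iter n S).
Proof.
elim: n => [|n ih]; first exact: measurable_id.
by rewrite (_ : iter n.+1 S = S \o iter n S)//; exact: measurableT_comp.
Qed.

Lemma measurable_preimage_iter n A : measurable A -> measurable (iter n S @^-1` A).
Proof. by move=> mA; rewrite -[X in measurable X]setTI; exact: measurable_iter. Qed.

Lemma preserving_iter n A : measurable A -> mu (iter n S @^-1` A) = mu A.
Proof.
elim: n A => // n ih A mA.
rewrite (_ : iter n.+1 S @^-1` A = iter n S @^-1` (S @^-1` A))//.
rewrite ih ?preserving//.
by rewrite -[X in measurable X]setTI; exact: mS.
Qed.

Lemma integral_iter n (g : T -> \bar R) : measurable_fun setT g ->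
  (forall x, 0 <= g x)%E -> (\int[mu]_x g (iter n S x) = \int[mu]_x g x)%E.
Proof.
move=> mg g0.
have := @ge0_integral_pushforward _ _ _ _ _ _ (measurable_iter n) mu setT g measurableT mg.
rewrite preimage_setT => <-; last by move=> x _.
apply: eq_measure_integral; first exact: measurable_iter.
by move=> mh A mA _; exact: preserving_iter.
Qed.

Variables (v : nat -> R) (thr C : R) (f : T -> R).
Hypothesis v0 : v 0%N = 0.
Hypothesis C0 : 0 <= C.
Hypothesis f_int : mu.-integrable setT (EFin \o f).

Definition exceed (n0 : nat) : set T :=
  [set x | exists2 N, (N <= n0)%N & thr < `|\sum_(n < N) v n * f (iter n S x)|].

Let mf : measurable_fun setT f.
Proof. by apply/measurable_EFinP; exact: measurable_int f_int. Qed.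

Lemma exceed_measurable n0 : measurable (exceed n0).
Proof.
rewrite (_ : exceed n0 = \bigcup_(N in [set N | (N <= n0)%N])
   [set x | thr < `|\sum_(n < N) v n * f (iter n S x)|]); last first.
  by apply/seteqP; split => x /=; [move=> [N]; exists N|move=> [N /= Nn h]; exists N].
apply: bigcup_measurable => N _.
set g := fun x => `|\sum_(n < N) v n * f (iter n S x)|.
suff mg : measurable_fun setT g.
  rewrite (_ : [set x | _] = setT `&` g @^-1` `]thr, +oo[%classic); last first.
    by rewrite setTI; apply/seteqP; split => x; rewrite /= in_itv/= andbT.
  by apply: mg => //; exact: measurable_itv.
apply: measurableT_comp => //.
apply: (@measurable_sum _ _ _ _ _ _ (fun (n : 'I_N) (x : T) => v n * f (iter n S x))) => n.
apply: measurable_realfun.measurable_funM; first exact: measurable_cst.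
by apply: measurableT_comp => //; exact: measurable_iter.
Qed.

Let mass := fine (\int[mu]_x `|f x|%:E).

Lemma mass_ge0 : 0 <= mass.
Proof. by rewrite fine_ge0// integral_ge0. Qed.

Lemma massE : (\int[mu]_x `|f x|%:E = mass%:E)%E.
Proof.
rewrite /mass fineK// ge0_fin_numE; last exact: integral_ge0.
by have /integrableP[_] := f_int.
Qed.

(* Calderon's transference: a bound on orbits is averaged over the system. *)
Lemma transfer (n0 : nat) : (0 < n0)%N ->
  (forall x, \sum_(m < n0 + n0) (`[< exists N, thr < `|\sum_(y < n0 + n0)
     f (iter y S x) * v (y - m) * (y - m < N)%N%:R| >])%:R
     <= C * \sum_(y < n0 + n0) `|f (iter y S x)|) ->
  (mu (exceed n0) <= (2 * C * mass)%:E)%E.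
Proof.
move=> n00 orbit.
have mE := exceed_measurable n0.
have mEm m : measurable (iter m S @^-1` exceed n0) by exact: measurable_preimage_iter.
(* Starting points [m < n0] and sums of length at most [n0] stay in an orbit segment of length
   [n0 + n0]; this doubling is the factor 2. *)
have key : (n0%:R%:E * mu (exceed n0) <= (n0%:R * (2 * C * mass))%:E)%E.
  apply: (@le_trans _ _ (\int[mu]_x (\sum_(m < n0) (\1_(iter m S @^-1` exceed n0) x)%:E))%E).
    rewrite ge0_integral_sum//; last first.
      by move=> m; apply/measurable_EFinP; exact: measurable_indic.
    rewrite (eq_bigr (fun=> mu (exceed n0))); last first.
      by move=> m _; rewrite integral_indic// setIT preserving_iter.
    by rewrite sume_ord_const.
  apply: (@le_trans _ _ (\int[mu]_x (\sum_(y < n0 + n0) (C * `|f (iter y S x)|)%:E))%E).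
    apply: ge0_le_integral => //.
    - by move=> x _; apply: sume_ge0 => m _; rewrite lee_fin.
    - apply: emeasurable_sum => m; apply/measurable_EFinP; exact: measurable_indic.
    - apply: emeasurable_sum => y; apply/measurable_EFinP.
      apply: measurable_realfun.measurable_funM; first exact: measurable_cst.
      apply: measurableT_comp => //; apply: measurableT_comp => //; exact: measurable_iter.
    move=> x _; rewrite !sumEFin lee_fin -mulr_sumr.
    apply: le_trans (orbit x).
    rewrite (big_ord_widen (n0 + n0) (fun m => \1_(iter m S @^-1` exceed n0) x) (leq_addr _ _)).
    rewrite big_mkcond/=; apply: ler_sum => m _; case: ifP => // mn0.
    rewrite indicE ler_nat; case: (boolP (x \in _)) => //; rewrite inE => -[N Nn h].
    rewrite asboolT//; exists N.
    rewrite (@sum_shift R v (fun y => f (iter y S x)))//; last by rewrite leq_add// ltnW.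
    by move: h; under eq_bigr do rewrite -iterD.
  rewrite ge0_integral_sum//; last 2 first.
  - move=> y; apply/measurable_EFinP.
    apply: measurable_realfun.measurable_funM; first exact: measurable_cst.
    apply: measurableT_comp => //; apply: measurableT_comp => //; exact: measurable_iter.
  - by move=> y x _; rewrite lee_fin mulr_ge0.
  rewrite (eq_bigr (fun=> (C * mass)%:E)); last first.
    move=> y _; rewrite (@integral_iter y (fun x => (C * `|f x|)%:E)).
    - under eq_integral do rewrite EFinM.
      rewrite ge0_integralZl_EFin//; first by rewrite massE.
      by apply/measurable_EFinP; apply: measurableT_comp.
    - apply/measurable_EFinP; apply: measurable_realfun.measurable_funM;
       first exact: measurable_cst.
      exact: measurableT_comp.
    - by move=> x; rewrite lee_fin mulr_ge0.
  rewrite sume_ord_const; last by rewrite lee_fin mulr_ge0 ?mass_ge0.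
  rewrite -EFinM lee_fin natrD.
  by rewrite le_eqVlt; apply/orP; left; apply/eqP; ring.
have n0R : 0 < n0%:R :> R by rewrite ltr0n.
(* [key] itself excludes infinite measure; only then can [n0] be cancelled. *)
have fin : mu (exceed n0) \is a fin_num.
  rewrite ge0_fin_numE//.
  have [E|neq] := eqVneq (mu (exceed n0)) +oo%E; last by rewrite ltey.
  by move: key; rewrite E gt0_muley ?lte_fin// leye_eq.
rewrite -(fineK fin) in key *.
by move: key; rewrite -EFinM !lee_fin ler_pM2l.
Qed.

End Transference.

(** * Almost everywhere convergence *)

Lemma cvgn_cauchy (R : realType) (u : nat -> R) :
  (forall e, 0 < e -> exists n0, forall n, (n0 <= n)%N -> `|u n - u n0| <= e) -> cvgn u.
Proof.
move=> h; apply/cauchy_cvgP; apply: cauchy_exP => e e0.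
have [n0 hn0] := h (e / 2) (divr_gt0 e0 (ltr0n _ 2)).
exists (u n0); exists n0 => // n /= n0n.
rewrite /ball/= distrC; apply: le_lt_trans (hn0 n n0n) _.
by rewrite ltr_pdivrMr// ltr_pMr// ltr1n.
Qed.

Lemma cvgn_cauchy_inv (R : realType) (u : nat -> R) : cvgn u ->
  forall e, 0 < e -> exists n0, forall n, (n0 <= n)%N -> `|u n - u n0| <= e.
Proof.
move=> cu e e0; have e2 : 0 < e / 2 by rewrite divr_gt0.
have /cvgrPdist_le/(_ _ e2) [n0 _ hn0] := cu.
exists n0 => n n0n.
rewrite -(subrKA (lim (u @ \oo))) (le_trans (ler_normD _ _))//.
rewrite [e]splitr lerD//; last by have := hn0 n0; rewrite /= leqnn; apply.
by rewrite distrC; exact: hn0.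
Qed.

Section Convergence.
Context (dT : measure_display) (T : measurableType dT) (R : realType)
  (mu : {measure set T -> \bar R}).
Variable S : T -> T.
Hypothesis mS : measurable_fun setT S.
Hypothesis preserving : forall A, measurable A -> mu (S @^-1` A) = mu A.

Definition modulated (v : nat -> R) (f : T -> R) (N : nat) (x : T) : R :=
  \sum_(n < N) v n * f (iter n S x).
Definition exceeds (v : nat -> R) (thr : R) (f : T -> R) : set T :=
  [set x | exists N, thr < `|modulated v f N x|].
Definition mass (f : T -> R) : R := fine (\int[mu]_x `|f x|%:E).

Lemma exceedsE v thr f : exceeds v thr f = \bigcup_K exceed S v thr f (2 ^ K).
Proof.
apply/seteqP; split => [x [N hN]|x [K _ [N _ hN]]]; last by exists N.
by exists N => //; exists N => //; apply: ltnW; exact: ltn_expl.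
Qed.

Section Integrable.
Variables (v : nat -> R) (thr : R) (f : T -> R).
Hypothesis f_int : mu.-integrable setT (EFin \o f).

Lemma exceeds_measurable : measurable (exceeds v thr f).
Proof.
by rewrite exceedsE; apply: bigcup_measurable => K _; exact: exceed_measurable f_int _.
Qed.

Lemma exceeds_le (c : R) : (forall K, mu (exceed S v thr f (2 ^ K)) <= c%:E)%E ->
  (mu (exceeds v thr f) <= c%:E)%E.
Proof.
move=> hc.
have mE K : measurable (exceed S v thr f (2 ^ K)) by exact: exceed_measurable f_int _.
have mU : measurable (\bigcup_K exceed S v thr f (2 ^ K)) by exact: bigcup_measurable.
have nd : {homo (fun K => exceed S v thr f (2 ^ K)) : n m / (n <= m)%N >-> (n <= m)%O}.
  move=> n m nm; apply/subsetPset => x [N Nn hN]; exists N => //.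
  by apply: leq_trans Nn _; rewrite leq_exp2l.
have cv := nondecreasing_cvg_mu (mu := mu) mE mU nd.
rewrite exceedsE -(cvg_lim _ cv)//; apply: lime_le; first
  by apply/cvg_ex; exists (mu (\bigcup_K exceed S v thr f (2 ^ K))).
by apply: nearW => K; exact: hc.
Qed.

Lemma exceeds_transfer (C : R) : v 0%N = 0 -> 0 <= C ->
  (forall (K : nat) x, \sum_(m < 2 ^ K) (`[< exists N, thr < `|\sum_(y < 2 ^ K)
     f (iter y S x) * v (y - m)%N * (y - m < N)%N%:R| >])%:R
     <= C * \sum_(y < 2 ^ K) `|f (iter y S x)|) ->
  (mu (exceeds v thr f) <= (2 * C * mass f)%:E)%E.
Proof.
move=> v0 C0 orbit; apply: exceeds_le => K.
apply: transfer => //; first by rewrite expn_gt0.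
by move=> x; have := orbit K.+1 x; rewrite expnS mul2n -addnn.
Qed.

End Integrable.

Lemma mass_scale (f : T -> R) (c : R) : mu.-integrable setT (EFin \o f) -> 0 <= c ->
  mass (fun x => f x * c) = mass f * c.
Proof.
move=> fi c0; rewrite /mass.
under eq_integral do rewrite normrM (ger0_norm c0) mulrC EFinM.
have mf : measurable_fun setT f by apply/measurable_EFinP; exact: measurable_int fi.
rewrite ge0_integralZl_EFin//; last by apply/measurable_EFinP; exact: measurableT_comp.
by rewrite massE// -EFinM/= mulrC.
Qed.

Lemma integrable_scale (f : T -> R) (c : R) : mu.-integrable setT (EFin \o f) ->
  mu.-integrable setT (EFin \o (fun x => f x * c)).
Proof.
move=> fi; rewrite (_ : _ \o _ = (fun x => (c%:E * (EFin \o f) x)%E)); first exact: integrableZl.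
by apply/funext => x; rewrite /= mulrC EFinM.
Qed.

Lemma exceeds_scale (v : nat -> R) (thr c : R) (f : T -> R) : 0 < c ->
  exceeds v thr (fun x => f x * c) = exceeds v (thr / c) f.
Proof.
move=> c0.
have E N x : `|modulated v (fun x => f x * c) N x| = `|modulated v f N x| * c.
  rewrite -[X in _ = _ * X](gtr0_norm c0) -normrM /modulated mulr_suml.
  by congr `|_|; apply: eq_bigr => n _; rewrite mulrA.
by apply/seteqP; split => x [N hN]; exists N; move: hN; rewrite E ltr_pdivrMr.
Qed.

Variables (d : nat -> R) (M C : R).
Hypothesis d0 : d 0%N = 0.
Hypothesis eM : forall n, `|dyadic_weight d n| <= M.
Hypothesis C0 : 0 <= C.
Hypothesis decorrelated : forall j k, (j <= k)%N ->
  \sum_(1 <= h < 2 ^ k.+1) corr_max d j k h ^+ 4 <= C * 2 ^+ (k + 2 * j) * gain R j ^+ 8.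

Let M0 : 0 <= M := M_ge0 eM.
Let cc : R := core_const M C.
Let cc0 : 0 <= cc. Proof. exact: core_const_ge0. Qed.
Let W : R := (2 + 6 * M) * 192.
Let W0 : 0 < W. Proof. by rewrite mulr_gt0// ltr_pwDl// mulr_ge0. Qed.
Let Cw : R := 3 + 192 * cc.
Let Cw0 : 0 <= Cw. Proof. by rewrite addr_ge0// mulr_ge0. Qed.

(** [weak_type] has the fixed threshold [W]; scaling [f] reaches every other one. *)
Lemma weak_type_system (f : T -> R) (thr : R) : mu.-integrable setT (EFin \o f) ->
  0 < thr -> (mu (exceeds d thr f) <= (2 * Cw * (mass f * (W / thr)))%:E)%E.
Proof.
move=> fi t0.
have c0 : 0 < W / thr by rewrite divr_gt0.
have -> : exceeds d thr f = exceeds d W (fun x => f x * (W / thr)).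
  by rewrite exceeds_scale// invf_div mulrC divfK// gt_eqF.
rewrite -mass_scale ?(ltW c0)//.
apply: exceeds_transfer => //; first exact: integrable_scale.
by move=> K x; exact: (weak_type d0 eM C0 decorrelated K (fun y => f (iter y S x) * (W / thr))).
Qed.

(** * Convergence for bounded functions *)

Definition block_weight (k n : nat) : R := d n * (blk n == k)%:R.
Let thr (k : nat) : R := (2 + 6 * M) / 2 ^+ (k %/ 96).

Lemma block_maximal_system (k : nat) (f : T -> R) : mu.-integrable setT (EFin \o f) ->
  (forall x, `|f x| <= 1) ->
  (mu (exceeds (block_weight k) (thr k) f) <= (2 * (cc / 2 ^+ (k %/ 96)) * mass f)%:E)%E.
Proof.
move=> fi f1; apply: exceeds_transfer => //; first by rewrite /block_weight d0 mul0r.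
  by rewrite divr_ge0 ?exprn_ge0.
move=> K x.
have := block_maximal d0 eM C0 decorrelated k (2 ^ K) (fun y => f1 (iter y S x)).
apply: le_trans; apply: ler_sum => m _; rewrite ler_nat.
case: asboolP => [[N hN]|]//; rewrite asboolT//; exists N; move: hN; congr (_ < `|_|).
by apply: eq_bigr => y _; rewrite /block_weight -mulnb natrM; ring.
Qed.

(** [n < N] forces [blk n < N], so [k < N] covers every block met, and the indices below [2 ^ k1]
    lie in blocks below [k1]. *)
Lemma modulated_blocks (f : T -> R) (x : T) (k1 N : nat) : (2 ^ k1 <= N)%N ->
  modulated d f N x - modulated d f (2 ^ k1) x =
  \sum_(k1 <= k < N) modulated (block_weight k) f N x.
Proof.
move=> kN; rewrite /modulated.
rewrite -!(big_mkord xpredT (fun n => d n * f (iter n S x))).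
rewrite (@big_cat_nat _ _ _ (2 ^ k1) 0 N)//= [LHS]addrC addKr.
under [RHS]eq_bigr do rewrite -(big_mkord xpredT (fun n => block_weight _ n * f (iter n S x))).
rewrite exchange_big/= [RHS](@big_cat_nat _ _ _ (2 ^ k1) 0 N)//=.
rewrite [X in _ = X + _]big_nat [X in _ = X + _]big1 ?add0r; last first.
  move=> n /andP[_ nk]; rewrite big_nat big1// => k /andP[k1k _].
  rewrite /block_weight; have [->|n0] := posnP n; first by rewrite d0 !mul0r.
  have /andP[h _] := blk_bounds n0.
  rewrite (_ : (blk n == k) = false) ?mulr0 ?mul0r//; apply/eqP => E.
  have : (2 ^ k1 < 2 ^ k1)%N.
    by apply: leq_ltn_trans nk; apply: leq_trans h; rewrite leq_exp2l// E.
  by rewrite ltnn.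
rewrite !big_nat; apply: eq_bigr => n /andP[kn nN].
have n0 : (0 < n)%N by apply: leq_trans kn; rewrite expn_gt0.
have /andP[h1 h2] := blk_bounds n0.
have b1 : (k1 <= blk n)%N by apply: trunc_log_max.
have b2 : (blk n < N)%N.
  by apply: leq_ltn_trans nN; apply: leq_trans h1; apply: ltnW; exact: ltn_expl.
rewrite (bigD1_seq (blk n)) ?iota_uniq ?mem_index_iota ?b1//=.
rewrite big1 ?addr0; first by rewrite /block_weight eqxx mulr1.
by move=> k kn'; rewrite /block_weight eq_sym (negbTE kn') mulr0 mul0r.
Qed.

(** Borel-Cantelli: the exceptional sets of the blocks have summable measures, and the thresholds
    are summable too, so almost every orbit has Cauchy partial sums. The maximal form of the block
    bound covers an incomplete last block. *)
Lemma ae_cvg_bounded1 (f : T -> R) : mu.-integrable setT (EFin \o f) ->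
  (forall x, `|f x| <= 1) -> {ae mu, forall x, cvgn (fun N => modulated d f N x)}.
Proof.
move=> fi f1.
pose E k := exceeds (block_weight k) (thr k) f.
have mE k : measurable (E k) by exact: exceeds_measurable.
have mass0 : 0 <= mass f by exact: mass_ge0.
have sumE : (\sum_(0 <= k <oo) mu (E k) < +oo)%E.
  apply: (@le_lt_trans _ _ (2 * cc * mass f * 192)%:E); last exact: ltry.
  apply: lime_le; first by apply: is_cvg_nneseries => n _ _; exact: measure_ge0.
  apply: nearW => n.
  apply: (@le_trans _ _ (\sum_(0 <= k < n) (2 * cc * mass f * 2^-1 ^+ (k %/ 96))%:E)%E).
    apply: lee_sum => k _; apply: le_trans (block_maximal_system k fi f1) _.
    by rewrite lee_fin exprVn le_eqVlt; apply/orP; left; apply/eqP; ring.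
  rewrite sumEFin lee_fin -mulr_sumr ler_wpM2l ?mulr_ge0//.
  by apply: le_trans (sum_geo_floor R _ _ _) _ => //; rewrite div0n expr0 mulr1.
have null := lim_sup_set_cvg0 mE sumE.
exists (lim_sup_set E); split => //.
  apply: bigcapT_measurable => n; apply: bigcup_measurable => k _; exact: mE.
move=> x /= ncv; apply: contrapT => nlim; apply: ncv.
have [k0 hk0] : exists k0, forall k, (k0 <= k)%N -> ~ E k x.
  apply: contrapT => /forallNP h; apply: nlim => n _.
  have /existsNP[k /not_implyP[nk /contrapT Ek]] := h n.
  by exists k.
apply: cvgn_cauchy => e e0.
have [k1 [k01 hk1]] : exists k1, (k0 <= k1)%N /\ W / 2 ^+ (k1 %/ 96) <= e.
  pose r := Num.truncn (W / e).
  exists (maxn k0 (96 * r.+1)); split; first exact: leq_maxl.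
  rewrite ler_pdivrMr ?exprn_gt0// mulrC -ler_pdivrMr//.
  have /andP[_ hr] := truncn_itv (divr_ge0 (ltW W0) (ltW e0)).
  apply: (le_trans (ltW hr)); apply: (@le_trans _ _ (2 ^+ r.+1)).
    by rewrite -natrX ler_nat ltnW// ltn_expl.
  rewrite ler_weXn2l ?ler1n// leq_divRL// mulnC leq_maxr//.
exists (2 ^ k1)%N => N kN.
rewrite modulated_blocks//; apply: le_trans (ler_norm_sum _ _ _) _; apply: le_trans hk1.
apply: (@le_trans _ _ (\sum_(k1 <= k < N) (2 + 6 * M) * 2^-1 ^+ (k %/ 96))).
  rewrite !big_nat; apply: ler_sum => k /andP[k1k _].
  rewrite leNgt; apply/negP => h; apply: (hk0 k); first exact: leq_trans k1k.
  by exists N; rewrite /thr -exprVn.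
rewrite -mulr_sumr /W -[leRHS]mulrA ler_wpM2l ?addr_ge0 ?mulr_ge0//.
by apply: le_trans (sum_geo_floor R _ _ _) _ => //; rewrite exprVn.
Qed.

Lemma ae_cvg_bounded (f : T -> R) (B : R) : mu.-integrable setT (EFin \o f) ->
  0 < B -> (forall x, `|f x| <= B) -> {ae mu, forall x, cvgn (fun N => modulated d f N x)}.
Proof.
move=> fi B0 fB.
have := @ae_cvg_bounded1 (fun x => f x * B^-1) (integrable_scale _ fi).
have h x : `|f x * B^-1| <= 1.
  by rewrite normrM (gtr0_norm (x := B^-1)) ?invr_gt0// ler_pdivrMr// mul1r.
move=> /(_ h); apply: filterS => x cv.
rewrite (_ : (fun N => _) = (fun N => B * modulated d (fun x => f x * B^-1) N x)).
  exact: is_cvgMr.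
apply/funext => N; rewrite /modulated mulr_sumr; apply: eq_bigr => n _.
by rewrite [RHS]mulrCA; congr (_ * _); rewrite mulrC divfK// gt_eqF.
Qed.

(** Banach principle: truncate [f] at height [r.+1]. The bounded part converges almost everywhere;
    the rest has small mass by dominated convergence, hence a small maximal function off a small
    set. *)
Theorem ae_cvg_modulated (f : T -> R) : mu.-integrable setT (EFin \o f) ->
  {ae mu, forall x, cvgn (fun N => modulated d f N x)}.
Proof.
move=> fi.
have mf : measurable_fun setT f by apply/measurable_EFinP; exact: measurable_int fi.
pose A (r : nat) : set T := [set x | `|f x| <= r.+1%:R].
have mA r : measurable (A r).
  rewrite (_ : A r = setT `&` (fun x => `|f x|) @^-1` `]-oo, r.+1%:R]%classic); last first.
    by rewrite setTI; apply/seteqP; split => x; rewrite /A /= in_itv/=.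
  have mnf : measurable_fun setT (fun x => `|f x|) by exact: measurableT_comp.
  by apply: mnf => //; exact: measurable_itv.
pose g r x := f x * \1_(A r) x.
pose h r x := f x * \1_(~` A r) x.
have ind_le (D : set T) x : \1_D x <= 1 :> R by rewrite indicE lern1 leq_b1.
have int_ind (D : set T) : measurable D -> mu.-integrable setT (EFin \o (fun x => f x * \1_D x)).
  move=> mD; apply: (le_integrable measurableT _ _ fi).
    apply/measurable_EFinP; apply: measurable_realfun.measurable_funM; first exact: mf.
    exact: measurable_indic.
  by move=> x _; rewrite /= lee_fin normrM ler_piMr// ger0_norm.
have gi r : mu.-integrable setT (EFin \o g r) by exact: int_ind.
have hi r : mu.-integrable setT (EFin \o h r) by apply: int_ind; exact: measurableC.
have gB r x : `|g r x| <= r.+1%:R.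
  rewrite /g indicE; case: (boolP (x \in A r)) => [|_]; last by rewrite mulr0 normr0.
  by rewrite inE mulr1.
have fgh r x : f x = g r x + h r x.
  rewrite /g /h -mulrDr !indicE in_setC.
  by case: (x \in A r); rewrite ?addr0 ?add0r mulr1.
have small e : 0 < e -> exists r, mass (h r) <= e.
  move=> e0.
  have ai := integrable_norm fi.
  pose hn r (x : T) : R := `|h r x|.
  have mh r : measurable_fun setT (EFin \o hn r).
    apply/measurable_EFinP; apply: measurableT_comp => //.
    by apply/measurable_EFinP; exact: measurable_int (hi r).
  have h0 x : setT x -> (EFin \o hn r) x @[r --> \oo] --> (cst 0%E : T -> \bar R) x.
    move=> _; apply: cvg_near_cst.
    exists (Num.truncn `|f x|) => // r /= hr.
    rewrite /= /hn /h indicE memNset ?mulr0 ?normr0//=; apply; rewrite /A/=.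
    have /andP[_ h2] := truncn_itv (normr_ge0 (f x)).
    by rewrite (le_trans (ltW h2))// ler_nat ltnS.
  have hf (r : nat) (x : T) : setT x -> (`|(EFin \o hn r) x| <= (`|f x|%R%:E))%E.
    by move=> _; rewrite /= lee_fin /hn normr_id /h normrM ler_piMr// ger0_norm.
  have fin (x : T) : setT x -> (EFin \o (Num.Def.normr \o f)) x \is a fin_num by [].
  have := @dominated_cvg _ _ _ mu setT measurableT _ _ _ mh h0 fin ai hf.
  rewrite integral_cst// mul0e => /fine_cvgP[_ /cvgrPdist_le/(_ _ e0)[r _ hr]].
  exists r; have := hr r (leqnn r); rewrite /= sub0r normrN.
  by apply: le_trans; exact: ler_norm.
pose thi i : R := i.+1%:R^-1.
(* Points where no truncation leaves a remainder with maximal function at most [thi i]. *)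
pose Bad i : set T := \bigcap_r exceeds d (thi i) (h r).
have mBad i : measurable (Bad i).
  by apply: bigcapT_measurable => r; exact: exceeds_measurable.
have BadNull i : mu (Bad i) = 0%E.
  apply/eqP; rewrite eq_le measure_ge0 andbT; apply/lee_addgt0Pr => e e0; rewrite add0e.
  pose c := 2 * Cw * (W / thi i).
  have c0 : 0 < c + 1.
    apply: ltr_wpDl => //; apply: mulr_ge0; first exact: mulr_ge0 (ler0n _ 2) Cw0.
    by apply: divr_ge0; [exact: ltW|rewrite invr_ge0].
  have [r hr] := small (e / (c + 1)) (divr_gt0 e0 c0).
  apply: (@le_trans _ _ (mu (exceeds d (thi i) (h r)))).
    rewrite le_measure ?inE//; first exact: exceeds_measurable.
    exact: bigcap_inf.
  have ti : 0 < thi i by rewrite invr_gt0.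
  apply: le_trans (weak_type_system (hi r) ti) _; rewrite lee_fin.
  apply: (@le_trans _ _ (c * mass (h r))).
    by rewrite /c le_eqVlt; apply/orP; left; apply/eqP; ring.
  apply: (@le_trans _ _ ((c + 1) * mass (h r))).
    by rewrite ler_wpM2r ?mass_ge0// lerDl.
  by rewrite mulrC -ler_pdivlMr.
have conv r : {ae mu, forall x, cvgn (fun N => modulated d (g r) N x)}.
  exact: (ae_cvg_bounded (gi r) (ltr0Sn _ _) (gB r)).
have BadAll : mu.-negligible (\bigcup_i Bad i).
  by apply: negligible_bigcup => i; apply/negligibleP; [exact: mBad|exact: BadNull].
have ConvAll : mu.-negligible (\bigcup_r ~` [set x | cvgn (fun N => modulated d (g r) N x)]).
  by apply: negligible_bigcup => r; exact: conv.
apply: negligibleS (negligibleU BadAll ConvAll) => x /= ncv.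
apply: contrapT => /not_orP[nBad nConv]; apply: ncv.
apply: cvgn_cauchy => e e0.
pose i := Num.truncn (3 / e).
have ti : thi i <= e / 3.
  have /andP[_ hr] := truncn_itv (divr_ge0 (ler0n R 3) (ltW e0)).
  by rewrite /thi -invf_div lef_pV2 ?posrE ?divr_gt0 ?ltr0n// ltW.
have [r hr] : exists r, forall N, `|modulated d (h r) N x| <= thi i.
  apply: contrapT => /forallNP nh; apply: nBad; exists i => // r _.
  have /existsNP[N /negP] := nh r; rewrite -ltNge => hN.
  by exists N.
have gcv : cvgn (fun N => modulated d (g r) N x).
  by apply: contrapT => ng; apply: nConv; exists r.
have e3 : 0 < e / 3 by rewrite divr_gt0.
have [n0 hn0] := cvgn_cauchy_inv gcv e3.
exists n0 => n n0n.
have fE N : modulated d f N x = modulated d (g r) N x + modulated d (h r) N x.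
  by rewrite /modulated -big_split/=; apply: eq_bigr => k _; rewrite (fgh r) mulrDr.
rewrite !fE opprD addrACA.
have -> : e = e / 3 + (e / 3 + e / 3) by field.
rewrite (le_trans (ler_normD _ _))// lerD ?hn0//.
by rewrite (le_trans (ler_normB _ _))// lerD// (le_trans (hr _)).
Qed.

End Convergence.

(** * From independent variables to every measure-preserving system *)

Theorem corollary1p10 (R : realType) (dO : measure_display)
    (Omega : measurableType dO) (P : probability Omega R)
    (X : nat -> {RV P >-> R})
    (X_bounded : uniformly_bounded [set n | (1 <= n)%N] X)
    (X_indep : mutually_independent [set n | (1 <= n)%N] X)
    (X_mean0 : forall n, (1 <= n)%N -> ('E_P[X n] = 0)%E) :
  {ae P, forall w,
    forall (d : measure_display) (T : measurableType d)
      (mu : {measure set T -> \bar R}) (tau : int -> T -> T),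
      measure_preserving_system mu tau ->
    forall f : T -> R, mu.-integrable setT (EFin \o f) ->
      {ae mu, forall x,
        cvgn (fun N => \sum_(1 <= n < N.+1) X n w / n%:R * translate tau n f x)}}.
Proof.
(* The given bound holds almost everywhere; truncating by [phi] makes it hold everywhere and changes
   the variables only on a null set, so the means stay zero. *)
have [M' hM'] := X_bounded; pose M := `|M'|.
pose phi (t : R) : R := t * \1_(`[- M, M]%classic : set R) t.
have phiE t : `|t| <= M -> phi t = t.
  by move=> tM; rewrite /phi indicE mem_set ?mulr1//= in_itv/= -ler_norml.
have phiM t : `|phi t| <= M.
  rewrite /phi indicE; case: (boolP (t \in _)) => [|_]; last by rewrite mulr0 normr0 normr_ge0.
  by rewrite inE/= in_itv/= mulr1 -ler_norml.
have mphi : measurable_fun setT phi.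
  by apply: measurable_realfun.measurable_funM => //; exact: measurable_indic.
have ae_phi : {ae P, forall w, forall n, (0 < n)%N -> phi (X n w) = X n w}.
  apply: ae_foralln => n.
  have [->|n0] := posnP n; first by apply: aeW.
  apply: filterS (hM' n n0) => w hw _; apply: phiE.
  exact: le_trans hw (ler_norm _).
have Ephi n : (0 < n)%N -> Ex P (fun w => phi (X n w)) = 0.
  move=> n0; rewrite /Ex /Rintegral.
  rewrite (_ : (\int[P]_w (phi (X n w))%:E)%E = 'E_P[X n]%E); first by rewrite X_mean0.
  rewrite expectation_def; apply: ae_eq_integral => //.
  - apply/measurable_EFinP; apply: (measurableT_comp mphi); exact: measurable_funPT.
  - by apply/measurable_EFinP; exact: measurable_funPT.
  - by apply: filterS ae_phi => w hw _; rewrite hw.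
have := ae_decorrelated X_indep (fun n n0 => n0) mphi phiM Ephi.
(* Here [w] is fixed outside a null set determined by the [X n] alone, before any system or function
   appears. *)
apply: filterS2 ae_phi => w hphi [C C0 decor].
move=> d T mu tau [_ _ [_ _ mtau ptau]] f fi.
pose c n : R := phi (X n w) / n%:R.
have c0 : c 0%N = 0 by rewrite /c invr0 mulr0.
have cM n : `|dyadic_weight c n| <= M by apply: dyadic_weight_le => m; exact: phiM.
have := ae_cvg_modulated (mtau 1) (ptau 1) c0 cM C0 decor fi.
apply: filterS => x cv.
(* [modulated] also contains the index 0, where [c 0 = 0] because the inverse of 0 is 0. *)
rewrite (_ : (fun N => _) = (fun N => modulated (tau 1) c f N.+1 x)).
  apply/cvg_ex; exists (limn (fun N => modulated (tau 1) c f N x)).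
  by rewrite (cvg_shiftS (fun N => modulated (tau 1) c f N x)).
apply/funext => N; rewrite /modulated -(big_mkord xpredT (fun n => c n * f (iter n (tau 1) x))).
rewrite big_ltn// c0 mul0r add0r !big_nat; apply: eq_bigr => n /andP[n0 _].
by rewrite /c hphi.
Qed.
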